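(* Let $\boldsymbol Y=\boldsymbol\theta^*+\boldsymbol\xi$, where $\boldsymbol\theta^*\in\mathbb R^n$ is the true signal and $\boldsymbol\xi$ is a random noise vector in $\mathbb R^n$. Let $\pi_0$ be a probability distribution supported by $S_0\subset\mathbb R^n$ with a diameter measured in sup-norm bounded by $\mathcal D_0$. Assume that the distribution of $\boldsymbol\xi$ satisfies the following assumption: for some sigma-algebra $\mathcal F$, for some $b:[0,1]\to[0,\infty)$ and some continuously differentiable function $v:[0,1]\to[0,\infty)$ vanishing at the origin, for every $\alpha\in(0,1]$, there exists an $n$-dimensional random vector $\boldsymbol\zeta=(\zeta_1,\ldots,\zeta_n)^\top$ such that $$\mathbf E[\boldsymbol\zeta\,|\,\mathcal F]=0,\qquad \boldsymbol\xi+\boldsymbol\zeta\stackrel{\mathscr D}{=}(1+\alpha)\boldsymbol\xi,$$ and, conditionally to $\mathcal F$, the entries $\zeta_i$ are independent and satisfy the $(v(\alpha),b(\alpha))$-Bernstein condition. Let $\hat{\boldsymbol\theta}$ be the exponentially weighted aggregate with prior $\pi_0$ and tuning parameter $\beta>0$, and let $\hat\pi$ be the corresponding posterior distribution. Then, for every $\beta\ge 2b(0)\mathcal D_0$, we have $$\mathbf E\big[\|\hat{\boldsymbol\theta}-\boldsymbol\theta^*\|^2\big]\le \inf_{\pi}\bigg\{\int_{\mathbb R^n}\|\boldsymbol\theta-\boldsymbol\theta^*\|^2\,\pi(d\boldsymbol\theta)+\beta D_{\rm KL}(\pi\|\pi_0)\bigg\}+\bigg(\frac{2v'(0)}{\beta-2b(0)\mathcal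 D_0}-1\bigg)\mathbf E\big[{\rm Var}_{\hat\pi}(\boldsymbol\theta)\big],$$ where the infimum is over all the probability distributions $\pi$ on $\mathbb R^n$. As a consequence, for $\beta\ge 2v'(0)+2b(0)\mathcal D_0$, we get $$\mathbf E\big[\|\hat{\boldsymbol\theta}-\boldsymbol\theta^*\|^2\big]\le \inf_{\pi}\bigg\{\int_{\mathbb R^n}\|\boldsymbol\theta-\boldsymbol\theta^*\|^2\,\pi(d\boldsymbol\theta)+\beta D_{\rm KL}(\pi\|\pi_0)\bigg\}.$$
   Context: $\|\cdot\|$ and $\|\cdot\|_\infty$ are the Euclidean norm and the sup-norm on $\mathbb R^n$; $\stackrel{\mathscr D}{=}$ denotes equality in distribution. The vector $\boldsymbol\theta^*$ is deterministic and unknown; only $\boldsymbol Y$ is observed. For a tuning parameter $\beta>0$, the posterior distribution $\hat\pi$ and the exponentially weighted aggregate $\hat{\boldsymbol\theta}$ are defined by $$\frac{d\hat\pi}{d\pi_0}(\boldsymbol\theta)=\frac{\exp\{-\|\boldsymbol Y-\boldsymbol\theta\|^2/\beta\}}{\int_{\mathbb R^n}\exp\{-\|\boldsymbol Y-\boldsymbol u\|^2/\beta\}\,\pi_0(d\boldsymbol u)},\qquad \hat{\boldsymbol\theta}=\int_{\mathbb R^n}\boldsymbol\theta\,\hat\pi(d\boldsymbol\theta).$$ For a probability distribution $\pi$ on $\mathbb R^n$, ${\rm Var}_\pi(\boldsymbol\theta)=\int_{\mathbb R^n}\|\boldsymbol\theta\|^2\,\pi(d\boldsymbol\theta)-\|\int_{\mathbb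 R^n}\boldsymbol\theta\,\pi(d\boldsymbol\theta)\|^2$. For probability distributions $\mu$ and $\nu$ with $\mu$ absolutely continuous with respect to $\nu$, $D_{\rm KL}(\mu\|\nu)=\int\frac{d\mu}{d\nu}(x)\log\frac{d\mu}{d\nu}(x)\,\nu(dx)$ is the Kullback-Leibler divergence; it is $+\infty$ if $\mu$ is not absolutely continuous with respect to $\nu$. Bernstein condition: for $v\ge 0$ and $b\ge 0$, a random variable $\eta$ satisfies the $(v,b)$-Bernstein condition if $\mathbf E[e^{t\eta}]\le\exp\{\frac{vt^2}{2(1-b|t|)}\}$ for all $t\in(-1/b,1/b)$ (all $t\in\mathbb R$ if $b=0$). Conditionally to a sigma-algebra $\mathcal F$, it means that almost surely $\mathbf E[e^{t\eta}\,|\,\mathcal F]\le\exp\{\frac{vt^2}{2(1-b|t|)}\}$ for every $t\in\mathbb R$ such that $b|t|<1$. By convention, $0\cdot\infty=0$.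
   Formalization: It is assumed in addition that ξ is F-measurable and that limsup of b(α) as α→0+ is at most b(0); without these the claim fails (F trivial and ζ=αξ with ξ Gaussian; Laplace noise with b(0) set to 0). *)

(* Defs.v *)
(* MathComp-Analysis. The space R^n is [n.-tuple R], which carries the product
   sigma-algebra of the Borel sets of R. *)
From HB Require Import structures.
From mathcomp Require Import all_boot all_order all_algebra.
From mathcomp Require Import all_classical all_reals all_analysis.
From mathcomp Require Import measurable_realfun.

Set Implicit Arguments.
Unset Strict Implicit.
Unset Printing Implicit Defensive.

Import Order.TTheory GRing.Theory Num.Theory.
Import numFieldNormedType.Exports.

Local Open Scope classical_set_scope.
Local Open Scope ring_scope.

Section euclidean.
Context {R : realType} {n : nat}.
Implicit Types x y : n.-tuple R.

Definition vadd x y : n.-tuple R := [tuple tnth x i + tnth y i | i < n].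
Definition vsub x y : n.-tuple R := [tuple tnth x i - tnth y i | i < n].
Definition vscale (a : R) x : n.-tuple R := [tuple a * tnth x i | i < n].

Definition enorm x : R := Num.sqrt (\sum_(i < n) tnth x i ^+ 2).
Definition supnorm x : R := \big[Num.max/0]_(i < n) `|tnth x i|.

Definition sup_diam (S : set (n.-tuple R)) : \bar R :=
  ereal_sup [set r | exists x y, [/\ S x, S y & r = (supnorm (vsub x y))%:E]].

Lemma measurable_enorm_vsub y :
  measurable_fun [set: n.-tuple R] (fun x => enorm (vsub y x)).
Proof.
apply: (@measurableT_comp _ _ _ _ _ _ (@Num.sqrt R)).
  exact: (continuous_measurable_fun (@sqrt_continuous R)).
apply: measurable_sum => i.
apply: measurable_funX.
rewrite (_ : (fun x => _) = (fun x : n.-tuple R => tnth y i - tnth x i)).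
  by apply: measurable_funB => //; exact: measurable_tnth.
by apply/funext => x; rewrite tnth_mktuple.
Qed.

End euclidean.

Section vector_moments.
Context {R : realType} {n : nat}.
Local Open Scope ereal_scope.

Definition vec_mean (pi : {measure set (n.-tuple R) -> \bar R}) : n.-tuple R :=
  [tuple (\int[pi]_theta (tnth theta i))%R | i < n].

Definition vec_var (pi : {measure set (n.-tuple R) -> \bar R}) : \bar R :=
  \int[pi]_theta (enorm theta ^+ 2)%:E - (enorm (vec_mean pi) ^+ 2)%:E.

End vector_moments.

Section kullback_leibler.
Local Open Scope ereal_scope.

(* The integrand vanishes where the density does: lne 0 = -oo and 0 * -oo = 0. *)
Definition KL d (T : measurableType d) (R : realType) (mu nu : probability T R)
    : \bar R :=
  if `[< mu `<< nu >] then
    \int[nu]_x (Radon_Nikodym_SigmaFinite.f mu nu x *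
                lne (Radon_Nikodym_SigmaFinite.f mu nu x))
  else +oo.

End kullback_leibler.

Section posterior.
Context {R : realType} {n : nat}.
Variables (pi0 : probability (n.-tuple R) R) (beta : R) (y : n.-tuple R).

Definition gibbs_weight (theta : n.-tuple R) : R :=
  expR (- (enorm (vsub y theta) ^+ 2 / beta)).

Definition posterior_density (theta : n.-tuple R) : R :=
  gibbs_weight theta / \int[pi0]_u gibbs_weight u.

Definition posterior (A : set (n.-tuple R)) : \bar R :=
  (\int[pi0]_(theta in A) (posterior_density theta)%:E)%E.

Lemma gibbs_weight_gt0 theta : 0 < gibbs_weight theta.
Proof. exact: expR_gt0. Qed.

Lemma measurable_gibbs_weight : measurable_fun setT gibbs_weight.
Proof.
apply: measurableT_comp => //; apply: measurableT_comp => //.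
apply: measurable_funM => //; apply: measurable_funX.
exact: measurable_enorm_vsub.
Qed.

Lemma posterior_density_ge0 theta : 0 <= posterior_density theta.
Proof.
apply: divr_ge0; first exact/ltW/gibbs_weight_gt0.
by apply: Rintegral_ge0 => u _; exact/ltW/gibbs_weight_gt0.
Qed.

Lemma measurable_posterior_density : measurable_fun setT posterior_density.
Proof. by apply: measurable_funM => //; exact: measurable_gibbs_weight. Qed.

Let posterior0 : posterior set0 = 0%E.
Proof. by rewrite /posterior integral_set0. Qed.

Let posterior_ge0 A : (0 <= posterior A)%E.
Proof.
by apply: integral_ge0 => x _; rewrite lee_fin posterior_density_ge0.
Qed.

Let posterior_sigma_additive : semi_sigma_additive posterior.
Proof.
move=> /= F mF tF mUF; rewrite /posterior; apply: cvg_toP.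
  apply: ereal_nondecreasing_is_cvgn => m k mk.
  apply: lee_sum_nneg_natr => // j _ _; apply: integral_ge0 => /= x _.
  by rewrite lee_fin posterior_density_ge0.
rewrite ge0_integral_bigcup//=.
- apply/measurable_funTS/measurableT_comp => //.
  exact: measurable_posterior_density.
- by move=> x _; rewrite lee_fin posterior_density_ge0.
Qed.

HB.instance Definition _ := isMeasure.Build _ _ _ posterior
  posterior0 posterior_ge0 posterior_sigma_additive.

Definition ewa : n.-tuple R := vec_mean posterior.

End posterior.

Section posterior_total_mass.
Context {R : realType} {n : nat}.
Variables (pi0 : probability (n.-tuple R) R) (beta : R) (y : n.-tuple R).
Hypothesis beta_gt0 : 0 < beta.

Lemma gibbs_weight_le1 theta : gibbs_weight beta y theta <= 1.
Proof.
rewrite -[leRHS]expR0 ler_expR oppr_le0.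
by rewrite divr_ge0 ?sqr_ge0// ltW.
Qed.

Lemma integrable_gibbs_weight :
  pi0.-integrable setT (EFin \o gibbs_weight beta y).
Proof.
apply: (@le_integrable _ _ _ pi0 setT measurableT _ (EFin \o cst 1)).
- by apply/measurable_EFinP; exact: measurable_gibbs_weight.
- move=> x _ /=; rewrite lee_fin normr1 ger0_norm ?gibbs_weight_le1//.
  exact/ltW/gibbs_weight_gt0.
- exact: finite_measure_integrable_cst.
Qed.

Lemma posterior_setT : posterior pi0 beta y setT = 1%E.
Proof.
have i0 := integrable_gibbs_weight.
have Z0 : 0 < \int[pi0]_u gibbs_weight beta y u.
  rewrite lt_def Rintegral_ge0 ?andbT; last first.
    by move=> u _; exact/ltW/gibbs_weight_gt0.
  apply/eqP => Z0.
  have : (\int[pi0]_u `|(gibbs_weight beta y u)%:E| = 0)%E.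
    under eq_integral => u _.
      rewrite gee0_abs ?lee_fin; last exact/ltW/gibbs_weight_gt0.
      over.
    by rewrite -(fineK (integrable_fin_num measurableT i0)) [X in X%:E]Z0.
  move/ae_eq_integral_abs => /(_ measurableT).
  have mg : measurable_fun setT (EFin \o gibbs_weight beta y).
    exact: (measurable_int pi0).
  move=> /(_ mg) [N [mN N0 sub]].
  have : (pi0 setT <= pi0 N)%E.
    apply: le_measure; rewrite ?inE// => u _; apply: sub => /= /(_ I) [].
    by apply/eqP; rewrite gt_eqF// gibbs_weight_gt0.
  by rewrite N0 probability_setT lee_fin ler10.
rewrite /posterior /posterior_density.
under eq_integral do rewrite mulrC EFinM.
rewrite integralZl//.
rewrite -(fineK (integrable_fin_num measurableT i0)) -EFinM.
by rewrite -[X in _ * X]/(\int[pi0]_u gibbs_weight beta y u) mulVf ?gt_eqF.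
Qed.

End posterior_total_mass.

Section oracle.
Context {R : realType} {n : nat}.
Local Open Scope ereal_scope.

Definition oracle_bound (pi0 : probability (n.-tuple R) R) (beta : R)
    (theta_star : n.-tuple R) : \bar R :=
  ereal_inf [set \int[pi]_theta (enorm (vsub theta theta_star) ^+ 2)%:E
                 + beta%:E * KL pi pi0 | pi in [set: probability (n.-tuple R) R]].

End oracle.

Section conditioning.
Context {R : realType} d {Omega : measurableType d} (P : probability Omega R).
Variable F : set (set Omega).

Definition measurable_wrt d' (T : measurableType d') (f : Omega -> T) :=
  preimage_set_system setT f measurable `<=` F.

(* Z is a version of the conditional expectation E[X | F]. *)
Definition is_cond_exp (X Z : Omega -> R) : Prop :=
  [/\ P.-integrable setT (EFin \o X), P.-integrable setT (EFin \o Z),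
      measurable_wrt Z &
      forall A, F A ->
        (\int[P]_(w in A) (Z w)%:E = \int[P]_(w in A) (X w)%:E)%E].

(* P(zeta_i \in A_i for all i | F) = \prod_i P(zeta_i \in A_i | F) for all
   Borel sets A_i; some of the A_i may be the whole line. *)
Definition cond_independent n (zeta : Omega -> n.-tuple R) : Prop :=
  forall A : 'I_n -> set R, (forall i, measurable (A i)) ->
  exists q : 'I_n -> Omega -> R,
    (forall i, is_cond_exp \1_([set w | A i (tnth (zeta w) i)]) (q i)) /\
    is_cond_exp \1_([set w | forall i, A i (tnth (zeta w) i)])
                (fun w => \prod_(i < n) q i w).

(* [M t] is a version of E[exp(t eta) | F]. *)
Definition cond_bernstein (v b : R) (eta : Omega -> R) : Prop :=
  exists M : R -> Omega -> R,
    (forall t, b * `|t| < 1 -> is_cond_exp (fun w => expR (t * eta w)) (M t)) /\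
    {ae P, forall w, forall t, b * `|t| < 1 ->
      M t w <= expR (v * t ^+ 2 / (2 * (1 - b * `|t|)))}.

End conditioning.

Definition eq_in_distribution (R : realType) d d' (Omega : measurableType d)
    (T : measurableType d') (P : probability Omega R) (X Y : Omega -> T) : Prop :=
  forall A, measurable A -> pushforward P X A = pushforward P Y A.

(* [f'] is the derivative of [f] on [0, 1], one-sided at the endpoints. *)
Definition C1_01 (R : realType) (f f' : R -> R) : Prop :=
  (forall x, x \in `[0, 1] ->
     (fun y => (f y - f x) / (y - x)) @ within `[0, 1]%classic x^' --> f' x) /\
  {within `[0, 1]%classic, continuous f'}.

(* Main.v *)
(* Write u = theta - theta_star, let Z x be the integral of
   exp ((2 x.u - |u|^2) / beta) under pi0, and let m x be the mean of u under the
   corresponding tilted prior, so that at the noise x the aggregate is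
   theta_star + m x and ln Z is convex with gradient (2 / beta) m x. The
   nonnegativity of a relative entropy gives
     |m x|^2 + Var x <= 2 x.m x - beta ln Z x,
   and since xi is centred, the Donsker-Varadhan inequality bounds
   - beta E[ln Z xi] by the oracle term. There remains the noise term
   2 E[xi.m xi], to be compared with E[Var xi]. Convexity and the identity in law
   of (1 + alpha) xi and xi + zeta give, for any centre c = c (xi),
     (2 alpha / beta) E[xi.m xi] <= E[ln Z (xi + zeta) - ln Z xi]
       <= E[average of exp ((2 / beta) zeta.(u - c)) under the tilted prior] - 1.
   With c = m xi, the conditional Bernstein condition bounds the right-hand side by
   E[Var xi] times v alpha * (2 / (beta (beta - 2 b(alpha) D))) (1 + o(1)) when the
   prior lives in a box of side D; divide by alpha and let alpha tend to 0. An
   unbounded prior is exhausted by boxes. *)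
Require Import Defs.
From HB Require Import structures.
From mathcomp Require Import all_boot all_order all_algebra.
From mathcomp Require Import all_classical all_reals all_analysis.
From mathcomp Require Import measurable_realfun ring lra.

Set Implicit Arguments.
Unset Strict Implicit.
Unset Printing Implicit Defensive.

Import Order.TTheory GRing.Theory Num.Theory.
Import numFieldNormedType.Exports.

Local Open Scope classical_set_scope.
Local Open Scope ring_scope.

(** Subtracting [c] costs nothing, since [c (xi)] is F-measurable and E[zeta | F] = 0, and it kills
    the first-order term of the exponential: the increment becomes of order v alpha, comparable with
    the factor alpha on the left because v alpha / alpha tends to v' 0. Tonelli lets theta be frozen
    before the noise is averaged. The exponents (2 / beta) (u - c) are then at most 2 D / beta in
    absolute value, so Bernstein's range b |t| < 1 becomes 2 b D < beta, and v (2 / beta)^2 / (2 (1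
    - 2 b D / beta)) is the constant 2 v / (beta (beta - 2 b D)). Conditional laws enter only
    through versions of conditional expectations, so every conditional bound is phrased as an
    inequality between integrals over sets of F. No moment of [xi] is assumed: square integrability
    and centring are first extracted from the identity in law at alpha = 1. The order of the limits
    is forced: the remainder in [curvature] involves n D^2, so alpha tends to 0 in a fixed box and
    the boxes grow last. The growing boxes keep a common constant because an infinite [D0] is
    compatible with the condition on beta only if b 0 = 0. *)

(** * Comparing integrals through comparison on preimages *)

Section integral_comparison.
Context {R : realType} d (T : measurableType d).
Local Open Scope ereal_scope.
Import HBNNSimple.

Lemma integral_simple_comp d' (W : measurableType d')
    (mu : {measure set W -> \bar R}) (phi : W -> T) (X : W -> R)
    (h : {nnsfun T >-> R}) :
  measurable_fun setT phi -> measurable_fun setT X -> (forall w, 0 <= X w)%R ->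
  \int[mu]_w (h (phi w) * X w)%:E =
  \sum_(y \in range h)
     y%:E * \int[mu]_(w in phi @^-1` (h @^-1` [set y])) (X w)%:E.
Proof.
move=> mphi mX X0.
have mA (y : R) : measurable (phi @^-1` (h @^-1` [set y])).
  by rewrite -[X in measurable X]setTI; apply: mphi.
have mI (y : R) : measurable_fun setT (fun w => \1_(h @^-1` [set y]) (phi w) : R).
  by apply: (measurableT_comp _ mphi); exact: measurable_indic.
under eq_integral => w _.
  rewrite fimfunE EFinM -fsumEFin// ge0_mule_fsuml; last first.
    by move=> y; exact: nnfun_muleindic_ge0.
  over.
rewrite ge0_integral_fsum//.
- apply: eq_fsbigr => y; rewrite inE => -[t _ <-].
  under eq_integral do rewrite EFinM -muleA.
  rewrite ge0_integralZl//.
  + congr (_ * _); rewrite [RHS]integral_mkcond; apply: eq_integral => w _.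
    have -> : \1_(h @^-1` [set h t]) (phi w) =
              \1_(phi @^-1` (h @^-1` [set h t])) w :> R.
      by rewrite !indicE; congr (_%:R); apply/idP/idP; rewrite !inE.
    rewrite -EFinM indicE patchE.
    by case: ifP; rewrite ?mul1r ?mul0r.
  + by apply/measurable_EFinP; exact: measurable_funM.
  + by move=> x _; rewrite lee_fin mulr_ge0.
  + by rewrite lee_fin.
- move=> y; apply/measurable_EFinP; apply: measurable_funM => //.
  exact: measurable_funM.
- move=> y w _; rewrite EFinM mule_ge0 ?lee_fin//.
  by rewrite -lee_fin EFinM; exact: nnfun_muleindic_ge0.
Qed.

(** The hypothesis orders the image measures of [X1 mu1] under [phi1] and of [X2 mu2] under [phi2];
    simple functions and monotone convergence carry the order over to every nonnegative [f],
    infinite values included. Pull-out properties, equality in law and the change of density in the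
    posterior are all instances. *)
Lemma ge0_le_integral_comp d1 d2 (W1 : measurableType d1)
    (W2 : measurableType d2) (mu1 : {measure set W1 -> \bar R})
    (mu2 : {measure set W2 -> \bar R}) (phi1 : W1 -> T) (phi2 : W2 -> T)
    (X1 : W1 -> R) (X2 : W2 -> R) :
  measurable_fun setT phi1 -> measurable_fun setT phi2 ->
  measurable_fun setT X1 -> measurable_fun setT X2 ->
  (forall w, 0 <= X1 w)%R -> (forall w, 0 <= X2 w)%R ->
  (forall A, measurable A -> \int[mu1]_(w in phi1 @^-1` A) (X1 w)%:E <=
                             \int[mu2]_(w in phi2 @^-1` A) (X2 w)%:E) ->
  forall f : T -> R, measurable_fun setT f -> (forall t, 0 <= f t)%R ->
  \int[mu1]_w (f (phi1 w) * X1 w)%:E <= \int[mu2]_w (f (phi2 w) * X2 w)%:E.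
Proof.
move=> mphi1 mphi2 mX1 mX2 X10 X20 X12 f mf f0.
have mf' : measurable_fun setT (EFin \o f) by exact/measurable_EFinP.
have f0' t : setT t -> 0 <= (EFin \o f) t by rewrite /= lee_fin.
pose h := nnsfun_approx measurableT mf'.
have lim d' (W : measurableType d') (mu : {measure set W -> \bar R})
    (phi : W -> T) (X : W -> R) : measurable_fun setT phi ->
    measurable_fun setT X -> (forall w, 0 <= X w)%R ->
    \int[mu]_w (h n (phi w) * X w)%:E @[n --> \oo] -->
    \int[mu]_w (f (phi w) * X w)%:E.
  move=> mphi mX X0.
  have limE w : (h n (phi w) * X w)%:E @[n --> \oo] --> (f (phi w) * X w)%:E.
    under eq_fun do rewrite EFinM; rewrite EFinM.
    by apply: cvgeZr => //; exact: (cvg_nnsfun_approx measurableT mf').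
  under eq_integral do rewrite -(cvg_lim _ (limE _))//.
  apply: cvg_monotone_convergence => //.
  - move=> n; apply/measurable_EFinP; apply: measurable_funM => //.
    exact: measurableT_comp.
  - by move=> n w _; rewrite lee_fin mulr_ge0.
  - move=> w _ a b ab; rewrite lee_fin ler_wpM2r//.
    exact/lefP/nd_nnsfun_approx.
rewrite -(cvg_lim _ (lim _ _ _ _ _ mphi1 mX1 X10))//.
rewrite -(cvg_lim _ (lim _ _ _ _ _ mphi2 mX2 X20))//.
apply: lee_lim.
- by apply/cvg_ex; eexists; exact: lim.
- by apply/cvg_ex; eexists; exact: lim.
apply: nearW => n; rewrite !integral_simple_comp//.
apply: lee_fsum => // y [t _ <-]; apply: lee_wpmul2l; first by rewrite lee_fin.
exact: X12.
Qed.

Lemma ge0_eq_integral_comp d1 d2 (W1 : measurableType d1)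
    (W2 : measurableType d2) (mu1 : {measure set W1 -> \bar R})
    (mu2 : {measure set W2 -> \bar R}) (phi1 : W1 -> T) (phi2 : W2 -> T)
    (X1 : W1 -> R) (X2 : W2 -> R) :
  measurable_fun setT phi1 -> measurable_fun setT phi2 ->
  measurable_fun setT X1 -> measurable_fun setT X2 ->
  (forall w, 0 <= X1 w)%R -> (forall w, 0 <= X2 w)%R ->
  (forall A, measurable A -> \int[mu1]_(w in phi1 @^-1` A) (X1 w)%:E =
                             \int[mu2]_(w in phi2 @^-1` A) (X2 w)%:E) ->
  forall f : T -> R, measurable_fun setT f -> (forall t, 0 <= f t)%R ->
  \int[mu1]_w (f (phi1 w) * X1 w)%:E = \int[mu2]_w (f (phi2 w) * X2 w)%:E.
Proof.
move=> mphi1 mphi2 mX1 mX2 X10 X20 X12 f mf f0.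
by apply/eqP; rewrite eq_le !ge0_le_integral_comp// => A mA; rewrite X12.
Qed.

End integral_comparison.

(** * Conditional expectations and the Bernstein condition *)

Lemma integral_cst_probability (R : realType) d (T : measurableType d)
    (P : probability T R) (r : \bar R) : (\int[P]_w r = r)%E.
Proof. by rewrite (integral_cst P measurableT) [X in (_ * X)%E]probability_setT mule1. Qed.

Section conditioning_facts.
Context {R : realType} d {Omega : measurableType d} (P : probability Omega R).
Variable F : set (set Omega).
Hypotheses (hF : sigma_algebra setT F) (hFm : F `<=` measurable).
Local Notation OF := (g_sigma_algebraType F).
Local Open Scope ereal_scope.

(** [OF] is Omega with F as its sigma-algebra, so that F-measurability is ordinary measurability
    with domain [OF]. The identity into [OF] then plays the role of [phi1] and [phi2] in the
    comparison of integrals. *)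
Let measurable_idF : measurable_fun setT (idfun : Omega -> OF).
Proof.
move=> _ A; rewrite (measurable_g_measurableTypeE hF) => FA.
by rewrite setTI; exact: hFm.
Qed.

Lemma measurable_wrtP d' (T : measurableType d') (f : Omega -> T) :
  measurable_wrt F f <-> measurable_fun setT (f : OF -> T).
Proof.
split=> [Ff _ A mA|mf _ [A mA <-]]; last by have := mf measurableT A mA;
  rewrite (measurable_g_measurableTypeE hF).
rewrite (measurable_g_measurableTypeE hF); apply: Ff.
by exists A.
Qed.

Lemma measurable_fun_wrt d' (T : measurableType d') (f : Omega -> T) :
  measurable_wrt F f -> measurable_fun setT f.
Proof. by move=> /measurable_wrtP mf; exact: (measurableT_comp mf measurable_idF). Qed.

(** On [OF], under the image of [P], every measurable set belongs to F, so two versions have equal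
    integrals over all measurable sets. The exceptional null set found there is an F-set, hence null
    for [P]. *)
Lemma cond_exp_unique (X Z Z' : Omega -> R) :
  is_cond_exp P F X Z -> is_cond_exp P F X Z' -> {ae P, forall w, Z w = Z' w}.
Proof.
move=> [_ iZ /measurable_wrtP mZ eZ] [_ iZ' /measurable_wrtP mZ' eZ'].
have mE (f : OF -> R) : measurable_fun setT f -> measurable_fun setT (EFin \o f).
  by move=> mf; exact/measurable_EFinP.
have : ae_eq (pushforward P (idfun : Omega -> OF)) setT (EFin \o Z) (EFin \o Z').
  move=> m; apply: integral_ae_eq => //.
  - by apply: integrable_pushforward => //; exact: mE.
  - exact: mE.
  - move=> E _ mE'; have FE : F E by rewrite -(measurable_g_measurableTypeE hF).
    rewrite !integral_pushforward//.
    + exact: etrans (eZ _ FE) (esym (eZ' _ FE)).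
    + exact: mE.
    + by apply: (integrableS measurableT) => //; exact: hFm.
    + exact: mE.
    + by apply: (integrableS measurableT) => //; exact: hFm.
move=> /(_ measurable_idF)[N [mN N0 sub]]; exists N; split => //.
- by apply: hFm; rewrite -(measurable_g_measurableTypeE hF).
- by move=> w /= ZZ'; apply: sub => /= /(_ I) [].
Qed.

Lemma integral_indicM d' (T : measurableType d') (mu : {measure set T -> \bar R})
    (A : set T) (X : T -> R) :
  \int[mu]_(w in A) (X w)%:E = \int[mu]_w (\1_A w * X w)%:E.
Proof.
rewrite integral_mkcond; apply: eq_integral => w _.
by rewrite indicE patchE; case: ifP; rewrite ?mul1r ?mul0r.
Qed.

Lemma cond_exp_pull_out (X Z H : Omega -> R) : measurable_fun setT X ->
  (forall w, 0 <= X w)%R -> (forall w, 0 <= Z w)%R -> is_cond_exp P F X Z ->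
  measurable_wrt F H -> (forall w, 0 <= H w)%R ->
  \int[P]_w (H w * X w)%:E = \int[P]_w (H w * Z w)%:E.
Proof.
move=> mX X0 Z0 [iX iZ mZ eZ] /measurable_wrtP mH H0.
apply: (ge0_eq_integral_comp measurable_idF measurable_idF _ _ _ _ _ mH) => //.
- exact: measurable_fun_wrt mZ.
- by move=> A; rewrite (measurable_g_measurableTypeE hF) => FA; rewrite eZ.
Qed.

Lemma le_integral_pull_out (X H : Omega -> R) (c : R) : measurable_fun setT X ->
  (forall w, 0 <= X w)%R -> (0 <= c)%R ->
  (forall A, F A -> \int[P]_(w in A) (X w)%:E <= c%:E * P A) ->
  measurable_wrt F H -> (forall w, 0 <= H w)%R ->
  \int[P]_w (H w * X w)%:E <= \int[P]_w (H w * c)%:E.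
Proof.
move=> mX X0 c0 Xc /measurable_wrtP mH H0.
apply: (ge0_le_integral_comp measurable_idF measurable_idF _ _ _ _ _ mH) => //.
move=> A; rewrite (measurable_g_measurableTypeE hF) => FA.
rewrite integral_cst; last exact: hFm.
exact: Xc.
Qed.

(** The set where [Z < 0] lies in F; over its F-subsets the integral of [Z] is at most 0 and equals
    that of [X], so [X] integrates to 0 there and [Z] may be cut off. A version that is nonnegative
    everywhere is what [cond_exp_pull_out] requires. *)
Lemma cond_exp_max0 (X Z : Omega -> R) : (forall w, 0 <= X w)%R ->
  is_cond_exp P F X Z -> is_cond_exp P F X (fun w => Num.max (Z w) 0)%R.
Proof.
move=> X0 [iX iZ mZ eZ].
have mZ' := measurable_fun_wrt mZ.
pose N := [set w | (Z w < 0)%R].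
have FN : F N.
  apply: mZ; exists [set x : R | (x < 0)%R]; last by rewrite setTI.
  by rewrite -set_itvNyo; exact: measurable_itv.
have mN : measurable N := hFm FN.
have mM : measurable_fun setT (fun w => Num.max (Z w) 0)%R.
  exact: measurable_maxr.
have iM : P.-integrable setT (EFin \o (fun w => Num.max (Z w) 0)%R).
  apply: le_integrable iZ => //; first exact/measurable_EFinP.
  move=> w _ /=; rewrite lee_fin [leLHS]ger0_norm ?le_max ?lexx ?orbT//.
  by rewrite ge_max normr_ge0 ler_norm.
split => //.
- apply/measurable_wrtP; apply: measurable_maxr => //.
  exact/measurable_wrtP.
- move=> A FA; have mA := hFm FA.
  have FI B C : F B -> F C -> F (B `&` C).
    by rewrite -(measurable_g_measurableTypeE hF); exact: measurableI.
  have FC B : F B -> F (~` B).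
    by rewrite -(measurable_g_measurableTypeE hF); exact: measurableC.
  have mAN : measurable (A `&` N) by exact: measurableI.
  have mAC : measurable (A `&` ~` N) by apply: measurableI => //; exact: measurableC.
  have split (X' : Omega -> R) : measurable_fun setT X' ->
      P.-integrable setT (EFin \o X') ->
      \int[P]_(w in A) (X' w)%:E =
      \int[P]_(w in A `&` N) (X' w)%:E + \int[P]_(w in A `&` ~` N) (X' w)%:E.
    move=> mX' iX'; rewrite -integral_setU//.
    + by rewrite -setIUr setUv setIT.
    + by apply/measurable_funTS/measurable_EFinP.
    + by apply/disj_setPS => w [[_ ?] [_ /=]].
  have mX : measurable_fun setT X by move/measurable_int : iX => /measurable_EFinP.
  rewrite [RHS]split// [LHS]split//.
  congr (_ + _).
  + rewrite integral0_eq; last by move=> w [_ /ltW Zw]; rewrite max_r.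
    apply/eqP; rewrite eq_le integral_ge0/=; last by move=> w _; rewrite lee_fin.
    rewrite -eZ; last exact: FI.
    rewrite -[leRHS](integral0 P (A `&` N)); apply: le_integral => //.
    * exact: integrableS iZ.
    * exact: integrable0.
    * by move=> w /[!inE] -[_ /ltW].
  + rewrite -eZ; last by apply: FI => //; exact: FC.
    by apply: eq_integral => w; rewrite inE => -[_ /negP]; rewrite -leNgt => /max_l ->.
Qed.

(** Independence speaks of indicators only, and the conditional means of the [f i] are only bounded
    above. The factors are therefore exchanged one index at a time: the product formula for
    indicators starts the induction, and each step upgrades one indicator to [f i] and its
    conditional probability to [c i]. *)
Lemma cond_independent_le_prod n (zeta : Omega -> n.-tuple R)
    (f : 'I_n -> R -> R) (c : 'I_n -> R) :
  measurable_fun setT zeta -> cond_independent P F zeta ->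
  (forall i, measurable_fun setT (f i)) -> (forall i x, 0 <= f i x)%R ->
  (forall i, 0 <= c i)%R ->
  (forall i A, F A ->
    \int[P]_(w in A) (f i (tnth (zeta w) i))%:E <= (c i)%:E * P A) ->
  forall A, F A ->
    \int[P]_(w in A) (\prod_(i < n) f i (tnth (zeta w) i))%:E
      <= (\prod_(i < n) c i)%:E * P A.
Proof.
move=> mzeta ind mf f0 c0 fc A FA.
have mz i : measurable_fun setT (fun w => tnth (zeta w) i).
  exact: (measurableT_comp (measurable_tnth i) mzeta).
have mB i (B : set R) : measurable B ->
    measurable_fun setT (fun w => \1_B (tnth (zeta w) i) : R).
  by move=> mBB; apply: (measurableT_comp _ (mz i)); exact: measurable_indic.
have ind01 (B : set R) x : (0 <= \1_B x :> R)%R by rewrite indicE.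
(* nonnegative versions of the conditional probabilities of [zeta_i \in B] *)
have /choice[q qP] : forall p : 'I_n * set R, exists h : Omega -> R,
    measurable p.2 -> (forall w, 0 <= h w)%R /\
    is_cond_exp P F (fun w => \1_(p.2) (tnth (zeta w) p.1)) h.
  move=> [i B]; have [mBB|nB] := pselect (measurable B); last first.
    by exists (cst 0%R) => /nB.
  have [|q [/(_ i) + _]] := ind (fun j => if j == i then B else setT).
    by move=> j; case: ifP.
  rewrite eqxx => /cond_exp_max0 qi.
  exists (fun w => Num.max (q i w) 0)%R => _; split.
    by move=> w; rewrite le_max lexx orbT.
  have -> : (fun w => \1_B (tnth (zeta w) i)) =
            \1_[set w | B (tnth (zeta w) i)] :> (_ -> R).
    by apply/funext => w; rewrite !indicE.
  by apply: qi => w; rewrite indicE.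
have q0 i B w : measurable B -> (0 <= q (i, B) w)%R by move=> /(qP (i, B))[].
have Fq i B : measurable B -> measurable_wrt F (q (i, B)).
  by move=> /(qP (i, B))[_ []].
have Findic : measurable_wrt F (\1_A : Omega -> R).
  apply/measurable_wrtP; apply: measurable_indic.
  by rewrite (measurable_g_measurableTypeE hF).
have mP (I : eqType) (r : seq I) (p : pred I) (h : I -> Omega -> R) :
    (forall i, measurable_wrt F (h i)) ->
    measurable_wrt F (fun w => \prod_(i <- r | p i) h i w)%R.
  move=> mh; apply/measurable_wrtP.
  under eq_fun do rewrite big_mkcond.
  apply: (@measurable_prod _ OF R setT _ r
    (fun i w => if p i then h i w else 1%R)) => i _.
  by case: (p i) => //; exact/measurable_wrtP.
(* the factors of index [< k] have been passed from indicators to [f] *)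
have claim k : (k <= n)%N -> forall B : 'I_n -> set R,
    (forall i, measurable (B i)) ->
    \int[P]_w (\1_A w * \prod_(i < n) (if (i < k)%N then f i (tnth (zeta w) i)
                             else \1_(B i) (tnth (zeta w) i)))%:E <=
    \int[P]_w (\1_A w * \prod_(i < n) (if (i < k)%N then c i
                             else q (i, B i) w))%:E.
  elim: k => [_ B mBi|k IH kn B mBi].
    (* The versions [q'] depend on the whole family [B], whereas [q] depends on a single index and
       set. Uniqueness identifies them almost everywhere, which makes it possible to change one set
       without touching the other factors. *)
    have [q' [q'1 [_ _ _ /(_ _ FA) q'2]]] := ind B mBi.
    have qq' : {ae P, forall w, forall i, q (i, B i) w = q' i w}.
      have : {ae P, forall w, forall k, forall i : 'I_n, i = k :> nat ->
          q (i, B i) w = q' i w}.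
        apply/ae_foralln => k; have [kn|nk] := ltnP k n; last first.
          apply: aeW => w i ik; have := ltn_ord i.
          by rewrite ik ltnNge nk.
        have [_ qk] := qP (Ordinal kn, B (Ordinal kn)) (mBi _).
        have := cond_exp_unique qk (q'1 (Ordinal kn)).
        apply: filterS => w qw i ik.
        by have -> : i = Ordinal kn by exact: val_inj.
      by apply: filterS => w qw i; apply: qw.
    rewrite -!integral_indicM -[leLHS]/(\int[P]_(w in A) _).
    rewrite le_eqVlt; apply/orP; left; apply/eqP.
    transitivity (\int[P]_(w in A) (\prod_(i < n) q' i w)%:E).
      rewrite q'2; apply: eq_integral => w _; congr EFin.
      have [wB|] := pselect (forall i, B i (tnth (zeta w) i)).
        rewrite indicE mem_set// big1// => i _.
        by rewrite indicE mem_set//; exact: wB.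
      move=> nB; rewrite indicE memNset//.
      move/existsNP : nB => [i Bi].
      by rewrite (bigD1 i)//= indicE memNset// mul0r.
    apply: ae_eq_integral => //.
    + exact: hFm.
    + apply/measurable_funTS/measurable_EFinP/measurable_fun_wrt.
      by apply: mP => i; have [_ _ ? _] := q'1 i.
    + apply/measurable_funTS/measurable_EFinP/measurable_fun_wrt.
      by apply: mP => i; exact: Fq.
    + apply: filterS qq' => w qw _; congr EFin; apply: eq_bigr => i _.
      by rewrite qw.
  pose i0 := Ordinal kn.
  have kne i : i != i0 -> (i < k.+1)%N = (i < k)%N.
    by move=> ii0; rewrite ltnS leq_eqVlt -[_ == k]/(i == i0) (negbTE ii0).
  pose g w := (\prod_(i < n | i != i0) (if (i < k)%N then f i (tnth (zeta w) i)
                             else \1_(B i) (tnth (zeta w) i)))%R.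
  pose r w := (\prod_(i < n | i != i0) (if (i < k)%N then c i
                             else q (i, B i) w))%R.
  have g0 w : (0 <= g w)%R by apply: prodr_ge0 => i _; case: ifP.
  have r0 w : (0 <= r w)%R by apply: prodr_ge0 => i _; case: ifP => // _; exact: q0.
  have mg : measurable_fun setT g.
    rewrite /g; under eq_fun do rewrite big_mkcond.
    apply: (@measurable_prod _ Omega R setT _ _ (fun i w => if i != i0 then
      if (i < k)%N then f i (tnth (zeta w) i) else \1_(B i) (tnth (zeta w) i)
      else 1%R)) => i _.
    case: (i != i0) => //; case: (i < k)%N; first exact: measurableT_comp.
    exact: mB.
  have Fr : measurable_wrt F r.
    apply: mP => i; case: (i < k)%N; last exact: Fq.
    exact/measurable_wrtP.
  have mr := measurable_fun_wrt Fr.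
  have FAr : measurable_wrt F (fun w => \1_A w * r w)%R.
    by apply/measurable_wrtP; apply: measurable_funM; exact/measurable_wrtP.
  have mA : measurable A := hFm FA.
  have splitS (u h : 'I_n -> R) : (\prod_(i < n) (if (i < k.+1)%N then u i else h i)
      = u i0 * \prod_(i < n | i != i0) (if (i < k)%N then u i else h i))%R.
    by rewrite (bigD1 i0)//= ltnSn; congr (_ * _)%R; apply: eq_bigr => i /kne ->.
  under eq_integral do rewrite splitS mulrCA.
  under [leRHS]eq_integral do rewrite splitS mulrCA mulrC.
  (* The middle term keeps [f i0] but already has the weight [r]. Its upper bound by the right-hand
     side is the conditional bound on [f i0]; its lower bound compares the weights [g] and [r] along
     the law of the coordinate [i0]. *)
  apply: (@le_trans _ _
      (\int[P]_w (\1_A w * r w * f i0 (tnth (zeta w) i0))%:E)); last first.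
    apply: le_integral_pull_out => //.
    + exact: measurableT_comp.
    + exact: fc.
    + by move=> w; rewrite mulr_ge0.
  under [leRHS]eq_integral do rewrite mulrC.
  apply: (@ge0_le_integral_comp R _ _ _ _ _ _ P P _ _
    (fun w => \1_A w * g w)%R (fun w => \1_A w * r w)%R
    (mz i0) (mz i0) _ _ _ _ _ (f i0)) => //.
  + by apply: measurable_funM => //; exact: measurable_indic.
  + by apply: measurable_funM => //; exact: measurable_indic.
  + by move=> w; rewrite mulr_ge0.
  + by move=> w; rewrite mulr_ge0.
  move=> C mC.
  rewrite [leLHS]integral_indicM [leRHS]integral_indicM.
  have BC i : measurable (if i == i0 then C else B i) by case: ifP.
  (* With [C] placed at index [i0], the induction hypothesis compares the two weights on the event
     that the coordinate [i0] lies in [C], once [q (i0, C)] has been turned back into the indicator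
     of that event. *)
  have := IH (ltnW kn) (fun i => if i == i0 then C else B i) BC.
  have splitC (u : 'I_n -> R) (h : 'I_n -> set R -> R) :
      (\prod_(i < n) (if (i < k)%N then u i else h i (if i == i0 then C else B i))
      = h i0 C * \prod_(i < n | i != i0) (if (i < k)%N then u i else h i (B i)))%R.
    rewrite (bigD1 i0)//= ltnn eqxx; congr (_ * _)%R.
    by apply: eq_bigr => i /negPf ->.
  under [X in X <= _ -> _]eq_integral => w _.
    rewrite (splitC _ (fun i D => \1_D (tnth (zeta w) i))).
    rewrite mulrCA; over.
  under [X in _ <= X -> _]eq_integral => w _.
    rewrite (splitC _ (fun i D => q (i, D) w)) -/(r w).
    rewrite mulrCA mulrC; over.
  have [_ qC] := qP (i0, C) mC.
  rewrite -[X in _ <= X -> _](@cond_exp_pull_out _ (q (i0, C)) _ _ _ _ qC FAr)//; last first.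
  - by move=> w; rewrite mulr_ge0.
  - by move=> w; exact: q0.
  - exact: mB.
  under [X in _ <= X -> _]eq_integral do rewrite mulrC.
  by [].
have := claim n (leqnn n) (fun=> setT) (fun=> measurableT).
under eq_integral do under eq_bigr do rewrite ltn_ord.
under [X in _ <= X -> _]eq_integral do under eq_bigr do rewrite ltn_ord.
by rewrite -!integral_indicM integral_cst//; exact: hFm.
Qed.
Lemma cond_bernstein_le (v b : R) (eta : Omega -> R) : measurable_fun setT eta ->
  cond_bernstein P F v b eta -> forall t, (b * `|t| < 1)%R -> forall A, F A ->
  \int[P]_(w in A) (expR (t * eta w))%:E
    <= (expR (v * t ^+ 2 / (2 * (1 - b * `|t|))))%:E * P A.
Proof.
move=> meta [M [Mexp Mle]] t bt A FA.
have mA := hFm FA.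
have [_ _ mM eM] := cond_exp_max0 (fun w => expR_ge0 _) (Mexp t bt).
rewrite -eM// -integral_cst//.
apply: ae_ge0_le_integral => //.
- by move=> w _; rewrite lee_fin le_max lexx orbT.
- by apply/measurable_funTS/measurable_EFinP/measurable_fun_wrt.
- by move=> w _; rewrite lee_fin expR_ge0.
- by apply: filterS Mle => w /(_ t bt) Mw _; rewrite lee_fin ge_max Mw expR_ge0.
Qed.

Lemma cond_bernstein_mgf n (zeta : Omega -> n.-tuple R) (v b : R) (t : 'I_n -> R) :
  measurable_fun setT zeta -> cond_independent P F zeta ->
  (forall i, cond_bernstein P F v b (fun w => tnth (zeta w) i)) ->
  (forall i, b * `|t i| < 1)%R -> forall A, F A ->
  \int[P]_(w in A) (expR (\sum_(i < n) t i * tnth (zeta w) i))%:E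
    <= (expR (\sum_(i < n) v * t i ^+ 2 / (2 * (1 - b * `|t i|))))%:E * P A.
Proof.
move=> mzeta ind bern bt A FA; rewrite expR_sum.
under eq_integral do rewrite expR_sum.
apply: (cond_independent_le_prod (f := fun i x => expR (t i * x)) mzeta ind) => //.
- by move=> i; apply: measurableT_comp => //; exact: measurable_funM.
- move=> i B FB; apply: cond_bernstein_le => //.
  exact: (measurableT_comp (measurable_tnth i) mzeta).
Qed.

(** The bracket is the square of e^(x/2) - e^(-x/2), which is at least x / 2 for x >= 0; the 4 is
    the price of this crude lower bound. *)
Lemma sqr_le_expR (x : R) : (x ^+ 2 <= 4 * (expR x + expR (- x) - 2))%R.
Proof.
have key (y : R) : (0 <= y -> y <= expR y - expR (- y))%R.
  move=> y0; have := expR_ge1Dx y; rewrite expRN => ey.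
  have e0 : (0 < expR y)%R := expR_gt0 y.
  have : (expR y * (expR y)^-1 = 1)%R by rewrite mulfV ?gt_eqF.
  move: ey e0; set a := expR y; set c := (a^-1)%R => ey e0 ac.
  nra.
wlog x0 : x / (0 <= x)%R.
  move=> H; have [/H//|x0] := leP 0%R x.
  by have := H (- x)%R; rewrite oppr_ge0 (ltW x0) sqrrN opprK [(expR (- x) + _)%R]addrC; exact.
have y0 : (0 <= x / 2)%R by lra.
have := key _ y0; have := expRD (x / 2) (x / 2); have := expRD (- (x / 2)) (- (x / 2)).
have := expRxMexpNx_1 (x / 2).
have -> : (x / 2 + x / 2 = x)%R by lra.
have -> : (- (x / 2) + - (x / 2) = - x)%R by lra.
set a := expR (x / 2); set c := expR (- (x / 2)) => ac -> -> xac.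
have -> : (a * a + c * c - 2 = (a - c) ^+ 2)%R by rewrite sqrrB; lra.
have : ((x / 2) ^+ 2 <= (a - c) ^+ 2)%R by rewrite ler_sqr// nnegrE (le_trans y0).
by rewrite expr_div_n; lra.
Qed.

(** The second moment is read off the moment generating function at the two points t and -t. What
    matters is linearity in [v]: it yields second moments of order v alpha for zeta, and the
    constant 16 never enters the final bound. *)
Lemma cond_bernstein_sqr_le (v b : R) (eta : Omega -> R) :
  (0 <= v)%R -> (0 <= b)%R -> measurable_fun setT eta ->
  cond_bernstein P F v b eta ->
  \int[P]_w (eta w ^+ 2)%:E <= (16 * v)%:E.
Proof.
move=> v0 b0 meta bern.
have FT : F setT by rewrite -(measurable_g_measurableTypeE hF); exact: measurableT.
(* This [t] satisfies t <= 1/2, b t <= 1/2 and v t <= 1 at once. Hence psi <= v t^2 <= 1/2 and e^psi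
   <= 1 + 2 psi, so that 4 (2 e^psi - 2) <= 16 v t^2, and t^2 cancels. *)
pose t := (2 + 2 * b + v)^-1%R.
have t0 : (0 < t)%R by rewrite invr_gt0; lra.
have tE : (t * (2 + 2 * b + v) = 1)%R by rewrite mulVf// gt_eqF//; lra.
have t2 : (t <= 1 / 2)%R by nra.
have bt : (b * t <= 1 / 2)%R by nra.
have vt : (v * t <= 1)%R by nra.
have abst : (`|t| = t)%R by rewrite ger0_norm// ltW.
have btN : (b * `|- t| < 1)%R by rewrite normrN abst; lra.
have btP : (b * `|t| < 1)%R by rewrite abst; lra.
have := cond_bernstein_le meta bern btN FT.
have := cond_bernstein_le meta bern btP FT.
rewrite normrN abst sqrrN probability_setT mule1.
set psi := (v * t ^+ 2 / (2 * (1 - b * t)))%R => h1 h2.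
have psi1 : (psi <= v * t ^+ 2)%R.
  rewrite /psi ler_pdivrMr; last by lra.
  by rewrite ler_peMr ?mulr_ge0 ?sqr_ge0//; lra.
have psi0 : (0 <= psi)%R.
  by rewrite /psi divr_ge0 ?mulr_ge0 ?sqr_ge0//; lra.
have psi2 : (psi <= 1 / 2)%R.
  by apply: (le_trans psi1); rewrite expr2; nra.
have epsi : (expR psi <= 1 + 2 * psi)%R.
  have := expR_ge1Dx (- psi); have := expRxMexpNx_1 psi.
  have := expR_gt0 psi.
  by set a := expR psi; set c := expR (- psi) => a0 ac cp; nra.
have mexp (s : R) : measurable_fun setT (fun w => (expR (s * eta w))%:E).
  apply/measurable_EFinP; apply: measurableT_comp => //; exact: measurable_funM.
have : \int[P]_w ((t ^+ 2)%:E * (eta w ^+ 2)%:E + 8%:E) <=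
       \int[P]_w (4%:E * ((expR (t * eta w))%:E + (expR (- t * eta w))%:E)).
  apply: ge0_le_integral => //.
  - by move=> w _; rewrite -EFinM -EFinD lee_fin addr_ge0// mulr_ge0// sqr_ge0.
  - apply: emeasurable_funD => //; apply: emeasurable_funM => //.
    by apply/measurable_EFinP; exact: measurable_funX.
  - by apply: emeasurable_funM => //; exact: emeasurable_funD.
  - move=> w _; rewrite -!EFinM -!EFinD lee_fin mulNr -exprMn.
    by have := sqr_le_expR (t * eta w); lra.
rewrite ge0_integralD//; last 2 first.
- by move=> w _; rewrite -EFinM lee_fin mulr_ge0// sqr_ge0.
- apply: emeasurable_funM => //; apply/measurable_EFinP; exact: measurable_funX.
rewrite integral_cst_probability.
rewrite ge0_integralZl//; last 3 first.
- by apply/measurable_EFinP; exact: measurable_funX.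
- by move=> w _; rewrite lee_fin sqr_ge0.
- by rewrite lee_fin sqr_ge0.
rewrite ge0_integralZl//; last 2 first.
- exact: emeasurable_funD.
- by move=> w _; rewrite -EFinD lee_fin addr_ge0 ?expR_ge0.
rewrite ge0_integralD//.
move=> h.
have : (t ^+ 2)%:E * \int[P]_x (eta x ^+ 2)%:E + 8%:E <=
    4%:E * ((expR psi)%:E + (expR psi)%:E).
  by apply: (le_trans h); apply: lee_wpmul2l => //; exact: leeD.
have I0 : 0 <= \int[P]_x (eta x ^+ 2)%:E.
  by apply: integral_ge0 => w _; rewrite lee_fin sqr_ge0.
have t20 : (0 < t ^+ 2)%R by rewrite exprn_gt0.
move: I0; case: (\int[P]_x (eta x ^+ 2)%:E) => [r| |]//.
- rewrite !lee_fin => r0 hh.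
  have : (t ^+ 2 * r <= t ^+ 2 * (16 * v))%R by lra.
  by rewrite ler_pM2l.
- by rewrite gt0_muley.
Qed.
Lemma maxr0M (h z : R) : Num.max (h * z)%R 0%R =
  (Num.max h 0 * Num.max z 0 + Num.max (- h) 0 * Num.max (- z) 0)%R.
Proof.
have [h0|h0] := leP 0%R h; have [z0|z0] := leP 0%R z.
- rewrite (@max_l _ _ (h * z)%R) ?mulr_ge0//.
  by rewrite (@max_r _ _ (- h)%R) ?oppr_le0// mul0r addr0.
- rewrite (@max_r _ _ (h * z)%R) ?mulr_ge0_le0 ?(ltW z0)//.
  by rewrite (@max_r _ _ (- h)%R) ?oppr_le0// mulr0 mul0r addr0.
- rewrite (@max_r _ _ (h * z)%R) ?mulr_le0_ge0 ?(ltW h0)//.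
  by rewrite (@max_r _ _ (- z)%R) ?oppr_le0// mul0r mulr0 addr0.
- rewrite (@max_l _ _ (h * z)%R) ?mulr_le0 ?ltW//.
  by rewrite !(@max_l _ _ (- _)%R) ?oppr_ge0 ?ltW// mul0r add0r mulrNN.
Qed.

(** Conditional mean 0 says that the positive and negative parts of [Z] have equal integrals over
    every F-set, so they may be exchanged against any nonnegative F-measurable weight. Applied to
    both parts of [H], this equates the positive and negative parts of the integral of [H Z]. *)
Lemma cond_exp0_pull_out (H Z : Omega -> R) :
  is_cond_exp P F Z (cst 0%R) -> measurable_wrt F H ->
  P.-integrable setT (fun w => (H w * Z w)%:E) ->
  \int[P]_w (H w * Z w)%:E = 0.
Proof.
move=> [iZ _ _ eZ] FH iHZ.
have mH := measurable_fun_wrt FH.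
have mZ : measurable_fun setT Z by move/measurable_int : iZ => /measurable_EFinP.
have pull (G : Omega -> R) : measurable_wrt F G -> (forall w, 0 <= G w)%R ->
    \int[P]_w (G w * Z^\+ w)%:E = \int[P]_w (G w * Z^\- w)%:E.
  move=> /measurable_wrtP mG G0.
  apply: (@ge0_eq_integral_comp R _ _ _ _ _ _ P P _ _ (Z^\+)%R (Z^\-)%R
    measurable_idF measurable_idF _ _ _ _ _ G) => //.
  - exact: measurable_funrpos.
  - exact: measurable_funrneg.
  move=> A; rewrite (measurable_g_measurableTypeE hF) => FA.
  have iA : P.-integrable A (EFin \o Z).
    by apply: (integrableS measurableT) => //; exact: hFm.
  have fp := integrable_pos_fin_num (hFm FA) iA.
  have fn := integrable_neg_fin_num (hFm FA) iA.
  have : \int[P]_(w in A) (EFin \o Z)^\+ w - \int[P]_(w in A) (EFin \o Z)^\- w = 0.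
    by rewrite -integralE -(eZ _ FA) integral0.
  move=> /eqP; rewrite -[X in X == _]/(_ - _) sube_eq ?add0e ?fin_num_adde_defl//.
  by rewrite funerpos funerneg => /eqP.
have FHp : measurable_wrt F (H^\+)%R.
  by apply/measurable_wrtP; apply: measurable_funrpos; exact/measurable_wrtP.
have FHn : measurable_wrt F (H^\-)%R.
  by apply/measurable_wrtP; apply: measurable_funrneg; exact/measurable_wrtP.
have mHp := measurable_fun_wrt FHp; have mHn := measurable_fun_wrt FHn.
have mZp := measurable_funrpos mZ; have mZn := measurable_funrneg mZ.
have fin := integrable_pos_fin_num measurableT iHZ.
rewrite integralE.
suff -> : \int[P]_x (fun w => (H w * Z w)%:E)^\- x =
          \int[P]_x (fun w => (H w * Z w)%:E)^\+ x by rewrite subee.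
have posE w : (fun w => (H w * Z w)%:E)^\+ w =
    (H^\+ w * Z^\+ w)%:E + (H^\- w * Z^\- w)%:E.
  by rewrite funeposE -EFin_max maxr0M.
have negE w : (fun w => (H w * Z w)%:E)^\- w =
    (H^\+ w * Z^\- w)%:E + (H^\- w * Z^\+ w)%:E.
  by rewrite funenegE -EFinN -EFin_max -mulrN maxr0M opprK.
under eq_integral do rewrite negE.
under [RHS]eq_integral do rewrite posE.
rewrite ge0_integralD//; first last.
- by apply/measurable_EFinP; exact: measurable_funM.
- by move=> w _; rewrite lee_fin mulr_ge0// ?funrpos_ge0 ?funrneg_ge0.
- by apply/measurable_EFinP; exact: measurable_funM.
- by move=> w _; rewrite lee_fin mulr_ge0// ?funrpos_ge0 ?funrneg_ge0.
rewrite ge0_integralD//; first last.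
- by apply/measurable_EFinP; exact: measurable_funM.
- by move=> w _; rewrite lee_fin mulr_ge0// ?funrpos_ge0 ?funrneg_ge0.
- by apply/measurable_EFinP; exact: measurable_funM.
- by move=> w _; rewrite lee_fin mulr_ge0// ?funrpos_ge0 ?funrneg_ge0.
by rewrite !pull// => w; rewrite ?funrpos_ge0 ?funrneg_ge0.
Qed.

End conditioning_facts.

(** * Moments and limits of integrals *)

Lemma measurable_fun_invr (R : realType) d (T : measurableType d) (f : T -> R) :
  measurable_fun setT f -> (forall w, 0 < f w) ->
  measurable_fun setT (fun w => (f w)^-1).
Proof.
move=> mf f0; under eq_fun => w do rewrite -[f w]lnK ?posrE// -expRN.
by do 2 apply: measurableT_comp => //; exact: measurableT_comp.
Qed.

Section real_integrable.
Context {R : realType} d {T : measurableType d}.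
Variables (mu : {measure set T -> \bar R}) (D : set T).
Hypothesis mD : measurable D.
Implicit Types f g : T -> R.

Lemma integrable_addr f g : mu.-integrable D (EFin \o f) ->
  mu.-integrable D (EFin \o g) ->
  mu.-integrable D (EFin \o (fun x => f x + g x)).
Proof. by move=> iF ig; have := integrableD mD iF ig. Qed.

Lemma integrable_subr f g : mu.-integrable D (EFin \o f) ->
  mu.-integrable D (EFin \o g) ->
  mu.-integrable D (EFin \o (fun x => f x - g x)).
Proof. by move=> iF ig; have := integrableB mD iF ig. Qed.

Lemma integrable_scaler f c : mu.-integrable D (EFin \o f) ->
  mu.-integrable D (EFin \o (fun x => c * f x)).
Proof. by move=> iF; have := integrableZl mD c iF. Qed.

Lemma integrable_sumr (I : Type) (r : seq I) (p : pred I) (f : I -> T -> R) :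
  (forall i, p i -> mu.-integrable D (EFin \o f i)) ->
  mu.-integrable D (EFin \o (fun x => \sum_(i <- r | p i) f i x)).
Proof.
move=> iF; have := @integrable_sum _ _ _ mu D mD I r p (fun i => EFin \o f i) iF.
by under [X in _.-integrable _ X -> _]eq_fun do rewrite sumEFin.
Qed.

Lemma Rintegral_sum (I : Type) (r : seq I) (p : pred I) (f : I -> T -> R) :
  (forall i, p i -> mu.-integrable D (EFin \o f i)) ->
  \int[mu]_(x in D) (\sum_(i <- r | p i) f i x) =
  \sum_(i <- r | p i) \int[mu]_(x in D) f i x.
Proof.
move=> iF; elim: r => [|i r IH].
  by rewrite big_nil; under eq_Rintegral do rewrite big_nil; rewrite Rintegral_cst// mul0r.
rewrite big_cons; under eq_Rintegral do rewrite big_cons.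
case: ifP => // pi; rewrite RintegralD ?IH//; first exact: iF.
exact: integrable_sumr.
Qed.

Lemma le_integrable_real f g : measurable_fun D f ->
  (forall x, D x -> `|f x| <= g x) -> mu.-integrable D (EFin \o g) ->
  mu.-integrable D (EFin \o f).
Proof.
move=> mf fg; apply: le_integrable => //; first exact/measurable_EFinP.
by move=> x Dx /=; rewrite lee_fin (le_trans (fg x Dx))// ler_norm.
Qed.

End real_integrable.

Section moments.
Context {R : realType} d {Omega : measurableType d} (P : probability Omega R).

Lemma bounded_integrable (f : Omega -> R) (c : R) : measurable_fun setT f ->
  (forall w, `|f w| <= c) -> P.-integrable setT (EFin \o f).
Proof.
move=> mf fc; apply: (@le_integrable _ _ _ P setT measurableT _ (EFin \o cst c)).
- exact/measurable_EFinP.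
- by move=> w _ /=; rewrite lee_fin (le_trans (fc w))// ler_norm.
- exact: finite_measure_integrable_cst.
Qed.

Lemma integrableM_bounded (f g : Omega -> R) (c : R) : measurable_fun setT f ->
  (forall w, `|f w| <= c) -> P.-integrable setT (EFin \o g) ->
  P.-integrable setT (fun w => (f w * g w)%:E).
Proof.
move=> mf fc ig; have mg : measurable_fun setT g.
  by move/measurable_int : ig => /measurable_EFinP.
apply: (@le_integrable _ _ _ P setT measurableT _ (fun w => c%:E * (EFin \o g) w)%E).
- by apply/measurable_EFinP; exact: measurable_funM.
- move=> w _ /=; rewrite lee_fin !normrM ler_wpM2r// (le_trans (fc w))//.
  exact: ler_norm.
- exact: integrableZl.
Qed.

Lemma eq_in_distribution_ge0_integral d' (T : measurableType d')
    (X Y : Omega -> T) (f : T -> R) :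
  eq_in_distribution P X Y -> measurable_fun setT X -> measurable_fun setT Y ->
  measurable_fun setT f -> (forall t, 0 <= f t) ->
  (\int[P]_w (f (X w))%:E = \int[P]_w (f (Y w))%:E)%E.
Proof.
move=> XY mX mY mf f0.
have := @ge0_eq_integral_comp R _ _ _ _ _ _ P P X Y (cst 1) (cst 1) mX mY.
move=> /(_ _ _ _ _ _ f mf f0) H.
under eq_integral do rewrite -[f _]mulr1.
under [RHS]eq_integral do rewrite -[f _]mulr1.
apply: H => // A mA.
have mp (U : Omega -> T) : measurable_fun setT U -> measurable (U @^-1` A).
  by move=> mU; rewrite -[X in measurable X]setTI; exact: mU.
by rewrite !(integral_cst P (mp _ _) 1%E) ?mul1e//; exact: XY.
Qed.

Lemma eq_in_distribution_integral d' (T : measurableType d')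
    (X Y : Omega -> T) (f : T -> R) :
  eq_in_distribution P X Y -> measurable_fun setT X -> measurable_fun setT Y ->
  measurable_fun setT f ->
  \int[P]_w f (X w) = \int[P]_w f (Y w).
Proof.
move=> XY mX mY mf; rewrite /Rintegral; congr fine.
rewrite integralE [RHS]integralE.
under eq_integral do rewrite funeposE -EFin_max.
under [X in (_ - X)%E]eq_integral do rewrite funenegE -EFinN -EFin_max.
under [X in _ = (X - _)%E]eq_integral do rewrite funeposE -EFin_max.
under [X in _ = (_ - X)%E]eq_integral do rewrite funenegE -EFinN -EFin_max.
congr (_ - _)%E.
- apply: (eq_in_distribution_ge0_integral (f := fun t => Num.max (f t) 0)) => //.
    exact: measurable_maxr.
  by move=> t; rewrite le_max lexx orbT.
- apply: (eq_in_distribution_ge0_integral (f := fun t => Num.max (- f t) 0)) => //.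
    by apply: measurable_maxr => //; exact: measurableT_comp.
  by move=> t; rewrite le_max lexx orbT.
Qed.

(* Square integrability of [X] is a conclusion of [sqr_integral_le], so a bounded
   function must stand in for the square: iterating [2 X ~ X + Z] bounds the mean
   of [phi (s * X)] by a multiple of [s ^+ 2], and [s] tends to 0. *)
Let phi (x : R) := x ^+ 2 / (1 + x ^+ 2).

Let den_gt0 (x : R) : 0 < 1 + x ^+ 2.
Proof. by rewrite ltr_pwDl// sqr_ge0. Qed.

Let phi_ge0 x : 0 <= phi x.
Proof. by rewrite divr_ge0// ?sqr_ge0// ltW. Qed.

Let phi_le1 x : phi x <= 1.
Proof. by rewrite ler_pdivrMr// mul1r lerDr. Qed.

Let measurable_den : measurable_fun setT (fun x : R => (1 + x ^+ 2)^-1).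
Proof.
by apply: measurable_fun_invr => //; apply: measurable_funD => //; exact: measurable_funX.
Qed.

Let measurable_phi : measurable_fun setT phi.
Proof. by apply: measurable_funM => //; exact: measurable_funX. Qed.

(** The linear coefficient is the derivative of [phi] at x. With A = 1 + x^2 and B = 1 + (x + z)^2,
    the difference of the two sides is z^2 (A^2 B - A + 4 x^2 + 2 x z) / (A^2 B), and B - A + 4 x^2
    + 2 x z = (2 x + z)^2 while A >= 1. *)
Let phi_add x z :
  phi (x + z) <= phi x + 2 * x * ((1 + x ^+ 2)^-1) ^+ 2 * z + z ^+ 2.
Proof.
rewrite /phi -subr_ge0.
have A0 := den_gt0 x; have B0 := den_gt0 (x + z).
set B := 1 + (x + z) ^+ 2 in B0 *; set A := 1 + x ^+ 2 in A0 *.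
have -> : x ^+ 2 / A + 2 * x * A^-1 ^+ 2 * z + z ^+ 2 - (x + z) ^+ 2 / B =
  z ^+ 2 * (A ^+ 2 * B - A + 4 * x ^+ 2 + 2 * x * z) / (A ^+ 2 * B).
  by rewrite /A /B in A0 B0 *; field; rewrite !gt_eqF.
apply: divr_ge0; last by rewrite mulr_ge0 ?sqr_ge0// ltW.
apply: mulr_ge0; first exact: sqr_ge0.
have A1 : 1 <= A by rewrite lerDl sqr_ge0.
have : B <= A ^+ 2 * B by rewrite ler_peMl ?exprn_ege1// ltW.
by move: (A ^+ 2 * B) => Q; rewrite /A /B; have := sqr_ge0 (2 * x + z); nra.
Qed.

Lemma dominated_cvg_Rintegral (f_ : (Omega -> R)^nat) (f g : Omega -> R) :
  (forall k, measurable_fun setT (f_ k)) -> measurable_fun setT f ->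
  P.-integrable setT (EFin \o g) ->
  (forall k w, `|f_ k w| <= g w) -> (forall w, f_ ^~ w @ \oo --> f w) ->
  \int[P]_w f_ k w @[k --> \oo] --> \int[P]_w f w.
Proof.
move=> mf_ mf ig fg f_f.
have [] := @dominated_convergence _ _ _ P setT measurableT
  (fun k => EFin \o f_ k) (EFin \o f) (EFin \o g).
- by move=> k; exact/measurable_EFinP.
- exact/measurable_EFinP.
- by apply: aeW => w _; apply: cvg_EFin; [exact: nearW|exact: f_f].
- exact: ig.
- by apply: aeW => w k _ /=; rewrite lee_fin.
move=> If _ cf.
by apply: fine_cvg; rewrite fineK ?integrable_fin_num.
Qed.

Lemma sqr_integral_le F (X Z : Omega -> R) (m : R) :
  sigma_algebra setT F -> F `<=` measurable -> measurable_wrt F X ->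
  is_cond_exp P F Z (cst 0) ->
  eq_in_distribution P (fun w => X w + Z w) (fun w => 2 * X w) ->
  (\int[P]_w (Z w ^+ 2)%:E <= m%:E)%E ->
  (\int[P]_w (X w ^+ 2)%:E <= m%:E)%E.
Proof.
move=> hF hFm FX Z0 XZ Zm.
have mX := measurable_fun_wrt hF hFm FX.
have [iZ _ _ _] := Z0.
have mZ : measurable_fun setT Z by move/measurable_int : iZ => /measurable_EFinP.
have iZ2 : P.-integrable setT (EFin \o (fun w => Z w ^+ 2)).
  apply/integrableP; split; first by apply/measurable_EFinP; exact: measurable_funX.
  under eq_integral do rewrite /= ger0_norm ?sqr_ge0//.
  by rewrite (le_lt_trans Zm)// ltry.
have {}Zm : \int[P]_w (Z w ^+ 2) <= m.
  by rewrite -lee_fin fineK// integrable_fin_num.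
pose a (s : R) := \int[P]_w phi (s * X w).
have phi_mul2 s x : phi (2 * s * x) = phi (s * (2 * x)).
  by rewrite (mulrC 2) mulrA.
have msX s : measurable_fun setT (fun w => s * X w) by exact: measurable_funM.
have iphi (U : Omega -> R) : measurable_fun setT U ->
    P.-integrable setT (EFin \o (fun w => phi (U w))).
  move=> mU; apply: (@bounded_integrable _ 1); first exact: measurableT_comp.
  by move=> w; rewrite ger0_norm.
have m0 : 0 <= m by apply: le_trans Zm; apply: Rintegral_ge0 => w _; exact: sqr_ge0.
have step s : a (2 * s) <= a s + s ^+ 2 * m.
  (* [h (X w) * Z w] is the linear term of [phi_add] at s X with increment s Z. As [h] is bounded,
     the product is integrable and its mean vanishes by [cond_exp0_pull_out]. *)
  pose h x := 2 * (s * x) * ((1 + (s * x) ^+ 2)^-1) ^+ 2 * s.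
  have mh : measurable_fun setT h.
    apply: measurable_funM => //; apply: measurable_funM; last first.
      by apply: measurable_funX; apply: (measurableT_comp measurable_den); exact: measurable_funM.
    by apply: measurable_funM => //; exact: measurable_funM.
  have FH : measurable_wrt F (fun w => h (X w)).
    apply/(measurable_wrtP hF); apply: (measurableT_comp mh).
    exact/(measurable_wrtP hF).
  have hb x : `|h x| <= 2 * `|s|.
    rewrite /h normrM ler_wpM2r// -mulrA normrM ger0_norm// ler_piMr// normrM.
    rewrite [`|_ ^+ 2|]ger0_norm ?sqr_ge0//.
    set y := s * x; set u := (1 + y ^+ 2)^-1.
    have u0 : 0 < u by rewrite invr_gt0.
    have u1 : u <= 1 by rewrite invf_le1// lerDl sqr_ge0.
    have yu : `|y| * u <= 1.
      rewrite ler_pdivrMr// mul1r -real_normK ?num_real//.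
      by have := sqr_ge0 (`|y| - 1); nra.
    by rewrite expr2 mulrA mulr_ile1 ?mulr_ge0 ?normr_ge0 ?(ltW u0).
  have iHZ : P.-integrable setT (fun w => (h (X w) * Z w)%:E).
    by apply: (integrableM_bounded _ (fun w => hb _)) => //; exact: measurableT_comp.
  have iphis : P.-integrable setT (EFin \o (fun w => phi (s * X w))) by exact: iphi.
  have isZ2 : P.-integrable setT (EFin \o (fun w => s ^+ 2 * Z w ^+ 2)).
    exact: (integrableZl measurableT (s ^+ 2) iZ2).
  have iphiHZ : P.-integrable setT
      (EFin \o (fun w => phi (s * X w) + h (X w) * Z w)) by exact: integrable_addr.
  have HZ0 := cond_exp0_pull_out hF hFm Z0 FH iHZ.
  have -> : a (2 * s) = \int[P]_w phi (s * (X w + Z w)).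
    rewrite /a; under eq_Rintegral do rewrite phi_mul2.
    apply/esym/(eq_in_distribution_integral (f := fun x => phi (s * x)) XZ).
    - exact: measurable_funD.
    - exact: measurable_funM.
    - by apply: (measurableT_comp measurable_phi); exact: measurable_funM.
  apply: (@le_trans _ _ (\int[P]_w (phi (s * X w) + h (X w) * Z w + s ^+ 2 * Z w ^+ 2))).
    apply: le_Rintegral => //.
    - by apply: iphi; apply: measurable_funM => //; exact: measurable_funD.
    - exact: integrable_addr.
    - move=> w _; rewrite mulrDr; apply: (le_trans (phi_add _ _)).
      by rewrite (exprMn_comm _ (mulrC s (Z w))) /h mulrA.
  rewrite RintegralD// RintegralD//.
  rewrite [X in _ + X + _](_ : _ = 0); last by rewrite /Rintegral HZ0.
  by rewrite addr0 lerD2l RintegralZl// ler_wpM2l ?sqr_ge0.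
(* Halving s repeatedly adds errors s^2 m / 4^j; bounding them by s^2 m / 2^j gives a sum that
   telescopes to the stated form. *)
have iter s k : a s <= a (s * 2^-1 ^+ k) + s ^+ 2 * m * (1 - 2^-1 ^+ k).
  elim: k => [|k /le_trans]; first by rewrite expr0 mulr1 subrr mulr0 addr0.
  apply; set t := s * 2^-1 ^+ k.+1.
  have -> : s * 2^-1 ^+ k = 2 * t by rewrite /t exprS; field.
  have := step t; have : t ^+ 2 <= s ^+ 2 * 2^-1 ^+ k.+1.
    rewrite /t exprMn ler_wpM2l ?sqr_ge0// expr2 ler_piMr ?exprn_ge0//.
    by rewrite exprn_ile1//; lra.
  have e2 : 2^-1 ^+ k = 2 * 2^-1 ^+ k.+1 :> R by rewrite exprS; field.
  by rewrite e2; move: (2^-1 ^+ k.+1) => q; nra.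
have cvg2 : (fun k => 2^-1 ^+ k : R) @ \oo --> (0 : R).
  by apply: cvg_expr; rewrite ger0_norm//; lra.
have lea s : a s <= s ^+ 2 * m.
  have acvg : a (s * 2^-1 ^+ k) @[k --> \oo] --> (\int[P]_w (0 : R)).
    apply: (@dominated_cvg_Rintegral (fun k w => phi (s * 2^-1 ^+ k * X w))
      (cst 0) (cst 1)) => //.
    - by move=> k; exact: (measurableT_comp measurable_phi).
    - exact: finite_measure_integrable_cst.
    - by move=> k w; rewrite ger0_norm.
    - move=> w; apply: (@squeeze_cvgr _ _ _ _ (cst 0)
        (fun k => (s * X w) ^+ 2 * (2^-1 ^+ k) ^+ 2)).
      + apply: nearW => k; rewrite phi_ge0/= /phi ler_pdivrMr//.
        by rewrite mulrAC -exprMn ler_peMr ?sqr_ge0// lerDl sqr_ge0.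
      + exact: cvg_cst.
      + rewrite [cst _ _](_ : _ = (s * X w) ^+ 2 * (0 * 0)); last by rewrite !mulr0.
        apply: cvgM; first exact: cvg_cst.
        by under eq_fun do rewrite expr2; exact: cvgM.
  rewrite Rintegral_cst// mul0r in acvg.
  have : a (s * 2^-1 ^+ k) + s ^+ 2 * m * (1 - 2^-1 ^+ k) @[k --> \oo] -->
         (0 + s ^+ 2 * m * (1 - 0) : R).
    by apply: cvgD => //; apply: cvgM; first exact: cvg_cst; apply: cvgB => //; exact: cvg_cst.
  rewrite subr0 mulr1 add0r => c.
  by apply: (cvgr_to_ge c); apply: nearW => k; exact: iter.
(* This is phi (s X) / s^2 at s = 1 / (k + 1). It increases to X^2, so monotone convergence
   transfers the bound [m]. *)
pose g k w := X w ^+ 2 / (1 + (harmonic k * X w) ^+ 2).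
have g0 k w : 0 <= g k w by rewrite divr_ge0 ?sqr_ge0// ltW.
have mg k : measurable_fun setT (g k).
  apply: measurable_funM; first exact: measurable_funX.
  exact: (measurableT_comp measurable_den).
have gm k : (\int[P]_w (g k w)%:E <= m%:E)%E.
  have h0 : 0 < harmonic k :> R by rewrite invr_gt0.
  have gE w : g k w = (harmonic k ^+ 2)^-1 * phi (harmonic k * X w).
    rewrite /phi [in RHS]exprMn mulrA mulKf// ?gt_eqF ?exprn_gt0//.
    by rewrite -exprMn.
  under eq_integral do rewrite gE EFinM.
  rewrite ge0_integralZl//.
  - have := lea (harmonic k); rewrite -lee_fin /a fineK ?integrable_fin_num//; last first.
      exact: iphi.
    move=> h; apply: (le_trans (lee_wpmul2l _ h)).
      by rewrite lee_fin invr_ge0 sqr_ge0.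
    by rewrite -EFinM mulKf// gt_eqF// exprn_gt0.
  - by apply/measurable_EFinP; exact: (measurableT_comp measurable_phi).
  - by move=> w _; rewrite lee_fin.
  - by rewrite lee_fin invr_ge0 sqr_ge0.
have gnd w i j : (i <= j)%N -> g i w <= g j w.
  move=> ij; rewrite ler_wpM2l ?sqr_ge0// lef_pV2 ?posrE// lerD2l !exprMn.
  by rewrite ler_wpM2r ?sqr_ge0// ler_sqr ?nnegrE ?invr_ge0// lef_pV2 ?posrE// ler_nat.
have gX w : g k w @[k --> \oo] --> X w ^+ 2.
  rewrite -[X in _ --> X]divr1; apply: cvgM; first exact: cvg_cst.
  apply: cvgV; first exact: oner_neq0.
  rewrite -[X in _ --> X]addr0; apply: cvgD; first exact: cvg_cst.
  rewrite (_ : 0 = (0 * X w) ^+ 2); last by rewrite mul0r expr0n.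
  under eq_fun do rewrite expr2; rewrite expr2.
  by apply: cvgM; apply: cvgM; [exact: cvg_harmonic|exact: cvg_cst|exact: cvg_harmonic|exact: cvg_cst].
have limE w : (X w ^+ 2)%:E = limn (fun k => (g k w)%:E).
  by apply/esym/cvg_lim => //; apply: cvg_EFin; [exact: nearW|exact: gX].
under eq_integral do rewrite limE.
rewrite monotone_convergence//.
- apply: lime_le; last by apply: nearW => k; exact: gm.
  apply: ereal_nondecreasing_is_cvgn => i j ij; apply: ge0_le_integral => //.
  + by move=> w _; rewrite lee_fin.
  + exact/measurable_EFinP.
  + exact/measurable_EFinP.
  + by move=> w _; rewrite lee_fin gnd.
- by move=> k; exact/measurable_EFinP.
- by move=> k w _; rewrite lee_fin.
- by move=> w _ i j ij; rewrite lee_fin gnd.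
Qed.

End moments.

(** * Parametric integrals and finitely valued maps *)

Lemma measurable_Rintegral_param (R : realType) d1 d2 (T1 : measurableType d1)
    (T2 : measurableType d2) (m : {sigma_finite_measure set T2 -> \bar R})
    (f : T1 * T2 -> R) : measurable_fun setT f ->
  measurable_fun setT (fun x => \int[m]_y f (x, y)).
Proof.
move=> mf.
have mi (g : T1 * T2 -> R) : measurable_fun setT g -> (forall p, 0 <= g p) ->
    measurable_fun setT (fun x => \int[m]_y (g (x, y))%:E)%E.
  move=> mg g0; apply: (measurable_fun_fubini_tonelli_F (EFin \o g)).
    exact/measurable_EFinP.
  by move=> p; rewrite lee_fin.
apply: (measurableT_comp (fine_measurable measurableT)).
rewrite (_ : (fun x => _) = (fun x => \int[m]_y (Num.max (f (x, y)) 0)%:E -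
    \int[m]_y (Num.max (- f (x, y)) 0)%:E)%E); last first.
  apply/funext => x; rewrite integralE; congr (_ - _)%E.
    by apply: eq_integral => y _; rewrite funeposE -EFin_max.
  by apply: eq_integral => y _; rewrite funenegE -EFinN -EFin_max.
apply: emeasurable_funB.
- apply: (mi (fun p => Num.max (f p) 0)); first exact: measurable_maxr.
  by move=> p; rewrite le_max lexx orbT.
- apply: (mi (fun p => Num.max (- f p) 0)).
    by apply: measurable_maxr => //; exact: measurableT_comp.
  by move=> p; rewrite le_max lexx orbT.
Qed.

Section finite_valued.
Context {R : realType} d (T : measurableType d) (I : finType) (J : T -> I).
Hypothesis mJ : forall j, measurable (J @^-1` [set j]).

Lemma sum_indic_fiber (x : T) (F : I -> R) :
  \sum_(j : I) \1_(J @^-1` [set j]) x * F j = F (J x).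
Proof.
rewrite (bigD1 (J x))//= indicE mem_set// mul1r big1 ?addr0// => j jx.
by rewrite indicE memNset ?mul0r// => /= /esym/eqP; apply/negP.
Qed.

Lemma measurable_fun_fiber (c : I -> R) : measurable_fun setT (fun x => c (J x)).
Proof.
under eq_fun do rewrite -(sum_indic_fiber _ c).
by apply: measurable_sum => j; apply: measurable_funM => //; exact: measurable_indic.
Qed.

End finite_valued.

Lemma measurable_truncn_fiber (R : realType) d (T : measurableType d) (f : T -> R) (k : nat) :
  measurable_fun setT f -> (forall x, 0 <= f x) ->
  measurable [set x | Num.truncn (f x) = k].
Proof.
move=> mf f0; rewrite (_ : [set _ | _] = f @^-1` [set` `[k%:R, k.+1%:R[ ]).
  by rewrite -[X in measurable X]setTI; apply: mf => //; exact: measurable_itv.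
apply/seteqP; split => x /=; rewrite in_itv/=.
  by move=> <-; rewrite truncn_itv.
by move=> h; apply/eqP; rewrite truncn_eq.
Qed.

(** * Exponential tilting of the prior *)

Section tilting.
Context {R : realType} {n : nat}.
Variables (pi0 : probability (n.-tuple R) R) (ts : n.-tuple R) (beta : R).
Hypothesis beta_gt0 : 0 < beta.
Implicit Types (B : set (n.-tuple R)) (x h theta : n.-tuple R).

Local Notation u theta i := (tnth theta i - tnth ts i).

Definition sqdist theta : R := \sum_(i < n) u theta i ^+ 2.

(* Up to a factor that does not depend on [theta], the Gibbs weight at the
   observation [ts + x], restricted to [B]. *)
Definition tilt B x theta : R := \1_B theta *
  expR ((2 * (\sum_(i < n) tnth x i * u theta i) - sqdist theta) / beta).

Definition mass B x : R := \int[pi0]_theta tilt B x theta.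

Definition tavg B x (f : n.-tuple R -> R) : R :=
  (\int[pi0]_theta (f theta * tilt B x theta)) / mass B x.

Definition mean B x i : R := tavg B x (fun theta => u theta i).

Definition second B x : R := tavg B x sqdist.

(** At most quadratic growth: a class closed under linear combinations, containing constants,
    coordinates and [sqdist], and integrable against every tilt whatever the prior, thanks to the
    Gaussian factor. *)
Definition admissible (f : n.-tuple R -> R) : Prop := measurable_fun setT f /\
  exists c, forall theta, `|f theta| <= c * (1 + sqdist theta).

Lemma sqdist_ge0 theta : 0 <= sqdist theta.
Proof. by apply: sumr_ge0 => i _; exact: sqr_ge0. Qed.

Let sq1_ge0 theta : 0 <= 1 + sqdist theta.
Proof. by rewrite addr_ge0// sqdist_ge0. Qed.

Lemma measurable_coord i : measurable_fun setT (fun theta => u theta i).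
Proof. by apply: measurable_funB => //; exact: measurable_tnth. Qed.

Lemma measurable_sqdist : measurable_fun setT sqdist.
Proof. by apply: measurable_sum => i; apply: measurable_funX; exact: measurable_coord. Qed.

Lemma admissible_cst c : admissible (cst c).
Proof.
split => //; exists `|c| => theta /=.
by rewrite ler_peMr// lerDl sqdist_ge0.
Qed.

Lemma admissible_coord i : admissible (fun theta => u theta i).
Proof.
split; first exact: measurable_coord.
exists 1 => theta; rewrite mul1r /sqdist (bigD1 i)//= addrA.
rewrite -[leLHS]addr0 lerD//; last by apply: sumr_ge0 => j _; exact: sqr_ge0.
rewrite -(real_normK (num_real (u theta i))).
have := normr_ge0 (u theta i); move: (`|_|) => y y0.
by have := sqr_ge0 (y - 1); nra.
Qed.

Lemma admissible_sqdist : admissible sqdist.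
Proof.
split; first exact: measurable_sqdist.
by exists 1 => theta; rewrite mul1r ger0_norm ?sqdist_ge0// lerDr.
Qed.

Lemma admissibleD f g : admissible f -> admissible g ->
  admissible (fun theta => f theta + g theta).
Proof.
move=> [mf [c fc]] [mg [c' gc]]; split; first exact: measurable_funD.
by exists (c + c') => theta; rewrite mulrDl (le_trans (ler_normD _ _))// lerD.
Qed.

Lemma admissibleZ c f : admissible f -> admissible (fun theta => c * f theta).
Proof.
move=> [mf [c' fc]]; split; first exact: measurable_funM.
by exists (`|c| * c') => theta; rewrite normrM -mulrA ler_wpM2l.
Qed.

Lemma admissible_sum (I : Type) (r : seq I) (f : I -> n.-tuple R -> R) :
  (forall i, admissible (f i)) -> admissible (fun theta => \sum_(i <- r) f i theta).
Proof.
move=> fa; elim: r => [|i r IH].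
  by under eq_fun do rewrite big_nil; exact: admissible_cst.
by under eq_fun do rewrite big_cons; exact: admissibleD.
Qed.

Lemma tilt_ge0 B x theta : 0 <= tilt B x theta.
Proof. by rewrite mulr_ge0 ?expR_ge0// indicE. Qed.

Lemma measurable_tilt B x : measurable B -> measurable_fun setT (tilt B x).
Proof.
move=> mB; apply: measurable_funM; first exact: measurable_indic.
apply: measurableT_comp => //; apply: measurable_funM => //.
apply: measurable_funB; last exact: measurable_sqdist.
apply: measurable_funM => //; apply: measurable_sum => i.
by apply: measurable_funM => //; exact: measurable_coord.
Qed.

Lemma tilt_le B x theta :
  tilt B x theta <= expR ((\sum_(i < n) tnth x i ^+ 2) / beta).
Proof.
rewrite -[leRHS]mul1r ler_pM ?expR_ge0//.
rewrite ler_expR ler_pM2r ?invr_gt0// mulr_sumr -sumrB; apply: ler_sum => i _.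
by have := sqr_ge0 (tnth x i - u theta i); nra.
Qed.

Lemma sqdist_tilt_le B x theta : (1 + sqdist theta) * tilt B x theta <=
  (1 + 2 * beta) * expR (2 * (\sum_(i < n) tnth x i ^+ 2) / beta).
Proof.
have s0 := sqdist_ge0 theta; set s := sqdist theta in s0 *.
have h1 : tilt B x theta <=
    expR (2 * (\sum_(i < n) tnth x i ^+ 2) / beta) * expR (- (s / (2 * beta))).
  rewrite -expRD -[leRHS]mul1r ler_pM ?expR_ge0//.
  rewrite ler_expR.
  have -> : 2 * (\sum_(i < n) tnth x i ^+ 2) / beta + - (s / (2 * beta)) =
     (2 * (\sum_(i < n) tnth x i ^+ 2) - s / 2) / beta by field; rewrite gt_eqF.
  rewrite ler_pM2r ?invr_gt0// -/s /s /sqdist.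
  rewrite mulr_sumr mulr_sumr mulr_suml -!sumrB; apply: ler_sum => i _.
  by have := sqr_ge0 (2 * tnth x i - u theta i); nra.
apply: (le_trans (ler_wpM2l _ h1)); first exact: sq1_ge0.
rewrite mulrCA mulrC ler_wpM2r ?expR_ge0//.
set y := s / (2 * beta).
have y0 : 0 <= y by rewrite divr_ge0// mulr_ge0// ltW.
have -> : s = 2 * beta * y by rewrite /y; field; rewrite gt_eqF.
have := expR_ge1Dx y; have := expRxMexpNx_1 y; have := expR_gt0 (- y).
set a := expR y; set c := expR (- y) => c0 ac ya.
have c1 : c <= 1 by nra.
have yc : y * c <= 1 by nra.
by have : beta * (y * c) <= beta; [rewrite ler_piMr// ltW|lra].
Qed.

Lemma integrable_tilt B x f : measurable B -> admissible f ->
  pi0.-integrable setT (EFin \o (fun theta => f theta * tilt B x theta)).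
Proof.
move=> mB [mf [c fc]].
apply: (@bounded_integrable _ _ _ _ _
  (`|c| * ((1 + 2 * beta) * expR (2 * (\sum_(i < n) tnth x i ^+ 2) / beta)))).
  by apply: measurable_funM => //; exact: measurable_tilt.
move=> theta; rewrite normrM [`|tilt _ _ _|]ger0_norm ?tilt_ge0//.
apply: (@le_trans _ _ (`|c| * ((1 + sqdist theta) * tilt B x theta))); last first.
  by rewrite ler_wpM2l// sqdist_tilt_le.
rewrite [leRHS]mulrA ler_wpM2r ?tilt_ge0// (le_trans (fc theta))//.
by rewrite ler_wpM2r// ler_norm.
Qed.

Lemma integrable_tilt1 B x : measurable B ->
  pi0.-integrable setT (EFin \o tilt B x).
Proof.
move=> mB; have := integrable_tilt x mB (admissible_cst 1).
by under [X in _.-integrable _ X -> _]eq_fun do rewrite /= mul1r.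
Qed.

Lemma mass_gt0 B x : measurable B -> (0 < pi0 B)%E -> 0 < mass B x.
Proof.
move=> mB B0.
have m0 : 0 <= mass B x by apply: Rintegral_ge0 => t _; exact: tilt_ge0.
rewrite lt_def m0 andbT; apply/eqP => m00.
have i1 := integrable_tilt1 x mB.
have : (\int[pi0]_t `|(EFin \o tilt B x) t| = 0)%E.
  under eq_integral => t _ do rewrite gee0_abs ?lee_fin ?tilt_ge0//.
  by rewrite -(fineK (integrable_fin_num measurableT i1)) [X in X%:E]m00.
move/ae_eq_integral_abs => /(_ measurableT).
have mt : measurable_fun setT (EFin \o tilt B x) by apply/measurable_EFinP; exact: measurable_tilt.
move=> /(_ mt) [N [mN N0 sub]].
have : (pi0 B <= pi0 N)%E.
  apply: le_measure; rewrite ?inE// => t Bt; apply: sub => /= /(_ I) [] /eqP.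
  by rewrite /tilt indicE mem_set// mul1r gt_eqF// expR_gt0.
by rewrite N0 leNgt B0.
Qed.

Section nondegenerate.
Variable B : set (n.-tuple R).
Hypotheses (mB : measurable B) (B_gt0 : (0 < pi0 B)%E).

Let mass_neq0 x : mass B x != 0.
Proof. by rewrite gt_eqF// mass_gt0. Qed.

Lemma tavg_cst x c : tavg B x (cst c) = c.
Proof.
by rewrite /tavg RintegralZl// -/(mass B x) ?mulfK//; exact: integrable_tilt1.
Qed.

Lemma tavgD x f g : admissible f -> admissible g ->
  tavg B x (fun theta => f theta + g theta) = tavg B x f + tavg B x g.
Proof.
move=> fa ga; rewrite /tavg; under eq_Rintegral do rewrite mulrDl.
by rewrite RintegralD ?mulrDl//; exact: integrable_tilt.
Qed.

Lemma tavgZ x c f : admissible f ->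
  tavg B x (fun theta => c * f theta) = c * tavg B x f.
Proof.
move=> fa; rewrite /tavg; under eq_Rintegral do rewrite -mulrA.
by rewrite RintegralZl ?mulrA//; exact: integrable_tilt.
Qed.

Lemma tavg_sum x (I : Type) (r : seq I) (f : I -> n.-tuple R -> R) :
  (forall i, admissible (f i)) ->
  tavg B x (fun theta => \sum_(i <- r) f i theta) = \sum_(i <- r) tavg B x (f i).
Proof.
move=> fa; rewrite /tavg; under eq_Rintegral do rewrite mulr_suml.
by rewrite Rintegral_sum ?mulr_suml// => i _; exact: integrable_tilt.
Qed.

Lemma le_tavg x f g : admissible f -> admissible g ->
  (forall theta, B theta -> f theta <= g theta) -> tavg B x f <= tavg B x g.
Proof.
move=> fa ga fg; rewrite /tavg ler_pM2r ?invr_gt0 ?mass_gt0//.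
apply: le_Rintegral => //; [exact: integrable_tilt..|move=> t _].
have [Bt|nBt] := pselect (B t); first by rewrite ler_wpM2r ?tilt_ge0// fg.
by rewrite /tilt indicE memNset// mul0r !mulr0.
Qed.

Lemma ln_addr_le (m1 m2 a : R) : 0 < m1 -> 0 < m2 -> m1 * expR a <= m2 ->
  ln m1 + a <= ln m2.
Proof. by move=> m10 m20 H; rewrite -ler_expR expRD !lnK ?posrE. Qed.

Lemma ln_subr_le (m1 m2 a : R) : 0 < m1 -> 0 < m2 ->
  ln m2 - ln m1 - a <= m2 * expR (- a) / m1 - 1.
Proof.
move=> m10 m20; set X := _ / m1.
have X0 : 0 < X by rewrite divr_gt0// mulr_gt0 ?expR_gt0.
have -> : ln m2 - ln m1 - a = ln X.
  rewrite /X lnM ?posrE ?mulr_gt0 ?expR_gt0 ?invr_gt0// lnM ?posrE ?expR_gt0//.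
  by rewrite expRK lnV ?posrE//; ring.
by have := @le_ln1Dx R (X - 1); rewrite addrCA subrr addr0; apply; lra.
Qed.

Definition lmass B x : R := ln (mass B x).

Definition var B x : R := second B x - \sum_(i < n) mean B x i ^+ 2.

Definition sqn x : R := \sum_(i < n) tnth x i ^+ 2.

Lemma RintegralM_tilt x f :
  \int[pi0]_theta (f theta * tilt B x theta) = tavg B x f * mass B x.
Proof. by rewrite /tavg divfK. Qed.

Lemma admissible_lin (a : 'I_n -> R) :
  admissible (fun theta => \sum_(i < n) a i * u theta i).
Proof. by apply: admissible_sum => i; apply: admissibleZ; exact: admissible_coord. Qed.

Lemma tavg_lin x (a : 'I_n -> R) :
  tavg B x (fun theta => \sum_(i < n) a i * u theta i) =
  \sum_(i < n) a i * mean B x i.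
Proof.
rewrite tavg_sum => [|i]; last by apply: admissibleZ; exact: admissible_coord.
by apply: eq_bigr => i _; rewrite tavgZ//; exact: admissible_coord.
Qed.

Lemma tilt_vadd x h theta : tilt B (vadd x h) theta =
  expR (2 / beta * \sum_(i < n) tnth h i * u theta i) * tilt B x theta.
Proof.
rewrite /tilt mulrCA -expRD; congr (_ * expR _).
under eq_bigr do rewrite tnth_mktuple mulrDl.
by rewrite big_split/=; ring.
Qed.

(** Jensen's inequality under the tilted prior for the exponential of (2 / beta) h.u, whose average
    is a. It is proved by integrating the tangent line [f] of the exponential at a, so that only
    admissible functions are averaged. *)
Lemma lmass_tangent x h :
  lmass B x + 2 / beta * (\sum_(i < n) tnth h i * mean B x i) <=
  lmass B (vadd x h).
Proof.
set a := _ * (\sum_(_ < _) _).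
have mx := mass_gt0 x mB B_gt0; have mh := mass_gt0 (vadd x h) mB B_gt0.
suff H : mass B x * expR a <= mass B (vadd x h).
  exact: ln_addr_le.
pose f theta := expR a * (1 - a) +
  expR a * (\sum_(i < n) 2 / beta * tnth h i * u theta i).
have fa : admissible f.
  by apply: admissibleD; [exact: admissible_cst|exact/admissibleZ/admissible_lin].
have -> : mass B x * expR a = \int[pi0]_theta (f theta * tilt B x theta).
  rewrite RintegralM_tilt tavgD; first last.
  - exact/admissibleZ/admissible_lin.
  - exact: admissible_cst.
  rewrite tavg_cst tavgZ; last exact: admissible_lin.
  rewrite tavg_lin mulrC; congr (_ * _).
  under eq_bigr do rewrite -(mulrA (2 / beta)).
  by rewrite -mulr_sumr -/a; ring.
apply: le_Rintegral => //; [exact: integrable_tilt|exact: integrable_tilt1|].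
move=> theta _; rewrite tilt_vadd ler_wpM2r ?tilt_ge0//.
rewrite /f; under eq_bigr do rewrite -(mulrA (2 / beta)).
rewrite -mulr_sumr; set y := _ * (\sum_(_ < _) _).
rewrite -[y in leRHS](subrK a) [in leRHS]addrC expRD -mulrDr ler_pM2l ?expR_gt0//.
by apply: le_trans (expR_ge1Dx _); lra.
Qed.

(** The tilted prior has log-density (2 x.u - |u|^2) / beta - [lmass B x] on [B] with respect to
    [pi0], and its relative entropy is nonnegative. Here [f] is one minus this log-density, and 1 +
    y <= e^y gives it a tilted average of at most 1. *)
Lemma second_le x :
  second B x <= 2 * (\sum_(i < n) tnth x i * mean B x i) - beta * lmass B x.
Proof.
have mx := mass_gt0 x mB B_gt0.
pose f theta := 1 + lmass B x +
  (\sum_(i < n) (- 2 / beta * tnth x i) * u theta i + beta^-1 * sqdist theta).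
have ga : admissible (fun theta =>
    \sum_(i < n) (- 2 / beta * tnth x i) * u theta i + beta^-1 * sqdist theta).
  by apply: admissibleD; [exact: admissible_lin|exact/admissibleZ/admissible_sqdist].
have fa : admissible f by apply: admissibleD => //; exact: admissible_cst.
have h : \int[pi0]_theta (f theta * tilt B x theta) <= \int[pi0]_theta mass B x.
  apply: le_Rintegral => //; first exact: integrable_tilt.
    exact: finite_measure_integrable_cst.
  move=> theta _; have [Bt|nBt] := pselect (B theta); last first.
    by rewrite /tilt indicE memNset// mul0r mulr0 ltW.
  rewrite /tilt indicE mem_set// mul1r; set g := (_ / beta).
  have -> : f theta = 1 + (lmass B x - g).
    rewrite /f /g; under eq_bigr do rewrite -(mulrA (- 2 / beta)).
    by rewrite -mulr_sumr; field; rewrite gt_eqF.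
  apply: (le_trans (ler_wpM2r (expR_ge0 _) (expR_ge1Dx _))).
  by rewrite -expRD subrK lnK// posrE.
rewrite RintegralM_tilt Rintegral_cst// [X in fine X]probability_setT mulr1 in h.
have : tavg B x f <= 1 by rewrite -(ler_pM2r mx) mul1r.
rewrite tavgD//; last exact: admissible_cst.
rewrite tavg_cst tavgD; first last.
- exact/admissibleZ/admissible_sqdist.
- exact: admissible_lin.
rewrite tavgZ; last exact: admissible_sqdist.
rewrite tavg_lin -/(second B x); under eq_bigr do rewrite -(mulrA (- 2 / beta)).
rewrite -mulr_sumr => h2.
have : beta * (lmass B x + (- 2 / beta * (\sum_(i < n) tnth x i * mean B x i)
   + beta^-1 * second B x)) <= 0 by rewrite pmulr_rle0//; lra.
set S := \sum_(_ < _) _.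
have -> : beta * (lmass B x + (- 2 / beta * S + beta^-1 * second B x)) =
  beta * lmass B x - 2 * S + second B x by field; rewrite gt_eqF.
by lra.
Qed.

Lemma lmass_le x : lmass B x <= sqn x / beta.
Proof.
have mx := mass_gt0 x mB B_gt0.
rewrite -[leRHS]expRK ler_ln ?posrE ?expR_gt0//.
rewrite -[leRHS]mulr1 -[X in _ * X](congr1 fine (probability_setT pi0)).
rewrite -Rintegral_cst//; apply: le_Rintegral => //.
- exact: integrable_tilt1.
- exact: finite_measure_integrable_cst.
- by move=> theta _; exact: tilt_le.
Qed.

Let sqdistBE (c : 'I_n -> R) theta : \sum_(i < n) (u theta i - c i) ^+ 2 =
  sqdist theta + (\sum_(i < n) (- 2 * c i) * u theta i + \sum_(i < n) c i ^+ 2).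
Proof. by rewrite /sqdist -!big_split/=; apply: eq_bigr => i _; ring. Qed.

Lemma admissible_sqdistB (c : 'I_n -> R) :
  admissible (fun theta => \sum_(i < n) (u theta i - c i) ^+ 2).
Proof.
rewrite (funext (sqdistBE c)); apply: admissibleD; first exact: admissible_sqdist.
by apply: admissibleD; [exact: admissible_lin|exact: admissible_cst].
Qed.

Lemma tavg_sqdistB x (c : 'I_n -> R) :
  tavg B x (fun theta => \sum_(i < n) (u theta i - c i) ^+ 2) =
  var B x + \sum_(i < n) (mean B x i - c i) ^+ 2.
Proof.
rewrite (funext (sqdistBE c)).
rewrite tavgD; first last.
- by apply: admissibleD; [exact: admissible_lin|exact: admissible_cst].
- exact: admissible_sqdist.
rewrite tavgD; first last.
- exact: admissible_cst.
- exact: admissible_lin.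
rewrite tavg_cst tavg_lin /var -/(second B x).
rewrite -addrA; congr (_ + _); rewrite addrC -sumrN -!big_split/=.
by apply: eq_bigr => i _; ring.
Qed.

Lemma var_ge0 x : 0 <= var B x.
Proof.
have := tavg_sqdistB x (mean B x).
rewrite [X in _ = _ + X]big1 ?addr0 => [<-|i _]; last by rewrite subrr expr0n.
apply: divr_ge0; last exact/ltW/mass_gt0.
apply: Rintegral_ge0 => t _; apply: mulr_ge0; last exact: tilt_ge0.
by apply: sumr_ge0 => i _; exact: sqr_ge0.
Qed.

Lemma sqmean_le x : \sum_(i < n) mean B x i ^+ 2 <= second B x.
Proof. by have := var_ge0 x; rewrite subr_ge0. Qed.

Let zero : n.-tuple R := [tuple 0 | i < n].

Let dot_le (a c : 'I_n -> R) :
  - (2 * \sum_(i < n) a i * c i) <= \sum_(i < n) a i ^+ 2 + \sum_(i < n) c i ^+ 2.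
Proof.
rewrite mulr_sumr -sumrN -big_split/=; apply: ler_sum => i _.
by have := sqr_ge0 (a i + c i); nra.
Qed.

(** The tangent at 0 gives the lower bound L(0) + (2 / beta) x.m(0), and 2 x.m(0) >= - |x|^2 -
    |m(0)|^2. Finally |m(0)|^2 <= - beta L(0) by [second_le] at 0, which accounts for the factor
    2. *)
Lemma lmass_ge x : 2 * lmass B [tuple 0 | i < n] - sqn x / beta <= lmass B x.
Proof.
have := lmass_tangent zero x.
have -> : vadd zero x = x.
  by apply: eq_from_tnth => i; rewrite !tnth_mktuple add0r.
have := second_le zero; rewrite big1 => [|i _]; last by rewrite tnth_mktuple mul0r.
have := sqmean_le zero; have := dot_le (tnth x) (mean B zero).
rewrite -/(sqn x) -/zero.
move: (\sum_(i < n) _ * _) (\sum_(i < n) mean B zero i ^+ 2) (sqn x)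
  (lmass B zero) (lmass B x) (second B zero) => S M Q W0 W s h1 h2 h3 h4.
have : - (Q - beta * W0) / beta <= 2 * S / beta by rewrite ler_pM2r ?invr_gt0//; lra.
have -> : - (Q - beta * W0) / beta = W0 - Q / beta by field; rewrite gt_eqF.
have -> : 2 * S / beta = 2 / beta * S by ring.
by lra.
Qed.

(** The tangent at x in the direction x, with [lmass_le] at 2 x, bounds 2 x.m(x) by 4 |x|^2 - beta
    L(x); [second_le] and [lmass_ge] finish. The bound is affine in |x|^2 and depends on [B] only
    through L(0), so it dominates uniformly along an exhaustion. *)
Lemma second_le_growth x :
  second B x <= 6 * sqn x - 4 * beta * lmass B [tuple 0 | i < n].
Proof.
have h1 := second_le x; have h2 := lmass_tangent x x; have h3 := lmass_le (vadd x x).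
have h4 := lmass_ge x.
have e : sqn (vadd x x) = 4 * sqn x.
  rewrite /sqn mulr_sumr; apply: eq_bigr => i _; rewrite tnth_mktuple; ring.
rewrite e in h3; move: h1 h2 h3 h4; set S := \sum_(_ < _) _; set Q := sqn x.
set W := lmass B x; set W2 := lmass B (vadd _ _); set W0 := lmass B _ => h1 h2 h3 h4.
have : beta * (W + 2 / beta * S) <= beta * (4 * Q / beta).
  by rewrite ler_pM2l//; lra.
have : beta * (2 * W0 - Q / beta) <= beta * W by rewrite ler_pM2l.
have -> : beta * (W + 2 / beta * S) = beta * W + 2 * S by field; rewrite gt_eqF.
have -> : beta * (4 * Q / beta) = 4 * Q by field; rewrite gt_eqF.
have -> : beta * (2 * W0 - Q / beta) = 2 * (beta * W0) - Q by field; rewrite gt_eqF.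
by lra.
Qed.

End nondegenerate.
End tilting.

Section tilting_measurability.
Context {R : realType} {n : nat}.
Variables (pi0 : probability (n.-tuple R) R) (ts : n.-tuple R) (beta : R).
Variable B : set (n.-tuple R).
Hypothesis mB : measurable B.
Local Notation Tn := (n.-tuple R).

Lemma measurable_tilt_pair d (W : measurableType d) (X : W -> Tn) (Th : W -> Tn) :
  measurable_fun setT X -> measurable_fun setT Th ->
  measurable_fun setT (fun w => tilt ts beta B (X w) (Th w)).
Proof.
move=> mX mTh.
have mc (U : W -> Tn) i : measurable_fun setT U ->
    measurable_fun setT (fun w => tnth (U w) i).
  by move=> mU; exact: (measurableT_comp (measurable_tnth i) mU).
apply: measurable_funM.
  by apply: (measurableT_comp _ mTh); exact: measurable_indic.
apply: measurableT_comp => //; apply: measurable_funM => //.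
apply: measurable_funB; last exact: (measurableT_comp (measurable_sqdist ts) mTh).
apply: measurable_funM => //; apply: measurable_sum => i.
apply: measurable_funM; first exact: mc.
exact: (measurableT_comp (measurable_coord ts i) mTh).
Qed.

Lemma measurable_RintegralM_tilt (f : Tn -> R) : measurable_fun setT f ->
  measurable_fun setT (fun x => \int[pi0]_theta (f theta * tilt ts beta B x theta)).
Proof.
move=> mf; apply: (measurable_Rintegral_param pi0
  (f := fun p : Tn * Tn => f p.2 * tilt ts beta B p.1 p.2)).
apply: measurable_funM; first exact: (measurableT_comp mf measurable_snd).
exact: measurable_tilt_pair.
Qed.

Lemma measurable_mass : measurable_fun setT (mass pi0 ts beta B).
Proof.
have := @measurable_RintegralM_tilt (cst 1) (measurable_cst _).
by under eq_fun do under eq_Rintegral do rewrite mul1r.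
Qed.

Hypotheses (beta_gt0 : 0 < beta) (B_gt0 : (0 < pi0 B)%E).

Lemma measurable_mass_inv : measurable_fun setT (fun x => (mass pi0 ts beta B x)^-1).
Proof.
apply: measurable_fun_invr; first exact: measurable_mass.
by move=> x; exact: mass_gt0.
Qed.

Lemma measurable_lmass : measurable_fun setT (lmass pi0 ts beta B).
Proof. by apply: measurableT_comp => //; exact: measurable_mass. Qed.

Lemma measurable_mean i : measurable_fun setT (fun x => mean pi0 ts beta B x i).
Proof.
apply: measurable_funM; last exact: measurable_mass_inv.
by apply: measurable_RintegralM_tilt; exact: measurable_coord.
Qed.

Lemma measurable_second : measurable_fun setT (second pi0 ts beta B).
Proof.
apply: measurable_funM; last exact: measurable_mass_inv.
by apply: measurable_RintegralM_tilt; exact: measurable_sqdist.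
Qed.

Lemma measurable_var : measurable_fun setT (var pi0 ts beta B).
Proof.
apply: measurable_funB; first exact: measurable_second.
by apply: measurable_sum => i; apply: measurable_funX; exact: measurable_mean.
Qed.

Let norm_le_of_bounds (L Q a : R) : L <= Q -> 2 * a - Q <= L -> 0 <= Q ->
  `|L| <= 2 * `|a| + Q.
Proof.
have := normr_ge0 a; have := ler_norm (- a); rewrite normrN.
by move: (`|a|) => q *; rewrite ler_norml; apply/andP; split; lra.
Qed.

Section integrability.
Context d {W : measurableType d} (P : probability W R) (X : W -> Tn).
Hypotheses (mX : measurable_fun setT X).
Hypothesis iX : P.-integrable setT (EFin \o (fun w => sqn (X w))).
Let W0 := lmass pi0 ts beta B [tuple 0 | i < n].

Lemma integrable_lmass :
  P.-integrable setT (EFin \o (fun w => lmass pi0 ts beta B (X w))).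
Proof.
apply: (@le_integrable_real _ _ _ P setT measurableT _
    (fun w => 2 * `|W0| + beta^-1 * sqn (X w))).
- exact: (measurableT_comp measurable_lmass mX).
- move=> w _.
  rewrite (mulrC beta^-1); apply: norm_le_of_bounds.
  - exact: lmass_le.
  - exact: lmass_ge.
  - by rewrite divr_ge0 ?(ltW beta_gt0)// sumr_ge0// => i _; exact: sqr_ge0.
- apply: integrable_addr => //; first exact: finite_measure_integrable_cst.
  exact: integrable_scaler.
Qed.

Lemma integrable_second :
  P.-integrable setT (EFin \o (fun w => second pi0 ts beta B (X w))).
Proof.
apply: (@le_integrable_real _ _ _ P setT measurableT _
    (fun w => 6 * sqn (X w) + (- (4 * beta * W0)))).
- exact: (measurableT_comp measurable_second mX).
- move=> w _; rewrite ger0_norm; first exact: second_le_growth.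
  apply: le_trans (sqmean_le ts beta_gt0 mB B_gt0 (X w)).
  by apply: sumr_ge0 => i _; exact: sqr_ge0.
- apply: integrable_addr => //; last exact: finite_measure_integrable_cst.
  exact: integrable_scaler.
Qed.

Lemma integrable_var :
  P.-integrable setT (EFin \o (fun w => var pi0 ts beta B (X w))).
Proof.
apply: (@le_integrable_real _ _ _ P setT measurableT _ _ _ _ integrable_second).
- exact: (measurableT_comp measurable_var mX).
- move=> w _; rewrite ger0_norm; last exact: var_ge0.
  by rewrite lerBlDr lerDl; apply: sumr_ge0 => i _; exact: sqr_ge0.
Qed.

Lemma integrable_dot_mean : P.-integrable setT
  (EFin \o (fun w => \sum_(i < n) tnth (X w) i * mean pi0 ts beta B (X w) i)).
Proof.
apply: (@le_integrable_real _ _ _ P setT measurableT _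
    (fun w => sqn (X w) + second pi0 ts beta B (X w))).
- apply: measurable_sum => i; apply: measurable_funM.
    exact: (measurableT_comp (measurable_tnth i) mX).
  exact: (measurableT_comp (measurable_mean i) mX).
- move=> w _.
  apply: (@le_trans _ _ (sqn (X w) + \sum_(i < n) mean pi0 ts beta B (X w) i ^+ 2)).
    rewrite /sqn -big_split/=; apply: le_trans (ler_norm_sum _ _ _) _.
    apply: ler_sum => i _; rewrite normrM.
    rewrite -(real_normK (num_real (tnth _ _))) -(real_normK (num_real (mean _ _ _ _ _ _))).
    by move: (`|_|) (`|_|) => p q; have := sqr_ge0 (p - q); nra.
  by rewrite lerD2l; exact: sqmean_le.
- by apply: integrable_addr => //; exact: integrable_second.
Qed.

End integrability.
End tilting_measurability.

(** * The key inequality on a box *)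

(* On a box of side [D], Bernstein's condition bounds the conditional logarithmic
   moment generating function of [2 / beta * zeta.(u - c)] by [kappa * |u - c| ^+ 2];
   as [|u - c| ^+ 2 <= n * D ^+ 2], the exponential of the latter is at most
   [1 + curvature * |u - c| ^+ 2]. *)
Definition curvature (R : realType) (n : nat) (beta v b D : R) : R :=
  let kappa := 2 * v / (beta * (beta - 2 * b * D)) in
  kappa * expR (kappa * (n%:R * D ^+ 2)).

Section key_inequality.
Context {R : realType} {n : nat}.
Variables (pi0 : probability (n.-tuple R) R) (ts : n.-tuple R) (beta : R).
Variable B : set (n.-tuple R).
Hypotheses (beta_gt0 : 0 < beta) (mB : measurable B) (B_gt0 : (0 < pi0 B)%E).
Local Notation Tn := (n.-tuple R).
Local Notation u theta i := (tnth theta i - tnth ts i).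
Local Notation tilt := (tilt ts beta B).
Local Notation mass := (mass pi0 ts beta B).
Local Notation lmass := (lmass pi0 ts beta B).
Local Notation mean := (mean pi0 ts beta B).
Local Notation second := (second pi0 ts beta B).
Local Notation var := (var pi0 ts beta B).
Local Notation tavg := (tavg pi0 ts beta B).

Variables (l : 'I_n -> R) (D : R).
Hypothesis D0 : 0 <= D.
Hypothesis box : forall theta, B theta -> forall i, l i <= u theta i <= l i + D.

Lemma mean_box x i : l i <= mean x i <= l i + D.
Proof.
rewrite -[X in X <= _](tavg_cst ts beta_gt0 mB B_gt0 x).
rewrite -[X in _ <= _ <= X](tavg_cst ts beta_gt0 mB B_gt0 x (l i + D)).
apply/andP; split; apply: le_tavg => //; do ?exact: admissible_cst;
  do ?exact: admissible_coord.
- by move=> theta /box /(_ i) /andP[].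
- by move=> theta /box /(_ i) /andP[].
Qed.

(* With a finitely valued centre, the conditional moment generating function of
   [zeta] is only needed at one deterministic exponent on each fibre of [J]. *)
Lemma mean_discretization (e : R) : 0 < e ->
  exists (I : finType) (J : Tn -> I) (c : I -> 'I_n -> R),
    (forall j, measurable (J @^-1` [set j])) /\
    forall x i, l i <= c (J x) i <= l i + D /\ `|mean x i - c (J x) i| <= e.
Proof.
move=> e0; pose N := (Num.truncn (D / e)).+1.
pose g i x := (mean x i - l i) / e.
have g0 i x : 0 <= g i x.
  by rewrite divr_ge0 ?(ltW e0)// subr_ge0; have /andP[] := mean_box x i.
have gN i x : (Num.truncn (g i x) < N)%N.
  rewrite -(ltr_nat R); have /andP[+ _] := truncn_itv (g0 i x).
  move=> /le_lt_trans; apply; apply: le_lt_trans (truncnS_gt _).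
  by rewrite ler_pM2r ?invr_gt0// lerBlDl; have /andP[] := mean_box x i.
(* Each coordinate of the mean is rounded down to the grid of step [e] based at [l i]. Rounding down
   keeps the centre inside the box, which later gives |u - c| <= D coordinatewise. *)
exists ({ffun 'I_n -> 'I_N} : finType), (fun x => [ffun i => Ordinal (gN i x)]),
  (fun (j : {ffun 'I_n -> 'I_N}) i => l i + (j i : nat)%:R * e); split.
- move=> j; rewrite (_ : _ @^-1` _ =
      \bigcap_(i in [set: 'I_n]) [set x | Num.truncn (g i x) = j i]).
    apply: fin_bigcap_measurable; first exact: finite_finset.
    move=> i _; apply: measurable_truncn_fiber => //.
    apply: measurable_funM => //; apply: measurable_funB => //.
    exact: measurable_mean.
  apply/seteqP; split => x /=.
    by move=> <- i _; rewrite ffunE.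
  by move=> h; apply/ffunP => i; apply: val_inj; rewrite ffunE /= (h i).
- move=> x i; rewrite ffunE /=.
  have /andP[] := truncn_itv (g0 i x); rewrite -natr1.
  have k0 : 0 <= (Num.truncn (g i x))%:R :> R by exact: ler0n.
  move: k0; move: (_%:R) => k k0 h1 h2.
  have gE : g i x * e = mean x i - l i by rewrite /g divfK// gt_eqF.
  have /andP[m1 m2] := mean_box x i.
  have ke : k * e <= mean x i - l i by rewrite -gE ler_pM2r.
  have ke0 : 0 <= k * e by rewrite mulr_ge0// ltW.
  have ke1 : mean x i - l i <= k * e + e.
    by rewrite -gE -[X in _ + X]mul1r -mulrDl ler_pM2r// ltW.
  move: (mean x i) m1 m2 ke ke1 {gE} => m m1 m2 ke ke1.
  split; first by apply/andP; split; lra.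
  by rewrite ler_norml; apply/andP; split; lra.
Qed.

Context d {Omega : measurableType d} (P : probability Omega R).
Variables (F : set (set Omega)) (hF : sigma_algebra setT F) (hFm : F `<=` measurable).
Variables (xi zeta : Omega -> Tn) (v b : R).
Hypotheses (hxi : measurable_wrt F xi) (mzeta : measurable_fun setT zeta).
Hypotheses (v0 : 0 <= v) (b0 : 0 <= b) (bD : 2 * b * D < beta).
Hypothesis ind : cond_independent P F zeta.
Hypothesis bern : forall i, cond_bernstein P F v b (fun w => tnth (zeta w) i).

Let mxi : measurable_fun setT xi := measurable_fun_wrt hF hFm hxi.

Let mzetai i : measurable_fun setT (fun w => tnth (zeta w) i).
Proof. exact: (measurableT_comp (measurable_tnth i) mzeta). Qed.

Lemma integral_expR_fiber_le (I : finType) (J : Tn -> I) (t : I -> 'I_n -> R)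
    (psi : I -> R) (G : Tn -> R) :
  (forall j, measurable (J @^-1` [set j])) -> measurable_fun setT G ->
  (forall x, 0 <= G x) -> (forall x i, b * `|t (J x) i| < 1) ->
  (forall x, \sum_(i < n) v * t (J x) i ^+ 2 / (2 * (1 - b * `|t (J x) i|))
     <= psi (J x)) ->
  (\int[P]_w (G (xi w) * expR (\sum_(i < n) t (J (xi w)) i * tnth (zeta w) i))%:E
    <= \int[P]_w (G (xi w) * expR (psi (J (xi w))))%:E)%E.
Proof.
move=> mJ mG G0 bt tpsi.
have mind j : measurable_fun setT (fun x => \1_(J @^-1` [set j]) x * G x).
  by apply: measurable_funM => //; exact: measurable_indic.
have FH j : measurable_wrt F (fun w => \1_(J @^-1` [set j]) (xi w) * G (xi w)).
  apply/(measurable_wrtP hF); apply: (measurableT_comp (mind j)).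
  exact/(measurable_wrtP hF).
have H0 j w : 0 <= \1_(J @^-1` [set j]) (xi w) * G (xi w).
  by rewrite mulr_ge0// indicE.
have mE j : measurable_fun setT
    (fun w => expR (\sum_(i < n) t j i * tnth (zeta w) i)).
  apply: measurableT_comp => //; apply: measurable_sum => i.
  exact: measurable_funM.
have splitE (f : I -> Omega -> R) : (\int[P]_w (G (xi w) * f (J (xi w)) w)%:E =
    \int[P]_w (\sum_j (\1_(J @^-1` [set j]) (xi w) * G (xi w) * f j w)%:E))%E.
  apply: eq_integral => w _; rewrite sumEFin; congr EFin.
  rewrite -(sum_indic_fiber J (xi w) (fun j => G (xi w) * f j w)).
  by apply: eq_bigr => j _; rewrite mulrA.
rewrite (splitE (fun j w => expR (\sum_(i < n) t j i * tnth (zeta w) i))).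
rewrite (splitE (fun j w => expR (psi j))).
rewrite ge0_integral_sum//; last 2 first.
- move=> j; apply/measurable_EFinP; apply: measurable_funM => //.
  exact: (measurableT_comp (mind j) mxi).
- by move=> j w _; rewrite lee_fin mulr_ge0 ?expR_ge0.
rewrite ge0_integral_sum//; last 2 first.
- move=> j; apply/measurable_EFinP; apply: measurable_funM => //.
  exact: (measurableT_comp (mind j) mxi).
- by move=> j w _; rewrite lee_fin mulr_ge0 ?expR_ge0.
apply: lee_sum => j _.
(* The assumptions on [t] and [psi] concern only values attained by [J]; on an empty fibre both
   integrals are 0. *)
have [[x Jx]|nJ] := pselect (exists x, J x = j).
  apply: (le_integral_pull_out hF hFm) => //.
  move=> A FA; rewrite -Jx.
  apply: (le_trans (cond_bernstein_mgf hF hFm mzeta ind bern (bt x) FA)).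
  by apply: lee_wpmul2r => //; rewrite lee_fin ler_expR.
have E (f : Omega -> R) : (\int[P]_w (\1_(J @^-1` [set j]) (xi w) * G (xi w) * f w)%:E = 0)%E.
  apply: integral0_eq => w _; rewrite indicE memNset ?mul0r// => h.
  by apply: nJ; exists (xi w).
by rewrite !E.
Qed.

Let kappa := 2 * v / (beta * (beta - 2 * b * D)).
Let kappa' := kappa * expR (kappa * (n%:R * D ^+ 2)).

Let kappa_ge0 : 0 <= kappa.
Proof. by rewrite divr_ge0 ?mulr_ge0// ?(ltW beta_gt0)// subr_ge0 ltW. Qed.

Let expR_kappa_le (s : R) : 0 <= s <= n%:R * D ^+ 2 ->
  expR (kappa * s) <= 1 + kappa' * s.
Proof.
move=> /andP[s0 sD]; set y := kappa * s.
have y0 : 0 <= y by rewrite mulr_ge0.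
have : expR y * (1 - y) <= 1.
  by rewrite -[leRHS](expRxMexpNx_1 y) ler_pM2l ?expR_gt0//; exact: expR_ge1Dx.
have : expR y <= expR (kappa * (n%:R * D ^+ 2)) by rewrite ler_expR ler_wpM2l.
have -> : kappa' * s = y * expR (kappa * (n%:R * D ^+ 2)) by rewrite /kappa' /y; ring.
move: (expR _) (expR (kappa * _)) => p q pq py.
by have : y * p <= y * q; [rewrite ler_wpM2l|lra].
Qed.

(** All denominators are bounded below by the common value 2 (1 - 2 b D / beta), positive because 2
    b D < beta; this turns Bernstein's sum into a multiple of the squared norm and produces
    [kappa]. *)
Let mgf_bound (tc : 'I_n -> R) : (forall i, `|tc i| <= D) ->
  (forall i, b * `|2 / beta * tc i| < 1) /\
  \sum_(i < n) v * (2 / beta * tc i) ^+ 2 / (2 * (1 - b * `|2 / beta * tc i|))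
     <= kappa * \sum_(i < n) tc i ^+ 2.
Proof.
move=> tcD.
have bt i : b * `|2 / beta * tc i| <= 2 * b * D / beta.
  rewrite normrM ger0_norm; last by rewrite divr_ge0// ltW.
  rewrite [leLHS](_ : _ = 2 * b / beta * `|tc i|); last by ring.
  rewrite [leRHS](_ : _ = 2 * b / beta * D); last by ring.
  by rewrite ler_wpM2l// divr_ge0 ?mulr_ge0// ltW.
have bD1 : 2 * b * D / beta < 1 by rewrite ltr_pdivrMr// mul1r.
split=> [i|]; first exact: le_lt_trans (bt i) bD1.
rewrite mulr_sumr; apply: ler_sum => i _.
have h1 : 0 < 1 - 2 * b * D / beta by rewrite subr_gt0.
have h2 : 1 - 2 * b * D / beta <= 1 - b * `|2 / beta * tc i| by rewrite lerB.
apply: (@le_trans _ _ (v * (2 / beta * tc i) ^+ 2 / (2 * (1 - 2 * b * D / beta)))).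
  apply: ler_wpM2l; first by apply: mulr_ge0 => //; exact: sqr_ge0.
  by rewrite lef_pV2 ?posrE ?mulr_gt0 ?ler_pM2l// (lt_le_trans h1).
rewrite le_eqVlt; apply/orP; left; apply/eqP; rewrite /kappa; field.
by rewrite !gt_eqF// subr_gt0.
Qed.

Lemma curvature_ge0 : 0 <= curvature n beta v b D.
Proof. by rewrite mulr_ge0 ?expR_ge0. Qed.

(** By [tilt_vadd], the ratio is the average under the prior tilted at xi of the exponential of (2 /
    beta) zeta.(u - c). With theta fixed by Tonelli the exponent depends on the noise only through
    [J (xi w)] and zeta. Returning to the theta-average, the bias-variance identity splits |u - c|^2
    into the variance and the discretization error, at most n e^2. *)
Lemma integral_ratio_le (I : finType) (J : Tn -> I) (c : I -> 'I_n -> R) (e : R) :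
  (forall j, measurable (J @^-1` [set j])) ->
  (forall x i, l i <= c (J x) i <= l i + D /\ `|mean x i - c (J x) i| <= e) ->
  (\int[P]_w (mass (vadd (xi w) (zeta w)) *
     expR (- (2 / beta * \sum_(i < n) tnth (zeta w) i * c (J (xi w)) i)) /
     mass (xi w))%:E <=
   \int[P]_w (1 + curvature n beta v b D * (var (xi w) + n%:R * e ^+ 2))%:E)%E.
Proof.
move=> mJ cP; rewrite -[curvature n beta v b D]/kappa'.
have mass0 x : 0 < mass x by exact: mass_gt0.
pose f1 (p : Tn * Omega) : R := tilt (xi p.2) p.1 / mass (xi p.2) *
  expR (\sum_(i < n) (2 / beta * (u p.1 i - c (J (xi p.2)) i)) * tnth (zeta p.2) i).
pose f2 (p : Tn * Omega) : R := tilt (xi p.2) p.1 / mass (xi p.2) *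
  (1 + kappa' * \sum_(i < n) (u p.1 i - c (J (xi p.2)) i) ^+ 2).
have kappa'0 : 0 <= kappa' by rewrite mulr_ge0 ?expR_ge0.
have w0 p : 0 <= tilt (xi p.2) p.1 / mass (xi p.2) by rewrite divr_ge0 ?tilt_ge0 ?ltW.
have f10 p : 0 <= f1 p by rewrite mulr_ge0 ?expR_ge0.
have f20 p : 0 <= f2 p.
  by rewrite mulr_ge0// addr_ge0// mulr_ge0// sumr_ge0// => i _; exact: sqr_ge0.
have mxi2 : measurable_fun setT (fun p : Tn * Omega => xi p.2).
  exact: (measurableT_comp mxi measurable_snd).
have mw : measurable_fun setT (fun p : Tn * Omega => tilt (xi p.2) p.1 / mass (xi p.2)).
  apply: measurable_funM; first exact: measurable_tilt_pair.
  exact: (measurableT_comp (measurable_mass_inv ts mB beta_gt0 B_gt0) mxi2).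
have mc i : measurable_fun setT (fun p : Tn * Omega => u p.1 i - c (J (xi p.2)) i).
  apply: measurable_funB.
    exact: (measurableT_comp (measurable_coord ts i) measurable_fst).
  exact: (measurableT_comp (measurable_fun_fiber mJ (fun j => c j i)) mxi2).
have mf1 : measurable_fun setT f1.
  apply: measurable_funM => //; apply: measurableT_comp => //.
  apply: measurable_sum => i; apply: measurable_funM; first exact: measurable_funM.
  exact: (measurableT_comp (mzetai i) measurable_snd).
have mf2 : measurable_fun setT f2.
  apply: measurable_funM => //; apply: measurable_funD => //.
  apply: measurable_funM => //; apply: measurable_sum => i.
  exact: measurable_funX.
have mEf1 : measurable_fun setT (EFin \o f1) by exact/measurable_EFinP.
have mEf2 : measurable_fun setT (EFin \o f2) by exact/measurable_EFinP.
have Ef10 p : (0 <= (EFin \o f1) p)%E by rewrite lee_fin.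
have Ef20 p : (0 <= (EFin \o f2) p)%E by rewrite lee_fin.
have -> : (\int[P]_w (mass (vadd (xi w) (zeta w)) *
     expR (- (2 / beta * \sum_(i < n) tnth (zeta w) i * c (J (xi w)) i)) /
     mass (xi w))%:E = \int[P]_w \int[pi0]_theta (f1 (theta, w))%:E)%E.
  apply: eq_integral => w _.
  rewrite -mulrA; set k := expR _ / mass (xi w).
  have E theta : f1 (theta, w) = k * tilt (vadd (xi w) (zeta w)) theta.
    rewrite /f1 /k /= tilt_vadd.
    have -> : \sum_(i < n) 2 / beta * (u theta i - c (J (xi w)) i) * tnth (zeta w) i =
      2 / beta * (\sum_(i < n) tnth (zeta w) i * u theta i) +
      - (2 / beta * \sum_(i < n) tnth (zeta w) i * c (J (xi w)) i).
      rewrite !mulr_sumr -sumrB; apply: eq_bigr => i _; ring.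
    by rewrite expRD; ring.
  under eq_integral do rewrite E EFinM.
  rewrite integralZl//; last exact: integrable_tilt1.
  rewrite -(fineK (integrable_fin_num measurableT _)); last exact: integrable_tilt1.
  by rewrite -EFinM mulrC.
rewrite -(@fubini_tonelli _ _ _ _ _ pi0 P (EFin \o f1))//.
apply: (@le_trans _ _ (\int[pi0]_theta \int[P]_w (f2 (theta, w))%:E)%E).
  apply: ge0_le_integral => //.
  - by move=> theta _; apply: integral_ge0 => w _.
  - exact: (measurable_fun_fubini_tonelli_F (EFin \o f1)).
  - exact: (measurable_fun_fubini_tonelli_F (EFin \o f2)).
  move=> theta _.
  have [Bt|nBt] := pselect (B theta); last first.
    have E g : (\int[P]_w (tilt (xi w) theta / mass (xi w) * g w)%:E = 0)%E.
      apply: integral0_eq => w _.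
      by rewrite /tilt indicE memNset// !mul0r.
    by rewrite /f1 /f2 /= !E.
  have tcD x i : `|u theta i - c (J x) i| <= D.
    have /andP[h1 h2] := box Bt i; have [/andP[h3 h4] _] := cP x i.
    by rewrite ler_norml; apply/andP; split; lra.
  apply: (@le_trans _ _ (\int[P]_w (tilt (xi w) theta / mass (xi w) *
      expR (kappa * \sum_(i < n) (u theta i - c (J (xi w)) i) ^+ 2))%:E)%E).
    apply: (integral_expR_fiber_le
      (t := fun j i => 2 / beta * (u theta i - c j i))
      (psi := fun j => kappa * \sum_(i < n) (u theta i - c j i) ^+ 2)
      (G := fun x => tilt x theta / mass x)) => //.
    - apply: measurable_funM; last exact: (measurable_mass_inv ts mB beta_gt0 B_gt0).
      exact: measurable_tilt_pair.
    - by move=> x; rewrite divr_ge0 ?tilt_ge0 ?ltW.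
    - by move=> x i; have [+ _] := mgf_bound (tcD x); exact.
    - by move=> x; have [_] := mgf_bound (tcD x).
  apply: ge0_le_integral => //.
  - by move=> w _; rewrite lee_fin mulr_ge0 ?expR_ge0// (w0 (theta, w)).
  - apply/measurable_EFinP; apply: measurable_funM.
      exact: (measurableT_comp mw (pair1_measurable theta)).
    apply: measurableT_comp => //; apply: measurable_funM => //.
    apply: measurable_sum => i; apply: measurable_funX.
    exact: (measurableT_comp (mc i) (pair1_measurable theta)).
  - exact: (measurableT_comp mEf2 (pair1_measurable theta)).
  - move=> w _; rewrite lee_fin /f2 ler_wpM2l ?(w0 (theta, w))//.
    apply: expR_kappa_le; rewrite sumr_ge0/= => [|i _]; last exact: sqr_ge0.
    rewrite (@le_trans _ _ (\sum_(i < n) D ^+ 2))//.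
      apply: ler_sum => i _; rewrite -[X in X <= _](real_normK (num_real _)).
      by rewrite ler_sqr ?nnegrE.
    by rewrite sumr_const card_ord mulr_natl.
rewrite (@fubini_tonelli _ _ _ _ _ pi0 P (EFin \o f2))//.
apply: ge0_le_integral => //.
- by move=> w _; apply: integral_ge0.
- exact: (measurable_fun_fubini_tonelli_G (EFin \o f2)).
- apply/measurable_EFinP; apply: measurable_funD => //; apply: measurable_funM => //.
  apply: measurable_funD => //.
  exact: (measurableT_comp (measurable_var ts mB beta_gt0 B_gt0) mxi).
move=> w _.
pose g theta : R := 1 + kappa' * \sum_(i < n) (u theta i - c (J (xi w)) i) ^+ 2.
have ga : admissible ts g.
  apply: admissibleD; first exact: admissible_cst.
  by apply: admissibleZ; exact: admissible_sqdistB.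
have -> : (\int[pi0]_theta (EFin \o f2) (theta, w) = (tavg (xi w) g)%:E)%E.
  have E theta : f2 (theta, w) = (mass (xi w))^-1 * (g theta * tilt (xi w) theta).
    by rewrite /f2 /g /=; ring.
  under eq_integral do rewrite /= E EFinM.
  rewrite integralZl//; last exact: integrable_tilt.
  rewrite -(fineK (integrable_fin_num measurableT _)); last exact: integrable_tilt.
  by rewrite -EFinM mulrC.
rewrite lee_fin /g tavgD//; last 2 first.
- exact: admissible_cst.
- by apply: admissibleZ; exact: admissible_sqdistB.
rewrite tavg_cst// tavgZ//; last exact: admissible_sqdistB.
rewrite tavg_sqdistB// lerD2l ler_wpM2l// lerD2l.
apply: (@le_trans _ _ (\sum_(i < n) e ^+ 2)); last first.
  by rewrite sumr_const card_ord mulr_natl.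
apply: ler_sum => i _; rewrite -[X in X <= _](real_normK (num_real _)).
have [_ h] := cP (xi w) i.
by rewrite ler_sqr// nnegrE// (le_trans _ h).
Qed.

End key_inequality.

Section log_convex_increment.
Context {R : realType} {n : nat} d {Omega : measurableType d}.
Variables (P : probability Omega R) (F : set (set Omega)).
Hypotheses (hF : sigma_algebra setT F) (hFm : F `<=` measurable).
Local Notation Tn := (n.-tuple R).
Variables (xi zeta : Omega -> Tn) (alpha : R).
Hypotheses (hxi : measurable_wrt F xi) (mzeta : measurable_fun setT zeta).
Hypothesis ixi : P.-integrable setT (EFin \o (fun w => sqn (xi w))).
Hypothesis izeta : P.-integrable setT (EFin \o (fun w => sqn (zeta w))).
Hypothesis mean0 : forall i, is_cond_exp P F (fun w => tnth (zeta w) i) (cst 0).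
Hypothesis xi_zeta : eq_in_distribution P (fun w => vadd (xi w) (zeta w))
  (fun w => vscale (1 + alpha) (xi w)).

Variables (M : Tn -> R) (g c : Tn -> 'I_n -> R) (C q : R).
Hypotheses (M0 : forall x, 0 < M x) (mM : measurable_fun setT M).
Hypothesis tangent : forall x h,
  ln (M x) + \sum_(i < n) tnth h i * g x i <= ln (M (vadd x h)).
Hypothesis integrable_lnM : forall X : Omega -> Tn, measurable_fun setT X ->
  P.-integrable setT (EFin \o (fun w => sqn (X w))) ->
  P.-integrable setT (EFin \o (fun w => ln (M (X w)))).
Hypothesis integrable_dot :
  P.-integrable setT (EFin \o (fun w => \sum_(i < n) tnth (xi w) i * g (xi w) i)).
Hypothesis mc : forall i, measurable_fun setT (fun x => c x i).
Hypothesis cC : forall x i, `|c x i| <= C.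
Let ratio w := M (vadd (xi w) (zeta w)) *
  expR (- \sum_(i < n) tnth (zeta w) i * c (xi w) i) / M (xi w).
Hypothesis ratio_le : (\int[P]_w (ratio w)%:E <= q%:E)%E.

Let mxi : measurable_fun setT xi.
Proof. exact: measurable_fun_wrt hxi. Qed.

Let mtnth (X : Omega -> Tn) i : measurable_fun setT X ->
  measurable_fun setT (fun w => tnth (X w) i).
Proof. by move=> mX; exact: (measurableT_comp (measurable_tnth i) mX). Qed.

Let measurable_vadd : measurable_fun setT (fun w => vadd (xi w) (zeta w)).
Proof.
apply/measurable_fun_tnthP => i.
rewrite (_ : _ \o _ = fun w => tnth (xi w) i + tnth (zeta w) i); last first.
  by apply/funext => w /=; rewrite tnth_mktuple.
by apply: measurable_funD; exact: mtnth.
Qed.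

Let measurable_vscale a : measurable_fun setT (fun w => vscale a (xi w)).
Proof.
apply/measurable_fun_tnthP => i.
rewrite (_ : _ \o _ = fun w => a * tnth (xi w) i); last first.
  by apply/funext => w /=; rewrite tnth_mktuple.
by apply: measurable_funM => //; exact: mtnth.
Qed.

Let integrable_sqn_vadd :
  P.-integrable setT (EFin \o (fun w => sqn (vadd (xi w) (zeta w)))).
Proof.
apply: (@le_integrable_real _ _ _ P setT measurableT _
    (fun w => 2 * sqn (xi w) + 2 * sqn (zeta w))).
- by apply: measurable_sum => i; apply: measurable_funX; exact: mtnth.
- move=> w _; rewrite ger0_norm; last by apply: sumr_ge0 => i _; exact: sqr_ge0.
  rewrite /sqn !mulr_sumr -big_split/=; apply: ler_sum => i _; rewrite tnth_mktuple.
  by have := sqr_ge0 (tnth (xi w) i - tnth (zeta w) i); nra.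
- by apply: integrable_addr => //; exact: integrable_scaler.
Qed.

Let integrable_sqn_vscale a :
  P.-integrable setT (EFin \o (fun w => sqn (vscale a (xi w)))).
Proof.
have -> : (fun w => sqn (vscale a (xi w))) = (fun w => a ^+ 2 * sqn (xi w)).
  apply/funext => w; rewrite /sqn mulr_sumr; apply: eq_bigr => i _.
  by rewrite tnth_mktuple exprMn.
exact: integrable_scaler.
Qed.

Let tangent_step :
  \int[P]_w ln (M (xi w)) + alpha * \int[P]_w (\sum_(i < n) tnth (xi w) i * g (xi w) i) <=
  \int[P]_w ln (M (vadd (xi w) (zeta w))).
Proof.
have il := integrable_lnM mxi ixi.
rewrite (eq_in_distribution_integral (f := fun x => ln (M x)) xi_zeta)//; last first.
  exact: measurableT_comp.
rewrite -RintegralZl// -RintegralD//; last exact: integrable_scaler.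
apply: le_Rintegral => //.
- by apply: integrable_addr => //; exact: integrable_scaler.
- exact: integrable_lnM.
- move=> w _; have := tangent (xi w) (vscale alpha (xi w)).
  have -> : vadd (xi w) (vscale alpha (xi w)) = vscale (1 + alpha) (xi w).
    by apply: eq_from_tnth => i; rewrite !tnth_mktuple mulrDl mul1r.
  apply: le_trans; rewrite lerD2l mulr_sumr le_eqVlt; apply/orP; left; apply/eqP.
  by apply: eq_bigr => i _; rewrite tnth_mktuple mulrA.
Qed.

(* Convexity of [ln M] at [xi] in the direction [alpha * xi]; then
   [(1 + alpha) * xi ~ xi + zeta], [ln y <= y - 1], and [zeta.c] has mean 0. *)
Lemma log_convex_increment :
  alpha * \int[P]_w (\sum_(i < n) tnth (xi w) i * g (xi w) i) <= q - 1.
Proof.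
pose a w := \sum_(i < n) c (xi w) i * tnth (zeta w) i.
have iz i : P.-integrable setT (EFin \o (fun w => tnth (zeta w) i)).
  by have [] := mean0 i.
have icz i : P.-integrable setT (fun w => (c (xi w) i * tnth (zeta w) i)%:E).
  apply: (@integrableM_bounded _ _ _ P _ _ C) => //.
  exact: (measurableT_comp (mc i) mxi).
have ia : P.-integrable setT (EFin \o a) by apply: integrable_sumr => // i _; exact: icz.
have a0 : \int[P]_w a w = 0.
  rewrite Rintegral_sum => [|//|i _]; last exact: icz.
  apply: big1 => i _; rewrite /Rintegral.
  rewrite (cond_exp0_pull_out hF hFm (mean0 i) _ (icz i))//.
  apply/(measurable_wrtP hF); apply: (measurableT_comp (mc i)).
  exact/(measurable_wrtP hF).
have r0 w : 0 <= ratio w.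
  by rewrite divr_ge0 ?mulr_ge0 ?expR_ge0// ltW.
have mr : measurable_fun setT ratio.
  apply: measurable_funM.
    apply: measurable_funM; first exact: (measurableT_comp mM measurable_vadd).
    apply: measurableT_comp => //; apply: measurableT_comp => //.
    apply: measurable_sum => i; apply: measurable_funM; first exact: mtnth.
    exact: (measurableT_comp (mc i) mxi).
  by apply: measurable_fun_invr => //; exact: (measurableT_comp mM mxi).
have ir : P.-integrable setT (EFin \o ratio).
  apply/integrableP; split; first exact/measurable_EFinP.
  under eq_integral do rewrite /= ger0_norm//.
  by apply: (le_lt_trans ratio_le); rewrite ltry.
have hr : \int[P]_w ratio w <= q.
  by rewrite -lee_fin /Rintegral fineK ?integrable_fin_num.
have il := integrable_lnM mxi ixi.
have ilz := integrable_lnM measurable_vadd integrable_sqn_vadd.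
have icst : P.-integrable setT (EFin \o (fun _ : Omega => 1 : R)).
  exact: finite_measure_integrable_cst.
have : \int[P]_w (ln (M (vadd (xi w) (zeta w))) - ln (M (xi w)) - a w) <=
       \int[P]_w (ratio w - 1).
  apply: le_Rintegral => //.
  - by apply: integrable_subr => //; exact: integrable_subr.
  - exact: integrable_subr.
  - move=> w _; rewrite /ratio.
    have -> : \sum_(i < n) tnth (zeta w) i * c (xi w) i = a w.
      by apply: eq_bigr => i _; rewrite mulrC.
    exact: ln_subr_le.
rewrite RintegralB//; last exact: integrable_subr.
rewrite RintegralB// RintegralB// a0 Rintegral_cst// [X in fine X]probability_setT mulr1.
have := tangent_step; move: hr.
move: (\int[P]_w ratio w) (\int[P]_w ln (M (xi w)))
  (\int[P]_w ln (M (vadd (xi w) (zeta w)))) (alpha * _) => *; lra.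
Qed.

End log_convex_increment.

Lemma exists_sqr_mul_le (R : realType) (k q : R) : 0 <= k -> 0 < q ->
  exists2 e, 0 < e & k * e ^+ 2 <= q.
Proof.
move=> k0 q0; have k1 : 0 < k + 1 by rewrite ltr_pwDr.
exists (Num.min 1 (q / (k + 1))); first by rewrite lt_min ltr01 divr_gt0.
set e := Num.min _ _; have e0 : 0 < e by rewrite lt_min ltr01 divr_gt0.
have e1 : e <= 1 by rewrite ge_min lexx.
have eq : e * (k + 1) <= q by rewrite -ler_pdivlMr// ge_min lexx orbT.
move: e e0 e1 eq => e *; rewrite expr2; have : k * (e * e) <= k * e.
  by rewrite ler_wpM2l// ler_piMr// ltW.
by lra.
Qed.

Section key_inequality_box.
Context {R : realType} {n : nat} d {Omega : measurableType d}.
Variables (P : probability Omega R) (F : set (set Omega)).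
Hypotheses (hF : sigma_algebra setT F) (hFm : F `<=` measurable).
Local Notation Tn := (n.-tuple R).
Variables (xi zeta : Omega -> Tn) (alpha v b : R).
Hypotheses (hxi : measurable_wrt F xi) (mzeta : measurable_fun setT zeta).
Hypothesis ixi : P.-integrable setT (EFin \o (fun w => sqn (xi w))).
Hypothesis mean0 : forall i, is_cond_exp P F (fun w => tnth (zeta w) i) (cst 0).
Hypothesis xi_zeta : eq_in_distribution P (fun w => vadd (xi w) (zeta w))
  (fun w => vscale (1 + alpha) (xi w)).
Hypotheses (v0 : 0 <= v) (b0 : 0 <= b).
Hypothesis ind : cond_independent P F zeta.
Hypothesis bern : forall i, cond_bernstein P F v b (fun w => tnth (zeta w) i).
Variables (pi0 : probability Tn R) (ts : Tn) (beta : R) (B : set Tn).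
Hypotheses (beta_gt0 : 0 < beta) (mB : measurable B) (B_gt0 : (0 < pi0 B)%E).
Variables (l : 'I_n -> R) (D : R).
Hypothesis D0 : 0 <= D.
Hypothesis bD : 2 * b * D < beta.
Hypothesis box : forall theta, B theta -> forall i,
  l i <= tnth theta i - tnth ts i <= l i + D.

Let integrable_sqn_zeta : P.-integrable setT (EFin \o (fun w => sqn (zeta w))).
Proof.
have mz i : measurable_fun setT (fun w => tnth (zeta w) i).
  exact: (measurableT_comp (measurable_tnth i) mzeta).
apply: integrable_sumr => // i _; apply/integrableP; split.
  by apply/measurable_EFinP; apply: measurable_funX; exact: mz.
under eq_integral do rewrite /= ger0_norm ?sqr_ge0//.
apply: le_lt_trans (ltry (16 * v)).
exact: (cond_bernstein_sqr_le hF hFm v0 b0 (mz i) (bern i)).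
Qed.

Let mxi : measurable_fun setT xi.
Proof. exact: measurable_fun_wrt hxi. Qed.

Lemma key_inequality_box :
  alpha * (2 / beta * \int[P]_w (\sum_(i < n) tnth (xi w) i * mean pi0 ts beta B (xi w) i))
  <= curvature n beta v b D * \int[P]_w var pi0 ts beta B (xi w).
Proof.
set K := curvature n beta v b D; set V := \int[P]_w var _ _ _ _ _.
have K0 : 0 <= K by exact: curvature_ge0.
apply/ler_addgt0Pr => q q0.
(* Here [K] does not depend on the grid, so the mesh [e] can be refined until the discretization
   error K n e^2 is below the arbitrary slack [q]. *)
have [e e0 eq] := exists_sqr_mul_le (mulr_ge0 K0 (ler0n R n)) q0.
have Kq : K * (V + n%:R * e ^+ 2) <= K * V + q by rewrite mulrDr lerD2l mulrA.
apply: (le_trans _ Kq).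
have [I [J [c [mJ cP]]]] := mean_discretization beta_gt0 mB B_gt0 box e0.
have ratio := integral_ratio_le beta_gt0 mB B_gt0 D0 box hF hFm hxi mzeta v0 b0 bD
  ind bern mJ cP.
have iv := integrable_var ts mB beta_gt0 B_gt0 mxi ixi.
have := @log_convex_increment R n _ _ P F hF hFm xi zeta alpha hxi mzeta ixi
  integrable_sqn_zeta mean0 xi_zeta (mass pi0 ts beta B)
  (fun x i => 2 / beta * mean pi0 ts beta B x i) (fun x i => 2 / beta * c (J x) i)
  (2 / beta * (\sum_(i < n) `|l i| + D)) (1 + K * (V + n%:R * e ^+ 2)).
have b2 : 0 <= 2 / beta by rewrite divr_ge0// ltW.
have scaleS (a z : 'I_n -> R) :
    \sum_(i < n) a i * (2 / beta * z i) = 2 / beta * \sum_(i < n) a i * z i.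
  by rewrite mulr_sumr; apply: eq_bigr => i _; rewrite mulrCA.
rewrite addrAC subrr add0r.
under eq_Rintegral do rewrite scaleS.
rewrite RintegralZl; last 2 first.
- exact: measurableT.
- exact: (integrable_dot_mean ts mB beta_gt0 B_gt0 mxi ixi).
apply.
- by move=> x; exact: mass_gt0.
- exact: measurable_mass.
- by move=> x h; rewrite scaleS; exact: lmass_tangent.
- by move=> X mX iX; exact: integrable_lmass.
- rewrite (_ : (fun w => _) = (fun w => 2 / beta *
      \sum_(i < n) tnth (xi w) i * mean pi0 ts beta B (xi w) i)).
    apply: integrable_scaler => //.
    exact: (integrable_dot_mean ts mB beta_gt0 B_gt0 mxi ixi).
  by apply/funext => w; exact: scaleS.
- move=> i; apply: measurable_funM => //.
  exact: (measurable_fun_fiber mJ (fun j => c j i)).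
- move=> x i; rewrite normrM ger0_norm// ler_wpM2l//.
  have [/andP[h1 h2] _] := cP x i.
  apply: (@le_trans _ _ (`|l i| + D)).
    have := ler_norm (l i); have := ler_norm (- l i); rewrite normrN.
    by move: (`|l i|) => p h3 h4; rewrite ler_norml; apply/andP; split; lra.
  by rewrite lerD2r (bigD1 i)//= lerDl; apply: sumr_ge0 => j _.
- under eq_integral do rewrite scaleS.
  apply: (le_trans ratio); rewrite -/K.
  have icst r : P.-integrable setT (EFin \o (fun _ : Omega => r : R)).
    exact: finite_measure_integrable_cst.
  have ive : P.-integrable setT
      (EFin \o (fun w => var pi0 ts beta B (xi w) + n%:R * e ^+ 2)).
    exact: integrable_addr.
  have iKve : P.-integrable setT
      (EFin \o (fun w => K * (var pi0 ts beta B (xi w) + n%:R * e ^+ 2))).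
    exact: integrable_scaler.
  have iall : P.-integrable setT
      (EFin \o (fun w => 1 + K * (var pi0 ts beta B (xi w) + n%:R * e ^+ 2))).
    exact: integrable_addr.
  rewrite -(fineK (integrable_fin_num measurableT iall)) lee_fin.
  rewrite -[leLHS]/(\int[P]_w (1 + K * (var pi0 ts beta B (xi w) + n%:R * e ^+ 2))).
  rewrite RintegralD// RintegralZl// RintegralD// !Rintegral_cst//.
  by rewrite ![X in fine X]probability_setT !mulr1.
Qed.

End key_inequality_box.

(** * The limit of small alpha *)

Lemma C1_01_cvg0 (R : realType) (v v' : R -> R) : C1_01 v v' -> v 0 = 0 ->
  v a / a @[a --> 0^'+] --> v' 0.
Proof.
move=> [dv _] v0.
have := dv 0; rewrite in_itv/= lexx ler01 => /(_ isT) h.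
move=> U /h; rewrite /= !nbhs_simpl /within /= => -[e /= e0 he].
near=> y.
have y0 : 0 < y by near: y; exact: nbhs_right_gt.
have := he y; rewrite v0 !subr0; apply.
- by rewrite /= sub0r normrN gtr0_norm.
- by rewrite gt_eqF.
- rewrite /= in_itv/= ltW//=; near: y; exact: nbhs_right_le.
Unshelve. all: by end_near. Qed.

Lemma C1_01_deriv_ge0 (R : realType) (v v' : R -> R) : C1_01 v v' -> v 0 = 0 ->
  (forall a : R, a \in `[0, 1] -> 0 <= v a) -> 0 <= v' 0.
Proof.
move=> hv vz v0; apply: (cvgr_to_ge (C1_01_cvg0 hv vz)); near=> a.
have a0 : 0 < a by near: a; exact: nbhs_right_gt.
rewrite divr_ge0 ?(ltW a0)//; apply: v0.
by rewrite in_itv/= ltW//=; near: a; exact: nbhs_right_le.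
Unshelve. all: by end_near. Qed.

Lemma curvature_limit (R : realType) (n : nat) (beta D : R) (v v' b : R -> R) :
  0 < beta -> 0 <= D -> 2 * b 0 * D < beta ->
  (forall a : R, a \in `[0, 1] -> 0 <= b a) ->
  (forall e : R, 0 < e -> \forall a \near (0 : R)^'+, b a < b 0 + e) ->
  (forall a : R, a \in `[0, 1] -> 0 <= v a) ->
  C1_01 v v' -> v 0 = 0 ->
  forall e, 0 < e -> exists a, [/\ a \in `]0, 1], 2 * b a * D < beta &
    curvature n beta (v a) (b a) D <=
      a * (2 * v' 0 / (beta * (beta - 2 * b 0 * D)) + e)].
Proof.
move=> beta0 D0 bD b0 hb v0 hv vz e e0.
have vcvg := C1_01_cvg0 hv vz.
have v'0 := C1_01_deriv_ge0 hv vz v0.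
pose k (t : R) := 2 * (v' 0 + t) / (beta * (beta - 2 * (b 0 + t) * D)).
pose H (t : R) := k t * expR (k t * t * (n%:R * D ^+ 2)).
have tc : t @[t --> (0 : R)^'+] --> (0 : R) by exact: cvg_at_right_filter.
have kc : k t @[t --> (0 : R)^'+] --> k 0.
  apply: cvgM.
    by apply: cvgM; [exact: cvg_cst|apply: cvgD => //; exact: cvg_cst].
  apply: cvgV.
    by rewrite mulf_neq0 ?gt_eqF// subr_gt0 addr0.
  apply: cvgM; first exact: cvg_cst.
  apply: cvgB; first exact: cvg_cst.
  apply: cvgM; last exact: cvg_cst.
  by apply: cvgM; [exact: cvg_cst|apply: cvgD => //; exact: cvg_cst].
have Hc : H t @[t --> (0 : R)^'+] --> H 0.
  apply: cvgM => //; apply: continuous_cvg; first exact: continuous_expR.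
  by apply: cvgM; [exact: cvgM|exact: cvg_cst].
have H0 : H 0 = 2 * v' 0 / (beta * (beta - 2 * b 0 * D)).
  by rewrite /H mulr0 mul0r expR0 mulr1 /k !addr0.
have : \forall t \near (0 : R)^'+, [/\ 0 < t, H t < H 0 + e & 2 * (b 0 + t) * D < beta].
  have h1 : \forall t \near (0 : R)^'+, H t < H 0 + e.
    by apply: (cvgr_lt _ Hc); rewrite ltrDl.
  have h2 : \forall t \near (0 : R)^'+, 2 * (b 0 + t) * D < beta.
    have c2 : 2 * (b 0 + t) * D @[t --> (0 : R)^'+] --> 2 * (b 0 + 0) * D.
      apply: cvgM; last exact: cvg_cst.
      by apply: cvgM; [exact: cvg_cst|apply: cvgD => //; exact: cvg_cst].
    by apply: (cvgr_lt _ c2); rewrite addr0.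
  near=> t; split; [near: t; exact: nbhs_right_gt|by near: t|by near: t].
move=> /filter_ex [t [t0 Ht bt]].
have h3 : \forall a \near (0 : R)^'+, v a / a < v' 0 + t.
  by apply: (cvgr_lt _ vcvg); rewrite ltrDl.
have : \forall a \near (0 : R)^'+,
    [/\ 0 < a <= 1, a <= t, v a / a < v' 0 + t & b a < b 0 + t].
  near=> a; split.
  - apply/andP; split; near: a; [exact: nbhs_right_gt|exact: nbhs_right_le].
  - by near: a; exact: nbhs_right_le.
  - by near: a.
  - by near: a; exact: hb.
move=> /filter_ex [a [/andP[a0 a1] at_ va ba]].
have aI : a \in `[0, 1] by rewrite in_itv/= ltW.
have bD1 : 2 * b a * D <= 2 * (b 0 + t) * D.
  by rewrite ler_wpM2r// ler_wpM2l// ltW.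
exists a; split; first by rewrite in_itv/= a0.
  exact: le_lt_trans bt.
rewrite -H0; apply: (@le_trans _ _ (a * H t)); last by rewrite ler_pM2l// ltW.
have va' : v a <= (v' 0 + t) * a by rewrite -ler_pdivrMr// ltW.
have kle : 2 * v a / (beta * (beta - 2 * b a * D)) <= a * k t.
  rewrite /k mulrA [a * _]mulrCA (mulrC a).
  rewrite ler_pM ?mulr_ge0 ?v0 ?invr_ge0 ?mulr_ge0 ?(ltW beta0) ?subr_ge0//.
  - by rewrite (le_trans bD1)// ltW.
  - by rewrite ler_pM2l.
  - by rewrite lef_pV2 ?posrE ?mulr_gt0 ?subr_gt0 ?(le_lt_trans bD1)// ler_pM2l// lerB.
have k0 : 0 <= 2 * v a / (beta * (beta - 2 * b a * D)).
  by rewrite divr_ge0 ?mulr_ge0 ?v0 ?(ltW beta0) ?subr_ge0// (le_trans bD1)// ltW.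
have nD : 0 <= n%:R * D ^+ 2 by rewrite mulr_ge0 ?sqr_ge0.
have kt0 : 0 <= k t.
  by have := le_trans k0 kle; rewrite pmulr_rge0.
rewrite /curvature /H [leRHS]mulrA; apply: ler_pM => //.
rewrite ler_expR ler_wpM2r//; apply: (le_trans kle).
by rewrite mulrC ler_wpM2l.
Unshelve. all: by end_near. Qed.

(** * Exhaustion by boxes *)

Section exhaustion.
Context {R : realType} {n : nat}.
Local Notation Tn := (n.-tuple R).
Variables (pi0 : probability Tn R) (ts : Tn) (beta : R) (B : (set Tn)^nat).
Hypotheses (beta_gt0 : 0 < beta) (mB : forall k, measurable (B k)).
Hypothesis B_homo : forall k l, (k <= l)%N -> B k `<=` B l.
Hypothesis B_gt0 : (0 < pi0 (B 0%N))%E.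
Hypothesis B_full : {ae pi0, forall theta, exists k, B k theta}.

Let pi0_gt0 k : (0 < pi0 (B k))%E.
Proof.
by apply: (lt_le_trans B_gt0); apply: le_measure; rewrite ?inE//; exact: B_homo.
Qed.

Let pi0T : (0 < pi0 setT)%E.
Proof. by rewrite [X in (_ < X)%E]probability_setT. Qed.

Let tilt_le_setT k x theta : tilt ts beta (B k) x theta <= tilt ts beta setT x theta.
Proof. by rewrite ler_wpM2r ?expR_ge0// !indicE in_setT lern1 leq_b1. Qed.

Lemma admissible_norm (f : Tn -> R) :
  admissible ts f -> admissible ts (fun theta => `|f theta|).
Proof.
move=> [mf [c fc]]; split; first exact: measurableT_comp.
by exists c => theta; rewrite normr_id.
Qed.

Lemma cvg_RintegralM_tilt x (f : Tn -> R) : admissible ts f ->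
  \int[pi0]_theta (f theta * tilt ts beta (B k) x theta) @[k --> \oo] -->
  \int[pi0]_theta (f theta * tilt ts beta setT x theta).
Proof.
move=> fa; have [mf _] := fa; pose U := \bigcup_k B k.
have mU : measurable U by exact: bigcup_measurable.
(* The sets [B k] exhaust the space only up to a null set, so the pointwise limit is the tilt
   restricted to their union [U]. *)
have -> : \int[pi0]_theta (f theta * tilt ts beta setT x theta) =
    \int[pi0]_theta (f theta * tilt ts beta U x theta).
  congr fine; apply: ae_eq_integral => //.
  - by apply/measurable_EFinP; apply: measurable_funM => //; exact: measurable_tilt.
  - by apply/measurable_EFinP; apply: measurable_funM => //; exact: measurable_tilt.
  - apply: filterS B_full => theta [k Bk] _; congr (_ * _)%:E.
    by rewrite /tilt !indicE in_setT mem_set//; exists k.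
apply: (dominated_cvg_Rintegral
    (g := fun theta => `|f theta| * tilt ts beta setT x theta)).
- by move=> k; apply: measurable_funM => //; exact: measurable_tilt.
- by apply: measurable_funM => //; exact: measurable_tilt.
- by apply: integrable_tilt => //; exact: admissible_norm.
- move=> k theta; rewrite normrM [`|tilt _ _ _ _ _|]ger0_norm ?tilt_ge0//.
  by rewrite ler_wpM2l.
- move=> theta; apply: cvgM; first exact: cvg_cst.
  rewrite /tilt; apply: cvgM; last exact: cvg_cst.
  have [[K _ BK]|nU] := pselect (U theta).
    apply: cvg_near_cst; near=> k.
    rewrite !indicE !mem_set//; first by exists K.
    by apply: B_homo BK; near: k; exact: nbhs_infty_ge.
  apply: cvg_near_cst; near=> k.
  by rewrite !indicE !memNset// => Bk; apply: nU; exists k.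
Unshelve. all: by end_near. Qed.

Lemma cvg_mass x :
  mass pi0 ts beta (B k) x @[k --> \oo] --> mass pi0 ts beta setT x.
Proof.
have := @cvg_RintegralM_tilt x _ (admissible_cst ts 1).
under eq_fun do under eq_Rintegral do rewrite mul1r.
by under [X in _ --> X -> _]eq_Rintegral do rewrite mul1r.
Qed.

Lemma cvg_tavg x (f : Tn -> R) : admissible ts f ->
  tavg pi0 ts beta (B k) x f @[k --> \oo] --> tavg pi0 ts beta setT x f.
Proof.
move=> fa; apply: cvgM; first exact: cvg_RintegralM_tilt.
by apply: cvgV; [rewrite gt_eqF// mass_gt0|exact: cvg_mass].
Qed.

Lemma cvg_second x :
  second pi0 ts beta (B k) x @[k --> \oo] --> second pi0 ts beta setT x.
Proof. by apply: cvg_tavg; exact: admissible_sqdist. Qed.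

Lemma cvg_var x :
  var pi0 ts beta (B k) x @[k --> \oo] --> var pi0 ts beta setT x.
Proof.
apply: cvgB; first exact: cvg_second.
apply: cvg_big => [|i _]; first exact: add_continuous.
apply: (@cvg_comp _ _ _ _ (fun y : R => y ^+ 2)); last exact: exprn_continuous.
by apply: cvg_tavg; exact: admissible_coord.
Qed.

Lemma cvg_lmass x :
  lmass pi0 ts beta (B k) x @[k --> \oo] --> lmass pi0 ts beta setT x.
Proof.
apply: continuous_cvg; last exact: cvg_mass.
by apply: continuous_ln; exact: mass_gt0.
Qed.

(** Along increasing sets the log-mass at 0 is smallest for [B 0]; substituted into the growth
    bounds it yields a dominating function independent of k. *)
Let lmass0_ge k : lmass pi0 ts beta (B 0%N) [tuple 0 | i < n] <=
  lmass pi0 ts beta (B k) [tuple 0 | i < n].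
Proof.
rewrite ler_ln ?posrE ?mass_gt0//; apply: le_Rintegral => //.
- exact: integrable_tilt1.
- exact: integrable_tilt1.
- move=> theta _; rewrite ler_wpM2r ?expR_ge0// !indicE ler_nat.
  have [B0|] := boolP (theta \in B 0%N) => //.
  by rewrite mem_set//; apply: (@B_homo 0%N) => //; exact: set_mem.
Qed.

Let norm_le_of_bounds (L L0 w0 q : R) :
  L <= q -> 2 * L0 - q <= L -> w0 <= L0 -> `|L| <= 2 * `|w0| + q.
Proof.
have := ler_norm (- w0); rewrite normrN; have := normr_ge0 w0.
by move: (`|w0|) => p *; rewrite ler_norml; apply/andP; split; lra.
Qed.

Section limit.
Context d {W : measurableType d} (P : probability W R) (X : W -> Tn).
Hypotheses (mX : measurable_fun setT X).
Hypothesis iX : P.-integrable setT (EFin \o (fun w => sqn (X w))).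
Let W0 := lmass pi0 ts beta (B 0%N) [tuple 0 | i < n].

Let integrable_affine a c :
  P.-integrable setT (EFin \o (fun w => a + c * sqn (X w))).
Proof.
apply: integrable_addr => //; first exact: finite_measure_integrable_cst.
exact: integrable_scaler.
Qed.

Lemma cvg_int_second : \int[P]_w second pi0 ts beta (B k) (X w) @[k --> \oo] -->
  \int[P]_w second pi0 ts beta setT (X w).
Proof.
apply: (dominated_cvg_Rintegral
  (g := fun w => - (4 * beta * W0) + 6 * sqn (X w))) => //.
- by move=> k; apply: (measurableT_comp _ mX); exact: measurable_second.
- by apply: (measurableT_comp _ mX); exact: measurable_second.
- move=> k w; rewrite ger0_norm; last first.
    apply: le_trans (sqmean_le ts beta_gt0 (mB k) (pi0_gt0 k) (X w)).
    by apply: sumr_ge0 => i _; exact: sqr_ge0.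
  apply: (le_trans (second_le_growth ts beta_gt0 (mB k) (pi0_gt0 k) (X w))).
  by rewrite addrC lerD2r lerN2 ler_wpM2l// mulr_ge0// ltW.
- by move=> w; exact: cvg_second.
Qed.

Lemma cvg_int_var : \int[P]_w var pi0 ts beta (B k) (X w) @[k --> \oo] -->
  \int[P]_w var pi0 ts beta setT (X w).
Proof.
apply: (dominated_cvg_Rintegral
  (g := fun w => - (4 * beta * W0) + 6 * sqn (X w))) => //.
- by move=> k; apply: (measurableT_comp _ mX); exact: measurable_var.
- by apply: (measurableT_comp _ mX); exact: measurable_var.
- move=> k w; rewrite ger0_norm ?var_ge0//.
  apply: (@le_trans _ _ (second pi0 ts beta (B k) (X w))).
    by rewrite lerBlDr lerDl; apply: sumr_ge0 => i _; exact: sqr_ge0.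
  apply: (le_trans (second_le_growth ts beta_gt0 (mB k) (pi0_gt0 k) (X w))).
  by rewrite addrC lerD2r lerN2 ler_wpM2l// mulr_ge0// ltW.
- by move=> w; exact: cvg_var.
Qed.

Lemma cvg_int_lmass : \int[P]_w lmass pi0 ts beta (B k) (X w) @[k --> \oo] -->
  \int[P]_w lmass pi0 ts beta setT (X w).
Proof.
apply: (dominated_cvg_Rintegral
  (g := fun w => 2 * `|W0| + beta^-1 * sqn (X w))) => //.
- by move=> k; apply: (measurableT_comp _ mX); exact: measurable_lmass.
- by apply: (measurableT_comp _ mX); exact: measurable_lmass.
- move=> k w; rewrite (mulrC beta^-1).
  exact: (norm_le_of_bounds (lmass_le ts beta_gt0 (mB k) (pi0_gt0 k) (X w))
    (lmass_ge ts beta_gt0 (mB k) (pi0_gt0 k) (X w)) (lmass0_ge k)).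
- by move=> w; exact: cvg_lmass.
Qed.

Lemma second_le_exhaustion (c : R) :
  (forall k, \int[P]_w second pi0 ts beta (B k) (X w) <=
     c * \int[P]_w var pi0 ts beta (B k) (X w)
     - beta * \int[P]_w lmass pi0 ts beta (B k) (X w)) ->
  \int[P]_w second pi0 ts beta setT (X w) <=
     c * \int[P]_w var pi0 ts beta setT (X w)
     - beta * \int[P]_w lmass pi0 ts beta setT (X w).
Proof.
move=> H; apply: (ler_cvg_to cvg_int_second).
- apply: cvgB; apply: cvgM; [exact: cvg_cst|exact: cvg_int_var|exact: cvg_cst|].
  exact: cvg_int_lmass.
- exact: nearW.
Qed.

End limit.
End exhaustion.

(** * The Donsker-Varadhan inequality *)

Section donsker_varadhan.
Context {R : realType} d {T : measurableType d}.
Variables mu nu : probability T R.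
Import Radon_Nikodym_SigmaFinite.

Let r x : R := fine (f mu nu x).

Section density.
Hypothesis mu_nu : mu `<< nu.

Let rE x : (r x)%:E = f mu nu x.
Proof. by rewrite fineK//; exact: f_fin_num. Qed.

Let r_ge0 x : 0 <= r x.
Proof. by rewrite fine_ge0//; exact: f_ge0. Qed.

Let integrable_r : nu.-integrable setT (EFin \o r).
Proof. by rewrite (_ : _ \o _ = f mu nu); [exact: f_integrable|exact/funext/rE]. Qed.

Let measurable_r : measurable_fun setT r.
Proof. by apply/measurable_EFinP; exact: measurable_int integrable_r. Qed.

Let integral_r : \int[nu]_x r x = 1.
Proof.
rewrite /Rintegral; under eq_integral do rewrite rE.
by rewrite -(f_integral mu_nu measurableT) [X in fine X]probability_setT.
Qed.

Let measurable_xlnx : measurable_fun setT (fun x => r x * ln (r x)).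
Proof.
by apply: measurable_funM => //; apply: measurableT_comp.
Qed.

Let KLE : KL mu nu = (\int[nu]_x (r x * ln (r x))%:E)%E.
Proof.
rewrite /KL asboolT//; apply: eq_integral => x _; rewrite -rE EFinM.
have := r_ge0 x; rewrite le_eqVlt => /predU1P[<-|r0]; first by rewrite !mul0e.
by rewrite lne_EFin.
Qed.

(** The negative part of r ln r is at most 1, because - ln r <= 1 / r - 1; only the positive part
    can diverge, and then the divergence is +oo. *)
Let KL_integrable : nu.-integrable setT (EFin \o (fun x => r x * ln (r x))) \/
  KL mu nu = +oo%E.
Proof.
set h := EFin \o _; have mh : measurable_fun setT h by exact/measurable_EFinP.
have neg_le : (\int[nu]_x h^\- x <= 1)%E.
  rewrite -[leRHS](probability_setT nu) -[leRHS]mul1e -integral_cst//.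
  apply: ge0_le_integral => //; first exact: measurable_funeneg.
  move=> x _; rewrite funenegE /h/= -EFin_max lee_fin ge_max ler01 andbT.
  have := r_ge0 x; rewrite le_eqVlt => /predU1P[<-|r0].
    by rewrite mul0r oppr0 ler01.
  have := @le_ln1Dx R ((r x)^-1 - 1).
  have ri : r x * (r x)^-1 = 1 by rewrite mulfV// gt_eqF.
  rewrite addrCA subrr addr0 lnV ?posrE// => H.
  have {}H : - ln (r x) <= (r x)^-1 - 1.
    by apply: H; rewrite ltrBrDl subrr invr_gt0.
  by nra.
have [pos|pos] := eqVneq (\int[nu]_x h^\+ x)%E +oo%E.
  right; rewrite KLE integralE pos.
  by rewrite addye// eqe_oppLR/= lt_eqF// (le_lt_trans neg_le)// ltry.
left; apply/integrableP; split => //.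
rewrite (_ : (fun x => `|h x|)%E = (h^\+ \+ h^\-)%E); last exact: (fune_abse h).
rewrite ge0_integralD//; [|exact: measurable_funepos|exact: measurable_funeneg].
by apply: lte_add_pinfty; [rewrite ltey|exact: le_lt_trans neg_le (ltry 1)].
Qed.

Lemma donsker_varadhan_ac (k : T -> R) : measurable_fun setT k ->
  (forall x, 0 <= k x) -> mu.-integrable setT (EFin \o k) ->
  ((- \int[mu]_x k x)%:E <= (ln (\int[nu]_x expR (- k x)))%:E + KL mu nu)%E.
Proof.
move=> mk k0 ik; have [ih|->] := KL_integrable; last by rewrite addey// leey.
have iE : nu.-integrable setT (EFin \o (fun x => expR (- k x))).
  apply: (@bounded_integrable _ _ _ _ _ 1) => [|x].
    by apply: measurableT_comp => //; exact: measurableT_comp.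
  by rewrite ger0_norm ?expR_ge0// -[leRHS]expR0 ler_expR oppr_le0.
have kr : (\int[nu]_x (k x * r x)%:E = \int[mu]_x (k x)%:E)%E.
  rewrite -(change_of_variables mu_nu)//; last exact/measurable_EFinP.
  by apply: eq_integral => x _; rewrite EFinM rE.
have ikr : nu.-integrable setT (EFin \o (fun x => k x * r x)).
  apply/integrableP; split; first by apply/measurable_EFinP; exact: measurable_funM.
  under eq_integral do rewrite /= ger0_norm ?mulr_ge0//.
  by rewrite kr ltey_eq (integrable_fin_num measurableT ik).
set M := \int[nu]_x _.
have M0 : 0 < M.
  rewrite lt_def Rintegral_ge0 ?andbT; last by move=> x _; exact: expR_ge0.
  apply/eqP => M0; have : (\int[nu]_x `|(expR (- k x))%:E| = 0)%E.
    under eq_integral do rewrite gee0_abs ?lee_fin ?expR_ge0//.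
    by rewrite -(fineK (integrable_fin_num measurableT iE)) [X in X%:E]M0.
  move/ae_eq_integral_abs => /(_ measurableT (measurable_int _ iE)) [N [mN N0 sub]].
  have : (nu setT <= nu N)%E.
    apply: le_measure; rewrite ?inE// => x _; apply: sub => /= /(_ I) [] /eqP.
    by rewrite gt_eqF// expR_gt0.
  by rewrite N0 probability_setT lee_fin ler10.
have -> : KL mu nu = (\int[nu]_x (r x * ln (r x)))%:E.
  by rewrite KLE fineK// (integrable_fin_num measurableT ih).
rewrite -EFinD lee_fin.
(* Pointwise this is r (1 + y) <= r e^y with y = - k - ln M - ln r, that is, the comparison of the
   density r with the Gibbs density e^(-k) / M. Where r = 0 the left integrand is nonpositive. *)
have : \int[nu]_x ((1 - ln M) * r x - (k x * r x + M^-1 * expR (- k x))) <=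
    \int[nu]_x (r x * ln (r x)).
  apply: le_Rintegral => //.
    apply: integrable_subr => //; first exact: integrable_scaler.
    by apply: integrable_addr => //; exact: integrable_scaler.
  move=> x _; have := r_ge0 x; rewrite le_eqVlt => /predU1P[<-|r0].
    by rewrite mul0r !mulr0 sub0r add0r oppr_le0 mulr_ge0 ?expR_ge0// invr_ge0 ltW.
  have := expR_ge1Dx (- k x - ln M - ln (r x)).
  rewrite !expRD !expRN !lnK ?posrE//.
  move: (expR (k x))^-1 => a /(ler_wpM2l (ltW r0)).
  have -> : r x * (a / M / r x) = M^-1 * a by field; rewrite !gt_eqF.
  by move: (M^-1 * a) (ln M) (ln (r x)) (r x) (k x) => *; nra.
rewrite RintegralB//; [|exact: integrable_scaler|]; last first.
  by apply: integrable_addr => //; exact: integrable_scaler.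
rewrite RintegralD//; last exact: integrable_scaler.
rewrite !RintegralZl// integral_r -/M mulVf ?gt_eqF//.
by rewrite {1}/Rintegral kr -/(Rintegral _ _ _); lra.
Qed.

End density.

Lemma donsker_varadhan (k : T -> R) : measurable_fun setT k ->
  (forall x, 0 <= k x) -> mu.-integrable setT (EFin \o k) ->
  ((- \int[mu]_x k x)%:E <= (ln (\int[nu]_x expR (- k x)))%:E + KL mu nu)%E.
Proof.
have [mu_nu|mu_nu] := pselect (mu `<< nu); first exact: donsker_varadhan_ac.
by move=> *; rewrite /KL asboolF// addey// leey.
Qed.

Lemma KL_ge0 : (0 <= KL mu nu)%E.
Proof.
have := @donsker_varadhan (cst 0) (measurable_cst _) (fun=> lexx _).
under [X in ln X]eq_Rintegral do rewrite /= oppr0 expR0.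
rewrite !Rintegral_cst// mul0r mul1r oppr0.
rewrite [X in fine X]probability_setT ln1 add0e; apply.
exact: finite_measure_integrable_cst.
Qed.

End donsker_varadhan.

(** * Bounding the expected log-mass by the oracle term *)

Section oracle_lower_bound.
Context {R : realType} {n : nat}.
Local Notation Tn := (n.-tuple R).
Variables (pi0 pi : probability Tn R) (ts : Tn) (beta : R).
Hypothesis beta_gt0 : 0 < beta.
Local Notation u theta i := (tnth theta i - tnth ts i).

Lemma enormE (x : Tn) : enorm x ^+ 2 = sqn x.
Proof. by rewrite sqr_sqrtr// sumr_ge0// => i _; exact: sqr_ge0. Qed.

Lemma enorm_vsub theta : enorm (vsub theta ts) ^+ 2 = sqdist ts theta.
Proof. by rewrite enormE; apply: eq_bigr => i _; rewrite tnth_mktuple. Qed.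

Let pi0T : (0 < pi0 setT)%E.
Proof. by rewrite [X in (_ < X)%E]probability_setT. Qed.

Section finite_risk.
Hypothesis isqdist : pi.-integrable setT (EFin \o sqdist ts).

Lemma admissible_integrable (f : Tn -> R) :
  admissible ts f -> pi.-integrable setT (EFin \o f).
Proof.
move=> [mf [c fc]]; apply: (@le_integrable_real _ _ _ pi setT measurableT f
  (fun theta => c * (1 + sqdist ts theta))) => //.
apply: integrable_scaler => //; apply: integrable_addr => //.
exact: finite_measure_integrable_cst.
Qed.

Let sqdistBE x theta : \sum_(i < n) (u theta i - tnth x i) ^+ 2 =
  sqdist ts theta + (\sum_(i < n) (- 2 * tnth x i) * u theta i + sqn x).
Proof. by rewrite /sqdist -!big_split/=; apply: eq_bigr => i _; ring. Qed.

Let integral_sqdistB x :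
  \int[pi]_theta (\sum_(i < n) (u theta i - tnth x i) ^+ 2) =
  \int[pi]_theta sqdist ts theta
  - 2 * (\sum_(i < n) tnth x i * \int[pi]_theta u theta i) + sqn x.
Proof.
under eq_Rintegral do rewrite sqdistBE.
have ic : pi.-integrable setT (EFin \o cst (sqn x)).
  exact: finite_measure_integrable_cst.
have il : pi.-integrable setT
    (EFin \o (fun theta => \sum_(i < n) (- 2 * tnth x i) * u theta i)).
  by apply: admissible_integrable; exact: admissible_lin.
rewrite RintegralD//; last exact: integrable_addr.
rewrite RintegralD// Rintegral_cst// [X in fine X]probability_setT mulr1 addrA.
congr (_ + _ + _).
rewrite Rintegral_sum// => [|i _]; last first.
  by apply: integrable_scaler => //; apply: admissible_integrable; exact: admissible_coord.
rewrite mulr_sumr -sumrN; apply: eq_bigr => i _.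
rewrite RintegralZl//; last by apply: admissible_integrable; exact: admissible_coord.
by rewrite mulNr mulrA mulNr.
Qed.

Let integral_expRN x :
  \int[pi0]_theta expR (- (beta^-1 * \sum_(i < n) (u theta i - tnth x i) ^+ 2)) =
  expR (- (sqn x / beta)) * mass pi0 ts beta setT x.
Proof.
rewrite /mass -RintegralZl//; last exact: integrable_tilt1.
apply: eq_Rintegral => theta _; rewrite /tilt indicT mul1r -expRD sqdistBE.
congr expR; under eq_bigr do rewrite -mulrA.
rewrite -mulr_sumr; set s := \sum_(_ < _) _.
by field; rewrite gt_eqF.
Qed.

(** Donsker-Varadhan is applied to k = |u - x|^2 / beta rather than to the tilting exponent, since k
    must be nonnegative; the extra |x|^2 appears on both sides and cancels. *)
Lemma lmassN_le x : ((- (beta * lmass pi0 ts beta setT x))%:E <=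
  (\int[pi]_theta sqdist ts theta
  - 2 * (\sum_(i < n) tnth x i * \int[pi]_theta u theta i))%:E
  + beta%:E * KL pi pi0)%E.
Proof.
pose k theta := beta^-1 * \sum_(i < n) (u theta i - tnth x i) ^+ 2.
have ik : pi.-integrable setT
    (EFin \o (fun theta => \sum_(i < n) (u theta i - tnth x i) ^+ 2)).
  by apply: admissible_integrable; exact: admissible_sqdistB.
have mk : measurable_fun setT k.
  by apply: measurable_funM => //; apply/measurable_EFinP; exact: measurable_int ik.
have k0 theta : 0 <= k theta.
  by rewrite mulr_ge0 ?invr_ge0 ?(ltW beta_gt0)// sumr_ge0// => i _; exact: sqr_ge0.
have := donsker_varadhan pi0 mk k0 (integrable_scaler measurableT beta^-1 ik).
rewrite integral_expRN RintegralZl// integral_sqdistB.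
have := mass_gt0 ts beta_gt0 x measurableT pi0T.
rewrite /lmass; move: (mass _ _ _ _ _) => m m0.
rewrite lnM ?posrE ?expR_gt0// expRK.
have := KL_ge0 pi pi0; case: (KL pi pi0) => [K| |]//.
- move=> _; rewrite -EFinM -!EFinD !lee_fin.
  move: (_ - _) (sqn x) => A Q H; have {H} := ler_wpM2l (ltW beta_gt0) H.
  have -> : beta * - (beta^-1 * (A + Q)) = - A - Q by field; rewrite gt_eqF.
  have -> : beta * (- (Q / beta) + ln m + K) =
      - Q + beta * ln m + beta * K by field; rewrite gt_eqF.
  by move: (beta * _) (beta * _) => *; lra.
- by move=> _ _; rewrite gt0_muley ?lte_fin// addey// leey.
Qed.

End finite_risk.

Section expectation.
Context d {W : measurableType d} (P : probability W R) (X : W -> Tn).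
Hypotheses (mX : measurable_fun setT X).
Hypothesis iX : P.-integrable setT (EFin \o (fun w => sqn (X w))).
Hypothesis iXi : forall i, P.-integrable setT (EFin \o (fun w => tnth (X w) i)).
Hypothesis X0 : forall i, \int[P]_w tnth (X w) i = 0.

(** The bound in [lmassN_le] is affine in x, and its linear part integrates to 0 because X is
    centred. An infinite risk or an infinite divergence makes the right-hand side +oo. *)
Lemma int_lmassN_le :
  ((- (beta * \int[P]_w lmass pi0 ts beta setT (X w)))%:E <=
   \int[pi]_theta (enorm (vsub theta ts) ^+ 2)%:E + beta%:E * KL pi pi0)%E.
Proof.
under eq_integral do rewrite enorm_vsub.
have q0 : (0 <= \int[pi]_theta (sqdist ts theta)%:E)%E.
  by apply: integral_ge0 => theta _; rewrite lee_fin sqdist_ge0.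
have [qoo|qfin] := eqVneq (\int[pi]_theta (sqdist ts theta)%:E)%E +oo%E.
  rewrite qoo addye ?leey// gt_eqF// (@lt_le_trans _ _ 0%E)//.
  by rewrite mule_ge0 ?KL_ge0// lee_fin ltW.
have iq : pi.-integrable setT (EFin \o sqdist ts).
  apply/integrableP; split; first by apply/measurable_EFinP; exact: measurable_sqdist.
  under eq_integral do rewrite /= ger0_norm ?sqdist_ge0//.
  by rewrite ltey.
rewrite -(fineK (integrable_fin_num measurableT iq)) -/(Rintegral _ _ _).
have := KL_ge0 pi pi0; have := lmassN_le iq; case: (KL pi pi0) => [K| |]//.
- move=> H _; rewrite -EFinM -EFinD lee_fin.
  have il := integrable_lmass ts measurableT beta_gt0 pi0T mX iX.
  pose m i := \int[pi]_theta u theta i.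
  have is_ : P.-integrable setT (EFin \o (fun w => \sum_(i < n) m i * tnth (X w) i)).
    by apply: integrable_sumr => // i _; exact: integrable_scaler.
  have s0 : \int[P]_w (\sum_(i < n) m i * tnth (X w) i) = 0.
    rewrite Rintegral_sum// => [|i _]; last exact: integrable_scaler.
    by rewrite big1// => i _; rewrite RintegralZl// X0 mulr0.
  have ic : P.-integrable setT
      (EFin \o cst (\int[pi]_theta sqdist ts theta + beta * K)).
    exact: finite_measure_integrable_cst.
  have : \int[P]_w (- beta * lmass pi0 ts beta setT (X w)) <=
      \int[P]_w (\int[pi]_theta sqdist ts theta + beta * K
                 + - 2 * \sum_(i < n) m i * tnth (X w) i).
    apply: le_Rintegral => //; first exact: integrable_scaler.
      by apply: integrable_addr => //; exact: integrable_scaler.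
    move=> w _; have := H (X w); rewrite -EFinM -EFinD lee_fin.
    under eq_bigr do rewrite mulrC -/(m _).
    move: (lmass _ _ _ _ _) (\int[pi]_theta _) (\sum_(_ < _) _) => L q S.
    by rewrite mulNr; lra.
  rewrite RintegralD//; last exact: integrable_scaler.
  rewrite !RintegralZl// s0 mulr0 addr0 Rintegral_cst//.
  by rewrite [X in fine X]probability_setT mulr1 mulNr.
- by move=> _ _; rewrite gt0_muley ?lte_fin// addey// leey.
Qed.

End expectation.
End oracle_lower_bound.

(** * The posterior distribution as a tilted prior *)

Section posterior_tilt.
Context {R : realType} {n : nat}.
Local Notation Tn := (n.-tuple R).
Variables (pi0 : probability Tn R) (ts : Tn) (beta : R) (x : Tn).
Hypothesis beta_gt0 : 0 < beta.
Local Notation u theta i := (tnth theta i - tnth ts i).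
Local Notation post := (posterior pi0 beta (vadd ts x)).

Let pi0T : (0 < pi0 setT)%E.
Proof. by rewrite [X in (_ < X)%E]probability_setT. Qed.

Lemma gibbs_weightE theta : gibbs_weight beta (vadd ts x) theta =
  expR (- (sqn x / beta)) * tilt ts beta setT x theta.
Proof.
rewrite /gibbs_weight enormE /tilt indicT mul1r -expRD; congr expR.
rewrite -!mulNr -mulrDl; congr (_ / beta).
rewrite /sqn /sqdist mulr_sumr -!sumrN -!big_split/=; apply: eq_bigr => i _.
by rewrite !tnth_mktuple; ring.
Qed.

Lemma posterior_densityE theta : posterior_density pi0 beta (vadd ts x) theta =
  tilt ts beta setT x theta / mass pi0 ts beta setT x.
Proof.
rewrite /posterior_density gibbs_weightE.
under eq_Rintegral do rewrite gibbs_weightE.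
rewrite RintegralZl//; last exact: integrable_tilt1.
have := mass_gt0 ts beta_gt0 x measurableT pi0T; rewrite /mass.
move: (\int[pi0]_theta _) (tilt _ _ _ _ _) => m t m0.
by field; rewrite !gt_eqF// expR_gt0.
Qed.

Lemma ge0_integral_posterior (f : Tn -> R) : admissible ts f ->
  (forall theta, 0 <= f theta) ->
  (\int[post]_theta (f theta)%:E = (tavg pi0 ts beta setT x f)%:E)%E.
Proof.
move=> fa f0; have [mf _] := fa.
have mp := measurable_posterior_density pi0 beta (vadd ts x).
have -> : (\int[post]_theta (f theta)%:E =
    \int[pi0]_theta (f theta * posterior_density pi0 beta (vadd ts x) theta)%:E)%E.
  under [LHS]eq_integral do rewrite -[f _]mulr1.
  apply: (ge0_eq_integral_comp (phi1 := id) (phi2 := id) (X1 := cst 1)) => //.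
  - by move=> w; exact: posterior_density_ge0.
  - by move=> A mA; rewrite !preimage_id; apply: etrans (mul1e (post A));
      exact: (@integral_cst _ _ _ post A mA 1%E).
under eq_integral do rewrite posterior_densityE mulrA EFinM.
rewrite integralZr//; last exact: integrable_tilt.
rewrite -(fineK (integrable_fin_num measurableT (integrable_tilt pi0 beta_gt0 x measurableT fa))).
by rewrite -EFinM.
Qed.

Lemma integral_posterior (f : Tn -> R) : admissible ts f ->
  \int[post]_theta f theta = tavg pi0 ts beta setT x f.
Proof.
move=> fa; have [mf [c fc]] := fa.
(* Adding the majorant [g] of |f| reduces the signed case to two nonnegative admissible
   functions. *)
pose g theta := c * (1 + sqdist ts theta).
have ga : admissible ts g.
  apply: admissibleZ; apply: admissibleD; first exact: admissible_cst.
  exact: admissible_sqdist.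
have g0 theta : 0 <= g theta by exact: le_trans (fc theta).
have fga : admissible ts (fun theta => f theta + g theta) by exact: admissibleD.
have fg0 theta : 0 <= f theta + g theta.
  by rewrite addrC -lerBlDr sub0r; have := fc theta; rewrite ler_norml => /andP[+ _]; rewrite lerNl.
have ige0 (h : Tn -> R) : admissible ts h -> (forall theta, 0 <= h theta) ->
    post.-integrable setT (EFin \o h).
  move=> ha h0; have [mh _] := ha; apply/integrableP.
  split; first exact/measurable_EFinP.
  under eq_integral do rewrite /= ger0_norm//.
  by rewrite (ge0_integral_posterior ha h0) ltry.
have tE (h : Tn -> R) : admissible ts h -> (forall theta, 0 <= h theta) ->
    \int[post]_theta h theta = tavg pi0 ts beta setT x h.
  by move=> ha h0; rewrite /Rintegral ge0_integral_posterior.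
transitivity (\int[post]_theta (f theta + g theta) - \int[post]_theta g theta).
  by rewrite -RintegralB; [|by []|exact: ige0..]; apply: eq_Rintegral => theta _; rewrite addrK.
by rewrite !tE// tavgD// addrK.
Qed.

Lemma ewa_tnth i : tnth (ewa pi0 beta (vadd ts x)) i =
  mean pi0 ts beta setT x i + tnth ts i.
Proof.
rewrite tnth_mktuple -[RHS](congr1 (+%R _) (tavg_cst ts beta_gt0 measurableT pi0T x (tnth ts i))).
rewrite -tavgD//; [|exact: admissible_coord|exact: admissible_cst].
rewrite -integral_posterior; last first.
  by apply: admissibleD; [exact: admissible_coord|exact: admissible_cst].
by apply: eq_Rintegral => theta _ /=; rewrite subrK.
Qed.

Lemma sqr_enorm_ewaB : enorm (vsub (ewa pi0 beta (vadd ts x)) ts) ^+ 2 =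
  \sum_(i < n) mean pi0 ts beta setT x i ^+ 2.
Proof.
rewrite enorm_vsub /sqdist; apply: eq_bigr => i _.
by rewrite ewa_tnth addrK.
Qed.

Lemma vec_var_posterior : vec_var post = (var pi0 ts beta setT x)%:E.
Proof.
(* The posterior variance is taken about the origin of R^n and [var] about [ts]; the bias-variance
   identity with centre -[ts] reconciles them. *)
have E (theta : Tn) : enorm theta ^+ 2 =
    \sum_(i < n) (u theta i - - tnth ts i) ^+ 2.
  by rewrite enormE; apply: eq_bigr => i _; rewrite opprK subrK.
rewrite /vec_var -/(ewa _ _ _); under eq_integral do rewrite E.
rewrite ge0_integral_posterior.
- rewrite tavg_sqdistB// -EFinB enormE; congr EFin.
  rewrite (_ : \sum_(_ < _) _ = sqn (ewa pi0 beta (vadd ts x))) ?addrK//.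
  by apply: eq_bigr => i _; rewrite ewa_tnth opprK.
- exact: admissible_sqdistB.
- by move=> theta; apply: sumr_ge0 => i _; exact: sqr_ge0.
Qed.

End posterior_tilt.

(** * Almost sure properties and sets of positive measure *)

Section almost_everywhere.
Context {R : realType} d {T : measurableType d} (mu : probability T R).

Lemma ae_exists (Q : T -> Prop) : {ae mu, forall x, Q x} -> exists x, Q x.
Proof.
move=> aeQ; apply: contrapT => /forallNP H.
have /(negligibleP _ measurableT) E : mu.-negligible setT.
  by apply: negligibleS aeQ => x _ /=; exact: H.
by have := probability_setT mu; rewrite [X in X = _ -> _]E => /esym/eqP; rewrite onee_eq0.
Qed.

Lemma negligible_le0 (A : set T) : measurable A -> ~ (0 < mu A)%E ->
  {ae mu, forall x, ~ A x}.
Proof.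
move=> mA A0; have : mu.-negligible A.
  apply/(negligibleP _ mA); apply/eqP; rewrite eq_le measure_ge0 andbT leNgt.
  exact/negP.
by apply: negligibleS => x /= /contrapT.
Qed.

Lemma ae_measure_gt0 (A : set T) : measurable A -> {ae mu, forall x, A x} ->
  (0 < mu A)%E.
Proof.
move=> mA aeA; apply: contrapT => /(negligible_le0 mA) aeN.
by have [x []] := ae_exists (filterI aeA aeN).
Qed.

End almost_everywhere.

(** * The oracle inequality *)

Section noise.
Context {R : realType} {n : nat} d {Omega : measurableType d}.
Variables (P : probability Omega R) (F : set (set Omega)).
Hypotheses (hF : sigma_algebra setT F) (hFm : F `<=` measurable).
Local Notation Tn := (n.-tuple R).
Variables (xi : Omega -> Tn) (b v v' : R -> R).
Hypotheses (mxi : measurable_fun setT xi) (hxi : measurable_wrt F xi).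
Hypothesis hb : forall a : R, a \in `[0, 1] -> 0 <= b a.
Hypothesis hb0 : forall e : R, 0 < e -> \forall a \near (0 : R)^'+, b a < b 0 + e.
Hypothesis hv : forall a : R, a \in `[0, 1] -> 0 <= v a.
Hypotheses (hv' : C1_01 v v') (hv0 : v 0 = 0).
Hypothesis hzeta : forall alpha : R, alpha \in `]0, 1] ->
  exists zeta : {RV P >-> Tn},
    [/\ forall i, is_cond_exp P F (fun w => tnth (zeta w) i) (cst 0),
        eq_in_distribution P (fun w => vadd (xi w) (zeta w))
                             (fun w => vscale (1 + alpha) (xi w)),
        cond_independent P F zeta &
        forall i, cond_bernstein P F (v alpha) (b alpha)
                                 (fun w => tnth (zeta w) i)].

Let mxii i : measurable_fun setT (fun w => tnth (xi w) i).
Proof. exact: (measurableT_comp (measurable_tnth i) mxi). Qed.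

Let Fxii i : measurable_wrt F (fun w => tnth (xi w) i).
Proof.
apply/(measurable_wrtP hF); apply: (measurableT_comp (measurable_tnth i)).
exact/(measurable_wrtP hF).
Qed.

Let half_open_closed (a : R) : a \in `]0, 1] -> a \in `[0, 1].
Proof. by rewrite !in_itv/= => /andP[/ltW -> ->]. Qed.

Let one_in : (1 : R) \in `]0, 1].
Proof. by rewrite in_itv/= ltr01 lexx. Qed.

Lemma eq_in_distribution_tnth (zeta : Omega -> Tn) a i :
  eq_in_distribution P (fun w => vadd (xi w) (zeta w)) (fun w => vscale a (xi w)) ->
  eq_in_distribution P (fun w => tnth (xi w) i + tnth (zeta w) i)
                       (fun w => a * tnth (xi w) i).
Proof.
move=> E A mA; have := E ((fun x : Tn => tnth x i) @^-1` A).
rewrite /pushforward; under eq_fun do rewrite /=.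
move=> H; transitivity (P ((fun w => vadd (xi w) (zeta w)) @^-1`
    ((fun x : Tn => tnth x i) @^-1` A))).
  by congr (P _); apply/seteqP; split => w /=; rewrite tnth_mktuple.
rewrite H.
  by congr (P _); apply/seteqP; split => w /=; rewrite tnth_mktuple.
by rewrite -[X in measurable X]setTI; exact: measurable_tnth.
Qed.

(** The case alpha = 1, xi + zeta ~ 2 xi, is exactly the doubling relation required by
    [sqr_integral_le], and Bernstein's condition bounds the second moment of zeta. *)
Lemma integrable_sqr_noise i :
  P.-integrable setT (EFin \o (fun w => tnth (xi w) i ^+ 2)).
Proof.
have [zeta [mean0 dist ind bern]] := hzeta one_in.
have mz : measurable_fun setT (fun w => tnth (zeta w) i).
  by apply: (measurableT_comp (measurable_tnth i)).
apply/integrableP; split; first by apply/measurable_EFinP; exact: measurable_funX.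
under eq_integral do rewrite /= ger0_norm ?sqr_ge0//.
apply: le_lt_trans (ltry (16 * v 1)).
apply: (sqr_integral_le hF hFm (@Fxii i) (mean0 i)).
  exact: (eq_in_distribution_tnth i dist).
apply: (cond_bernstein_sqr_le hF hFm _ _ mz (bern i)).
- by apply: hv; exact: half_open_closed.
- by apply: hb; exact: half_open_closed.
Qed.

Lemma integrable_sqn_noise : P.-integrable setT (EFin \o (fun w => sqn (xi w))).
Proof. by apply: integrable_sumr => // i _; exact: integrable_sqr_noise. Qed.

Lemma integrable_noise i : P.-integrable setT (EFin \o (fun w => tnth (xi w) i)).
Proof.
apply: (@le_integrable_real _ _ _ P setT measurableT _
    (fun w => 1 + tnth (xi w) i ^+ 2)); first exact: mxii.
- move=> w _; rewrite -(real_normK (num_real (tnth _ _))).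
  by move: (`|_|) (normr_ge0 (tnth (xi w) i)) => y y0; have := sqr_ge0 (y - 1); nra.
- apply: integrable_addr => //; first exact: finite_measure_integrable_cst.
  exact: integrable_sqr_noise.
Qed.

(** At alpha = 1 the identity in law gives E[xi] + 0 = 2 E[xi]. *)
Lemma mean_noise i : \int[P]_w tnth (xi w) i = 0.
Proof.
have [zeta [mean0 dist _ _]] := hzeta one_in.
have mz : measurable_fun setT (fun w => tnth (zeta w) i).
  by apply: (measurableT_comp (measurable_tnth i)).
have [iz _ _ ez] := mean0 i.
have ix := integrable_noise i.
have z0 : \int[P]_w tnth (zeta w) i = 0.
  have FT : F setT by rewrite -(measurable_g_measurableTypeE hF); exact: measurableT.
  by rewrite /Rintegral -(ez _ FT) integral0.
have := eq_in_distribution_integral (f := id) (eq_in_distribution_tnth i dist).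
move=> /(_ (measurable_funD (mxii i) mz)).
move=> /(_ (measurable_funM (measurable_cst _) (mxii i)) (@measurable_id _ _ setT)).
rewrite RintegralD// RintegralZl// z0 addr0.
by move: (Rintegral _ _ _) => m; lra.
Qed.

(** Squaring the identity in law, with a cross term of mean 0, gives (2 a + a^2) E[xi_i^2] =
    E[zeta_i^2] <= 16 v a; divide by 2 a and let a tend to 0. The use is qualitative: v' 0 = 0
    leaves no noise. *)
Lemma sqr_noise_le i : \int[P]_w (tnth (xi w) i ^+ 2) <= 8 * v' 0.
Proof.
have vcvg := C1_01_cvg0 hv' hv0.
have c8 : 8 * (v a / a) @[a --> 0^'+] --> 8 * v' 0.
  by apply: cvgM => //; exact: cvg_cst.
apply: (cvgr_to_ge c8); near=> a.
have a0 : 0 < a by near: a; exact: nbhs_right_gt.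
have aI : a \in `]0, 1] by rewrite in_itv/= a0/=; near: a; exact: nbhs_right_le.
have [zeta [mean0 dist _ bern]] := hzeta aI.
have mz : measurable_fun setT (fun w => tnth (zeta w) i).
  by apply: (measurableT_comp (measurable_tnth i)).
have ix2 := integrable_sqr_noise i.
have z2 : (\int[P]_w (tnth (zeta w) i ^+ 2)%:E <= (16 * v a)%:E)%E.
  apply: (cond_bernstein_sqr_le hF hFm _ _ mz (bern i)).
  - by apply: hv; exact: half_open_closed.
  - by apply: hb; exact: half_open_closed.
have iz2 : P.-integrable setT (EFin \o (fun w => tnth (zeta w) i ^+ 2)).
  apply/integrableP; split; first by apply/measurable_EFinP; exact: measurable_funX.
  under eq_integral do rewrite /= ger0_norm ?sqr_ge0//.
  exact: le_lt_trans (ltry (16 * v a)).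
have {}z2 : \int[P]_w (tnth (zeta w) i ^+ 2) <= 16 * v a.
  by rewrite -lee_fin fineK// integrable_fin_num.
have ixz : P.-integrable setT (fun w => (tnth (xi w) i * tnth (zeta w) i)%:E).
  apply: (@le_integrable_real _ _ _ P setT measurableT
      (fun w => tnth (xi w) i * tnth (zeta w) i)
      (fun w => tnth (xi w) i ^+ 2 + tnth (zeta w) i ^+ 2)).
  - exact: measurable_funM.
  - move=> w _; move: (tnth _ _) (tnth _ _) => x z.
    have := sqr_ge0 (x - z); have := sqr_ge0 (x + z).
    by move=> *; rewrite ler_norml; apply/andP; split; nra.
  - exact: integrable_addr.
have xz0 : \int[P]_w (tnth (xi w) i * tnth (zeta w) i) = 0.
  by rewrite /Rintegral (cond_exp0_pull_out hF hFm (mean0 i) (@Fxii i) ixz).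
have := eq_in_distribution_integral (f := fun x : R => x ^+ 2)
  (eq_in_distribution_tnth i dist).
move=> /(_ (measurable_funD (mxii i) mz)).
move=> /(_ (measurable_funM (measurable_cst _) (mxii i))).
move=> /(_ (measurable_funX _ (@measurable_id _ _ setT))).
under eq_Rintegral do rewrite sqrrD -mulr_natl.
under [X in _ = X -> _]eq_Rintegral do rewrite exprMn.
rewrite RintegralD//; last first.
  by apply: integrable_addr => //; exact: integrable_scaler.
rewrite RintegralD//; last exact: integrable_scaler.
rewrite RintegralZl// xz0 mulr0 addr0 RintegralZl//.
have x20 : 0 <= \int[P]_w (tnth (xi w) i ^+ 2).
  by apply: Rintegral_ge0 => w _; exact: sqr_ge0.
move: z2 x20; move: (\int[P]_w (tnth (zeta w) i ^+ 2)) => Z.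
move: (\int[P]_w (tnth (xi w) i ^+ 2)) => X Zv X0 E.
rewrite mulrA ler_pdivlMr//.
have a2X : 0 <= a ^+ 2 * X by rewrite mulr_ge0// sqr_ge0.
by nra.
Unshelve. all: by end_near. Qed.

Lemma dot_mean_le_box (pi0 : probability Tn R) (ts : Tn) (beta : R) (B : set Tn)
    (l : 'I_n -> R) (D : R) :
  0 < beta -> measurable B -> (0 < pi0 B)%E -> 0 <= D -> 2 * b 0 * D < beta ->
  (forall theta, B theta -> forall i, l i <= tnth theta i - tnth ts i <= l i + D) ->
  2 * \int[P]_w (\sum_(i < n) tnth (xi w) i * mean pi0 ts beta B (xi w) i) <=
  2 * v' 0 / (beta - 2 * b 0 * D) * \int[P]_w var pi0 ts beta B (xi w).
Proof.
move=> beta0 mB B0 D0 bD box.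
have ixi := integrable_sqn_noise.
set S := \int[P]_w _; set V := \int[P]_w _.
have V0 : 0 <= V by apply: Rintegral_ge0 => w _; exact: var_ge0.
apply/ler_addgt0Pr => q q0.
(* The error contributed by [e] is beta e V, at most [q]; the 1 keeps the denominator positive when
   V = 0. *)
pose e := q / (beta * (V + 1)).
have e0 : 0 < e by rewrite divr_gt0// mulr_gt0// ltr_wpDl.
have [a [aI baD Ka]] := curvature_limit n beta0 D0 bD hb hb0 hv hv' hv0 e0.
have a0 : 0 < a by move: aI; rewrite in_itv/= => /andP[].
have [zeta [mean0 dist ind bern]] := hzeta aI.
have key : a * (2 / beta * S) <= curvature n beta (v a) (b a) D * V.
  apply: (key_inequality_box hF hFm hxi _ ixi mean0 dist _ _ ind bern beta0 mB B0 D0 baD box).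
  - by [].
  - by apply: hv; exact: half_open_closed.
  - by apply: hb; exact: half_open_closed.
have {}key := le_trans key (ler_wpM2r V0 Ka).
rewrite -[X in _ <= X]mulrA ler_pM2l// in key.
have eV : beta * e * V <= q.
  have -> : beta * e * V = q * (V / (V + 1)).
    by rewrite /e; field; rewrite !gt_eqF// ltr_wpDl.
  by rewrite ler_piMr ?(ltW q0)// ler_pdivrMr ?ltr_wpDl// mul1r lerDl.
have : beta * (2 / beta * S) <= beta * ((2 * v' 0 / (beta * (beta - 2 * b 0 * D)) + e) * V).
  by rewrite ler_pM2l.
have -> : beta * (2 / beta * S) = 2 * S by field; rewrite gt_eqF.
have -> : beta * ((2 * v' 0 / (beta * (beta - 2 * b 0 * D)) + e) * V) =
  2 * v' 0 / (beta - 2 * b 0 * D) * V + beta * e * V.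
  by field; rewrite !gt_eqF// subr_gt0.
by move: (_ / _ * V) (beta * e * V) eV => x y; lra.
Qed.

Section aggregate.
Variables (pi0 : probability Tn R) (ts : Tn) (beta : R).
Hypothesis beta_gt0 : 0 < beta.

Let pi0T : (0 < pi0 setT)%E.
Proof. by rewrite [X in (_ < X)%E]probability_setT. Qed.

Local Notation int_dot B := (\int[P]_w (\sum_(i < n) tnth (xi w) i * mean pi0 ts beta B (xi w) i)).
Local Notation int_second B := (\int[P]_w second pi0 ts beta B (xi w)).
Local Notation int_var B := (\int[P]_w var pi0 ts beta B (xi w)).
Local Notation int_lmass B := (\int[P]_w lmass pi0 ts beta B (xi w)).

Lemma int_second_le B : measurable B -> (0 < pi0 B)%E ->
  int_second B <= 2 * int_dot B - beta * int_lmass B.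
Proof.
move=> mB B0; have ix := integrable_sqn_noise.
have is_ := integrable_second ts mB beta_gt0 B0 mxi ix.
have id_ := integrable_dot_mean ts mB beta_gt0 B0 mxi ix.
have il := integrable_lmass ts mB beta_gt0 B0 mxi ix.
rewrite -!RintegralZl// -RintegralB//; last 2 first.
- exact: integrable_scaler.
- exact: integrable_scaler.
apply: le_Rintegral => //; last by move=> w _; exact: second_le.
by apply: integrable_subr => //; exact: integrable_scaler.
Qed.

(** Requiring 2 b 0 D k to be the same [e] for every k keeps the coefficient constant along the
    exhaustion. This covers both uses: a constant box, and growing boxes with b 0 = 0. *)
Lemma int_second_le_boxes (B : (set Tn)^nat) (l : nat -> 'I_n -> R) (D : nat -> R)
    (e : R) :
  e < beta -> (forall k, measurable (B k)) ->
  (forall k m, (k <= m)%N -> B k `<=` B m) -> (0 < pi0 (B 0%N))%E ->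
  {ae pi0, forall theta, exists k, B k theta} ->
  (forall k, 0 <= D k) -> (forall k, 2 * b 0 * D k = e) ->
  (forall k theta, B k theta ->
     forall i, l k i <= tnth theta i - tnth ts i <= l k i + D k) ->
  int_second setT <= 2 * v' 0 / (beta - e) * int_var setT - beta * int_lmass setT.
Proof.
move=> ebeta mB B_homo B0 B_full D0 De box.
have Bk k : (0 < pi0 (B k))%E.
  by apply: (lt_le_trans B0); apply: le_measure; rewrite ?inE//; exact: B_homo.
apply: (second_le_exhaustion beta_gt0 mB B_homo B0 B_full mxi integrable_sqn_noise).
move=> k; apply: (le_trans (int_second_le (mB k) (Bk k))).
rewrite lerD2r -[e](De k); apply: (dot_mean_le_box beta_gt0 (mB k) (Bk k) (D0 k) _ (box k)).
by rewrite De.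
Qed.

Lemma measurable_box (l r : 'I_n -> R) : measurable
  [set theta : Tn | forall i, l i <= tnth theta i - tnth ts i <= r i].
Proof.
rewrite (_ : mkset _ = \bigcap_(i in [set: 'I_n])
    ((fun theta : Tn => tnth theta i - tnth ts i) @^-1` `[l i, r i]%classic)).
  apply: fin_bigcap_measurable => // i _; rewrite -[X in measurable X]setTI.
  exact: measurable_coord.
apply/seteqP; split=> theta H i; first by move=> _ /=; rewrite in_itv/=.
by have := H i I; rewrite /= in_itv.
Qed.

Lemma int_second_le_unbounded : b 0 = 0 ->
  int_second setT <= 2 * v' 0 / beta * int_var setT - beta * int_lmass setT.
Proof.
move=> b00.
pose C k : set Tn :=
  [set theta | forall i, - k%:R <= tnth theta i - tnth ts i <= k%:R].
have mC k : measurable (C k) by exact: measurable_box.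
have C_homo k m : (k <= m)%N -> C k `<=` C m.
  move=> km theta H i; have /andP[h1 h2] := H i; have : (k%:R : R) <= m%:R by rewrite ler_nat.
  by move=> h; apply/andP; split; lra.
have CT : \bigcup_k C k = setT.
  apply/seteqP; split => // theta _.
  pose s := \sum_(i < n) `|tnth theta i - tnth ts i|.
  exists (Num.bound s) => // i.
  rewrite -ler_norml (le_trans _ (ltW (archi_boundP _)))//; last exact: sumr_ge0.
  by rewrite /s (bigD1 i)//= lerDl sumr_ge0.
(* The exhaustion must start from a set of positive prior mass; the cubes cover the space, so they
   are not all null, and the sequence is shifted by [K]. *)
have [K CK] : exists K, (0 < pi0 (C K))%E.
  apply: contrapT => /forallNP H.
  have : {ae pi0, forall theta, forall k, ~ C k theta}.
    apply: negligibleS (negligible_bigcup (fun k => negligible_le0 (mC k) (H k))).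
    by move=> theta /= /existsNP[k Hk]; exists k.
  move=> /ae_exists[theta N]; have : setT theta by [].
  by rewrite -CT => -[k _ /N].
rewrite -[X in _ / X * _]subr0.
apply: (@int_second_le_boxes (fun k => C (K + k)%N)
  (fun k _ => - (K + k)%:R) (fun k => 2 * (K + k)%:R)) => //.
- by move=> k m km; apply: C_homo; rewrite leq_add2l.
- by rewrite addn0.
- apply: aeW => theta; have : setT theta by []; rewrite -CT => -[k _ Ck].
  by exists k; apply: C_homo Ck; rewrite leq_addl.
- by move=> k; rewrite b00 mulr0 mul0r.
- by move=> k theta H i; have /andP[h1 h2] := H i; apply/andP; split; lra.
Qed.

Lemma int_second_le_bounded (S0 : set Tn) (D : R) :
  {ae pi0, forall theta, S0 theta} -> (sup_diam S0 <= D%:E)%E ->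
  2 * b 0 * D < beta ->
  int_second setT <=
  2 * v' 0 / (beta - 2 * b 0 * D) * int_var setT - beta * int_lmass setT.
Proof.
move=> hS0 hD bD.
have coordD i theta theta' : S0 theta -> S0 theta' ->
    tnth theta i - tnth theta' i <= D.
  move=> S S'; rewrite -lee_fin; apply: le_trans hD.
  apply: (@le_trans _ _ (supnorm (vsub theta theta'))%:E); last first.
    by apply: ereal_sup_ubound; exists theta, theta'.
  rewrite lee_fin; apply: (le_trans (ler_norm _)).
  have -> : tnth theta i - tnth theta' i = tnth (vsub theta theta') i.
    by rewrite tnth_mktuple.
  by rewrite /supnorm; exact: (le_bigmax _ (fun i => `|tnth (vsub theta theta') i|)).
have [theta0 S00] := ae_exists hS0.
have D0 : 0 <= D.
  rewrite -lee_fin; apply: le_trans hD.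
  apply: (@le_trans _ _ (supnorm (vsub theta0 theta0))%:E); last first.
    by apply: ereal_sup_ubound; exists theta0, theta0.
  by rewrite lee_fin /supnorm; exact: bigmax_ge_id.
(* [S0] need not be measurable. The diameter bound puts each coordinate in an interval of length D
   starting at its infimum over [S0], which gives a measurable box containing [S0]. *)
pose E i := [set tnth theta i - tnth ts i | theta in S0].
have E0 i : E i !=set0 by exists (tnth theta0 i - tnth ts i); exists theta0.
have lbE i theta : S0 theta -> lbound (E i) (tnth theta i - tnth ts i - D).
  by move=> S _ [theta' S' <-]; have := coordD i _ _ S S'; lra.
pose B := [set theta : Tn | forall i, inf (E i) <= tnth theta i - tnth ts i <=
                            inf (E i) + D].
have SB : S0 `<=` B.
  move=> theta S i; apply/andP; split.
    by apply: ge_inf; [exists (tnth theta i - tnth ts i - D); exact: lbE|exists theta].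
  by rewrite -lerBlDr; apply: lb_le_inf => //; exact: lbE.
have mB : measurable B by exact: measurable_box.
have B_full : {ae pi0, forall theta, B theta} by apply: filterS hS0 => theta; exact: SB.
apply: (@int_second_le_boxes (fun=> B) (fun _ i => inf (E i)) (fun=> D)) => //.
- by move=> k m _ theta.
- exact: ae_measure_gt0.
- by apply: filterS B_full => theta Bt; exists 0%N.
Qed.

Lemma int_dot_degenerate : v' 0 = 0 -> int_dot setT = 0.
Proof.
move=> v'0.
have z i : {ae P, forall w, tnth (xi w) i = 0}.
  have : (\int[P]_w `|(tnth (xi w) i ^+ 2)%:E| = 0)%E.
    under eq_integral do rewrite gee0_abs ?lee_fin ?sqr_ge0//.
    rewrite -(fineK (integrable_fin_num measurableT (integrable_sqr_noise i))).
    congr EFin; apply/eqP; rewrite eq_le -[X in X <= _]/(\int[P]_w _).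
    have := sqr_noise_le i; rewrite v'0 mulr0 => ->/=.
    by apply: Rintegral_ge0 => w _; exact: sqr_ge0.
  move=> /(ae_eq_integral_abs _ measurableT) H.
  have := H (measurable_int _ (integrable_sqr_noise i)).
  apply: filterS => w /(_ I) /= [] /eqP; by rewrite sqrf_eq0 => /eqP.
have Z : {ae P, forall w, forall i, tnth (xi w) i = 0} by exact: filter_forall.
transitivity (\int[P]_w (0 : R)); last by rewrite Rintegral_cst// mul0r.
rewrite /Rintegral; congr fine; apply: ae_eq_integral => //.
- exact: measurable_int (integrable_dot_mean ts measurableT beta_gt0 pi0T mxi integrable_sqn_noise).
- by apply: filterS Z => w Zw _; rewrite big1// => i _; rewrite Zw mul0r.
Qed.

(** One noise value with zero variance is enough: the tilt is positive everywhere, so u = c holds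
    [pi0]-almost everywhere. The tilted mean is then c at every noise value, and the centring of xi
    annihilates the integral of xi.c. *)
Lemma int_dot_dirac : int_var setT = 0 -> int_dot setT = 0.
Proof.
move=> V0.
have iv := integrable_var ts measurableT beta_gt0 pi0T mxi integrable_sqn_noise.
have [w0 vw0] : exists w, var pi0 ts beta setT (xi w) = 0.
  have : (\int[P]_w `|(var pi0 ts beta setT (xi w))%:E| = 0)%E.
    under eq_integral do rewrite gee0_abs ?lee_fin ?var_ge0//.
    by rewrite -(fineK (integrable_fin_num measurableT iv)) [X in X%:E]V0.
  move=> /(ae_eq_integral_abs _ measurableT) H.
  have {H} H := H (measurable_int _ iv).
  by apply: ae_exists; apply: filterS H => w /(_ I) /= [].
pose c i := mean pi0 ts beta setT (xi w0) i.
have m0 := mass_gt0 ts beta_gt0 (xi w0) measurableT pi0T.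
have fa := admissible_sqdistB ts c.
have pc : {ae pi0, forall theta, forall i, tnth theta i - tnth ts i = c i}.
  have it := integrable_tilt pi0 beta_gt0 (xi w0) measurableT fa.
  have : (\int[pi0]_theta `|((\sum_(i < n) (tnth theta i - tnth ts i - c i) ^+ 2)
      * tilt ts beta setT (xi w0) theta)%:E| = 0)%E.
    under eq_integral.
      move=> theta _; rewrite gee0_abs; last first.
        rewrite lee_fin mulr_ge0 ?tilt_ge0// sumr_ge0// => i _; exact: sqr_ge0.
      over.
    rewrite -(fineK (integrable_fin_num measurableT it)); congr EFin.
    rewrite -[LHS]/(\int[pi0]_theta _) RintegralM_tilt// tavg_sqdistB// vw0 add0r.
    by rewrite big1 ?mul0r// => i _; rewrite subrr expr0n.
  move=> /(ae_eq_integral_abs _ measurableT) H.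
  have := H (measurable_int _ it).
  apply: filterS => theta /(_ I) /= [] /eqP; rewrite mulf_eq0 => /orP[|]; last first.
    by rewrite /tilt indicT mul1r gt_eqF// expR_gt0.
  rewrite psumr_eq0 => [|i _]; last exact: sqr_ge0.
  move=> /allP E i; have := E i; rewrite mem_index_enum => /(_ isT) /=.
  by rewrite sqrf_eq0 subr_eq0 => /eqP.
have mc x i : mean pi0 ts beta setT x i = c i.
  rewrite -[RHS](tavg_cst ts beta_gt0 measurableT pi0T x).
  rewrite /mean /tavg; congr (fine _ / _); apply: ae_eq_integral => //.
  - exact: measurable_int (integrable_tilt pi0 beta_gt0 x measurableT (admissible_coord ts i)).
  - exact: measurable_int (integrable_tilt pi0 beta_gt0 x measurableT (admissible_cst ts _)).
  - by apply: filterS pc => theta H _; rewrite H.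
under eq_Rintegral do under eq_bigr do rewrite mc mulrC.
rewrite Rintegral_sum// => [|i _].
  by rewrite big1// => i _; rewrite RintegralZl ?mean_noise ?mulr0//; exact: integrable_noise.
by apply: integrable_scaler => //; exact: integrable_noise.
Qed.

Lemma int_sqmeanE : \int[P]_w (\sum_(i < n) mean pi0 ts beta setT (xi w) i ^+ 2) =
  int_second setT - int_var setT.
Proof.
have ix := integrable_sqn_noise.
have is_ := integrable_second ts measurableT beta_gt0 pi0T mxi ix.
have iv := integrable_var ts measurableT beta_gt0 pi0T mxi ix.
rewrite -RintegralB//; apply: eq_Rintegral => w _.
by rewrite /var opprB addrCA subrr addr0.
Qed.

Lemma oracle_bound_ge :
  ((- (beta * int_lmass setT))%:E <= oracle_bound pi0 beta ts)%E.
Proof.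
apply: le_ereal_inf_tmp => _ [rho _ <-].
exact: (@int_lmassN_le _ _ pi0 rho ts beta beta_gt0 _ _ P xi mxi
  integrable_sqn_noise integrable_noise mean_noise).
Qed.

Lemma int_var_ge0 : 0 <= int_var setT.
Proof. by apply: Rintegral_ge0 => w _; exact: var_ge0. Qed.

Lemma diam_ge0 (S0 : set Tn) : {ae pi0, forall theta, S0 theta} ->
  (0 <= sup_diam S0)%E.
Proof.
move=> /ae_exists[theta S]; apply: (@le_trans _ _ (supnorm (vsub theta theta))%:E).
  by rewrite lee_fin; exact: bigmax_ge_id.
by apply: ereal_sup_ubound; exists theta, theta.
Qed.

Let oracle_real (c : R) :
  int_second setT <= c * int_var setT - beta * int_lmass setT ->
  ((\int[P]_w (\sum_(i < n) mean pi0 ts beta setT (xi w) i ^+ 2))%:E <=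
   oracle_bound pi0 beta ts + (c%:E - 1) * (int_var setT)%:E)%E.
Proof.
rewrite int_sqmeanE; have := oracle_bound_ge; move: (oracle_bound _ _ _) => O.
move: (int_second _) (int_var _) (int_lmass _) => Q V L LO H.
rewrite -EFinB -EFinM; apply: (le_trans _ (leeD2r _ LO)).
by rewrite -EFinD lee_fin mulrBl mul1r; move: (c * V) (beta * L) H => *; lra.
Qed.

(* At [beta = 2 * b 0 * D0] the coefficient is +oo, except when [v' 0 = 0], which
   forces [xi = 0] almost surely, or when the expected variance vanishes, which
   forces [pi0] to be a Dirac mass; both make the noise term disappear. *)
Lemma oracle_inequality (S0 : set Tn) (D0 : \bar R) :
  {ae pi0, forall theta, S0 theta} -> (sup_diam S0 <= D0)%E ->
  ((2 * b 0)%:E * D0 <= beta%:E)%E ->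
  ((\int[P]_w (\sum_(i < n) mean pi0 ts beta setT (xi w) i ^+ 2))%:E <=
   oracle_bound pi0 beta ts
   + ((2 * v' 0)%:E / (beta%:E - (2 * b 0)%:E * D0) - 1) * (int_var setT)%:E)%E.
Proof.
move=> hS0 hD; have D0_ge0 := le_trans (diam_ge0 hS0) hD.
have b0 : 0 <= b 0 by apply: hb; rewrite in_itv/= lexx ler01.
move: D0 D0_ge0 hD => [D| |]// D_ge0 hD; last first.
  move: b0; rewrite le_eqVlt => /predU1P[b00|b00]; last first.
    by rewrite gt0_muley ?lte_fin ?mulr_gt0// leye_eq.
  move=> _; rewrite -b00 mulr0 mul0e sube0 inver gt_eqF// -EFinM.
  by apply: oracle_real; exact: int_second_le_unbounded.
rewrite -EFinM lee_fin le_eqVlt => /predU1P[bD|bD]; last first.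
  rewrite -EFinB inver gt_eqF ?subr_gt0// -EFinM.
  by apply: oracle_real; exact: int_second_le_bounded hD bD.
have := C1_01_deriv_ge0 hv' hv0 hv; rewrite le_eqVlt => /predU1P[v'0|v'0].
  (* The quotient is 0 times +oo, that is 0, so the coefficient to be proved is -1. *)
  rewrite -v'0 mulr0 mul0e -[X in (X - 1)%E]/(0%R%:E); apply: oracle_real.
  have := int_second_le measurableT pi0T.
  by rewrite (int_dot_degenerate (esym v'0)) mulr0 mul0r.
rewrite -EFinB bD subrr inver eqxx gt0_muley ?lte_fin ?mulr_gt0//.
rewrite addye//.
have := int_var_ge0; rewrite le_eqVlt => /predU1P[V0|V0]; last first.
  rewrite gt0_mulye ?lte_fin// addey ?leey// gt_eqF//.
  by apply: lt_le_trans oracle_bound_ge; rewrite ltNyr.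
rewrite -V0 mule0 adde0 int_sqmeanE -V0 subr0.
apply: le_trans oracle_bound_ge; rewrite lee_fin.
have := int_second_le measurableT pi0T.
by rewrite (int_dot_dirac (esym V0)) mulr0 sub0r.
Qed.

End aggregate.

End noise.

(* - [hxi]: the conditioning sigma-algebra F contains sigma(xi). Without it F
     could be trivial and zeta := alpha *: xi would be admissible.
   - [hb0]: limsup_(a -> 0+) b a <= b 0, in particular any b continuous at 0.
     Without it the value b 0 would be unrelated to the noise.
   - D0 may be +oo; with b 0 = 0 the product (2 * b 0)%:E * D0 is then 0.
   - In \bar R, 0^-1 = +oo and 0 * +oo = 0, which is the convention needed for
     the coefficient when beta = 2 * b 0 * D0. *)
Theorem theorem1 (R : realType) (n : nat)
  (d : measure_display) (Omega : measurableType d) (P : probability Omega R)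
  (theta_star : n.-tuple R) (xi : {RV P >-> n.-tuple R})
  (Y : Omega -> n.-tuple R) (hY : forall w, Y w = vadd theta_star (xi w))
  (S0 : set (n.-tuple R)) (D0 : \bar R) (pi0 : probability (n.-tuple R) R)
  (hS0 : {ae pi0, forall theta, S0 theta})
  (hD0 : (sup_diam S0 <= D0)%E)
  (F : set (set Omega)) (hF : sigma_algebra setT F) (hFm : F `<=` measurable)
  (hxi : measurable_wrt F xi)
  (b v v' : R -> R)
  (hb : forall a : R, a \in `[0, 1] -> 0 <= b a)
  (hb0 : forall e : R, 0 < e -> \forall a \near (0 : R)^'+, b a < b 0 + e)
  (hv : forall a : R, a \in `[0, 1] -> 0 <= v a)
  (hv' : C1_01 v v')
  (hv0 : v 0 = 0)
  (hzeta : forall alpha : R, alpha \in `]0, 1] ->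
     exists zeta : {RV P >-> n.-tuple R},
       [/\ forall i, is_cond_exp P F (fun w => tnth (zeta w) i) (cst 0),
           eq_in_distribution P (fun w => vadd (xi w) (zeta w))
                                (fun w => vscale (1 + alpha) (xi w)),
           cond_independent P F zeta &
           forall i, cond_bernstein P F (v alpha) (b alpha)
                                    (fun w => tnth (zeta w) i)]) :
  (forall beta : R, 0 < beta -> ((2 * b 0)%:E * D0 <= beta%:E)%E ->
     ('E_P[fun w => (enorm (vsub (ewa pi0 beta (Y w)) theta_star) ^+ 2)%R]
      <= oracle_bound pi0 beta theta_star
         + ((2 * v' 0)%:E / (beta%:E - (2 * b 0)%:E * D0) - 1)
           * \int[P]_w vec_var (posterior pi0 beta (Y w)))%E)
  /\
  (forall beta : R, 0 < beta ->
     ((2 * v' 0)%:E + (2 * b 0)%:E * D0 <= beta%:E)%E ->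
     ('E_P[fun w => (enorm (vsub (ewa pi0 beta (Y w)) theta_star) ^+ 2)%R]
      <= oracle_bound pi0 beta theta_star)%E).
Proof.
have mxi : measurable_fun setT xi by [].
have oracle beta (beta_gt0 : 0 < beta) := @oracle_inequality R n d Omega P F hF hFm
  xi b v v' mxi hxi hb hb0 hv hv' hv0 hzeta pi0 theta_star beta beta_gt0 S0 D0 hS0 hD0.
have pi0T : (0 < pi0 setT)%E by rewrite [X in (_ < X)%E]probability_setT.
have ixi := integrable_sqn_noise hF hFm mxi hxi hb hv hzeta.
have riskE beta (beta_gt0 : 0 < beta) :
    ('E_P[fun w => (enorm (vsub (ewa pi0 beta (Y w)) theta_star) ^+ 2)%R] =
     (\int[P]_w (\sum_(i < n) mean pi0 theta_star beta setT (xi w) i ^+ 2)%R)%R%:E)%E.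
  rewrite unlock; under eq_integral do rewrite hY sqr_enorm_ewaB//.
  rewrite fineK//; apply: integrable_fin_num => //.
  apply: (@le_integrable_real _ _ _ P setT measurableT _ _ _ _
    (integrable_second theta_star measurableT beta_gt0 pi0T mxi ixi)).
  - apply: measurable_sum => i; apply: measurable_funX.
    exact: (measurableT_comp (measurable_mean theta_star measurableT beta_gt0 pi0T i) mxi).
  - move=> w _; rewrite ger0_norm; first exact: sqmean_le.
    by apply: sumr_ge0 => i _; exact: sqr_ge0.
have varE beta (beta_gt0 : 0 < beta) :
    (\int[P]_w vec_var (posterior pi0 beta (Y w)) =
     (\int[P]_w var pi0 theta_star beta setT (xi w))%R%:E)%E.
  under eq_integral do rewrite hY vec_var_posterior//.
  rewrite fineK// integrable_fin_num//.
  exact: (integrable_var theta_star measurableT beta_gt0 pi0T mxi ixi).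
have part1 : forall beta : R, 0 < beta -> ((2 * b 0)%:E * D0 <= beta%:E)%E ->
    ('E_P[fun w => (enorm (vsub (ewa pi0 beta (Y w)) theta_star) ^+ 2)%R]
      <= oracle_bound pi0 beta theta_star
         + ((2 * v' 0)%:E / (beta%:E - (2 * b 0)%:E * D0) - 1)
           * \int[P]_w vec_var (posterior pi0 beta (Y w)))%E.
  by move=> beta beta_gt0 bD; rewrite riskE// varE//; exact: oracle.
split=> // beta beta_gt0 bD.
have v'0 : (0 <= (2 * v' 0)%:E)%E.
  by rewrite lee_fin mulr_ge0// (C1_01_deriv_ge0 hv' hv0 hv).
have b0 : (0 <= (2 * b 0)%:E)%E.
  by rewrite lee_fin mulr_ge0// hb// in_itv/= lexx ler01.
have e0 : (0 <= (2 * b 0)%:E * D0)%E.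
  by apply: mule_ge0 => //; exact: le_trans (diam_ge0 hS0) hD0.
have eb : ((2 * b 0)%:E * D0 <= beta%:E)%E by apply: le_trans bD; rewrite leeDr.
apply: (le_trans (part1 _ beta_gt0 eb)).
rewrite -[leRHS]adde0 leeD2l// varE//.
apply: mule_le0_ge0; last by rewrite lee_fin; apply: Rintegral_ge0 => w _; exact: var_ge0.
rewrite sube_le0; move: e0 eb bD v'0; case: (_ * D0)%E => [e| |]//.
rewrite -EFinD -EFinB !lee_fin => e0 eb ab a0; rewrite inver.
(* If the denominator vanishes, the condition on beta leaves no room for 2 v' 0, so the quotient is
   again 0 times +oo = 0. *)
case: eqVneq => [be|be].
  have -> : 2 * v' 0 = 0 by apply/eqP; rewrite eq_le a0 andbT; lra.
  by rewrite mul0e.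
rewrite -EFinM lee_fin ler_pdivrMr; last by rewrite lt_neqAle eq_sym be subr_ge0.
by rewrite mul1r; lra.
Qed.
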